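(* Let $w_0\in H^2(0,1)$, let $w$ be the solution of the closed-loop problem and $w_h$ the semidiscrete finite element solution described in the context, with $\alpha$ as in the context. Then, with implied constants independent of $h$ and $t$, $$\|(w-w_h)(t)\|_r=O\Big(\frac{1}{\sqrt\mu}\,h^{2-r}e^{-\alpha t}\Big),\qquad r=0,1,$$ and $$|||(w-w_h)(t)|||=O\big(h\,e^{-\alpha t}\big).$$
   Context: Constants: $\mu>0$, $\nu>0$, $w_d\ge 0$, $c_0>0$, $c_1>0$ (fixed, as is $w_0$). $\|\cdot\|=\|\cdot\|_0$ and $(\cdot,\cdot)$ are the norm and inner product of $L^2(0,1)$; $\|\cdot\|_m$ is the $H^m(0,1)$ norm; subscripts $x,t$ denote derivatives; $|||z|||^2=z^2(0)+z^2(1)+\|z_x\|^2$. Closed-loop problem: $w=w(x,t)$, $x\in(0,1)$, $t>0$, satisfies $$w_t-\mu w_{xxt}-\nu w_{xx}+(1+w_d)w_x+ww_x=0,\qquad w(x,0)=w_0(x),$$ $$w_x(0,t)=\frac1\nu\Big((c_0+1+w_d)w(0,t)+\frac{2}{9c_0}w^3(0,t)\Big),\qquad w_x(1,t)=-\frac1\nu\Big((c_1+1+w_d)w(1,t)+\frac{2}{9c_1}w^3(1,t)\Big).$$ Standing well-posedness assumption: for $w_0\in H^2(0,1)$ there is a unique weak solution with $w(t)\in H^1(0,1)$, $w_t\in L^2(L^2)$, $\mu w_t\in L^2(H^1)$, and it satisfies $\|w(t)\|_2^2+\|w_t(t)\|^2+\mu\|w_{xt}(t)\|^2+\int_0^t(\|w_t(s)\|_1^2+\mu\|w_{xxt}(s)\|^2)\,ds\le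 C$. Finite element space: for a partition $0=x_0<\dots<x_N=1$ with mesh size $h=\max_j(x_j-x_{j-1})$, $V_h$ is the space of continuous functions on $[0,1]$ that are affine on each $(x_{j-1},x_j)$. Semidiscrete solution: $w_h(t)\in V_h$, $t>0$, satisfies $w_h(0)=w_{0h}$ and, for all $\chi\in V_h$, $$(w_{ht},\chi)+\mu(w_{hxt},\chi_x)+\nu(w_{hx},\chi_x)+(1+w_d)(w_{hx},\chi)+(w_hw_{hx},\chi)+\sum_{i=0}^1\Big((1+c_i+w_d)w_h(i,t)+\frac{2}{9c_i}w_h^3(i,t)\Big)\chi(i)+\frac{\mu}{\nu}\sum_{i=0}^1\Big((c_i+1+w_d)w_{ht}(i,t)+\frac{2}{3c_i}w_h^2(i,t)w_{ht}(i,t)\Big)\chi(i)=0.$$ Here $w_{0h}\in V_h$ is the $H^1$-projection of $w_0$: $(w_{0x}-w_{0hx},\chi_x)+\lambda(w_0-w_{0h},\chi)=0$ for all $\chi\in V_h$, with $\lambda>0$ fixed. The number $\alpha$ is any real with $$0\le\alpha\le\frac12\min\Big\{\frac{\nu}{\mu+1},\ \frac{\nu}{2\mu+\nu},\ \frac{\nu(1+c_i+w_d)}{\nu+(1+c_i+w_d)\mu}\ (i=0,1)\Big\}.$$ *)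

(* Defs.v *)
From HB Require Import structures.
From mathcomp Require Import all_boot all_order all_algebra.
From mathcomp Require Import all_classical all_reals all_analysis.

Set Implicit Arguments.
Unset Strict Implicit.
Unset Printing Implicit Defensive.

Import Order.TTheory GRing.Theory Num.Theory.
Import numFieldNormedType.Exports.

Local Open Scope classical_set_scope.
Local Open Scope ring_scope.

Section Sobolev.
Context {R : realType}.
Implicit Types (f g u v : R -> R) (I : interval R).

Local Notation leb := (@lebesgue_measure R).
Local Notation I01 := (`]0%R, 1%R[%classic : set R).

(* C^1 functions with compact support in the open interval I. *)
Definition test_function I (phi : R -> R) : Prop :=
  [/\ forall x : R, derivable phi x 1, continuous phi^`()%classic &
      exists a b, [/\ a \in I, b \in I &
        forall x, x \notin `[a, b] -> phi x = 0]].

(* g is the weak derivative of f on I; both are meant to be locally integrable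
   on I, which every use below guarantees. *)
Definition weak_deriv I f g : Prop := forall phi, test_function I phi ->
  \int[leb]_(x in [set` I]) (f x * (phi^`())%classic x) =
  - \int[leb]_(x in [set` I]) (g x * phi x).

Definition L2 f : Prop := (f \_ I01) \in Lfun leb 2%:E.

Definition ip f g : R := \int[leb]_(x in I01) (f x * g x).

Definition L2norm f : R := Num.sqrt (ip f f).

(* Membership in the Sobolev space H^m(0,1). *)
Fixpoint Hm (m : nat) f : Prop :=
  if m is m'.+1 then
    L2 f /\ exists2 g, weak_deriv `]0, 1[ f g & Hm m' g
  else L2 f.

(* A representative of the weak derivative of f in L^2(0,1) (and 0 if there is
   none): it is determined almost everywhere on (0,1), and only enters
   integrals over (0,1). *)
Definition wD f : R -> R :=
  xget (cst 0) [set g | L2 g /\ weak_deriv `]0, 1[ f g].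

Definition Hnorm (m : nat) f : R :=
  Num.sqrt (\sum_(k < m.+1) L2norm (iter k wD f) ^+ 2).

(* The representative to which the point values f 0 and f 1 refer. *)
Definition cont01 f : Prop := {within `[0, 1], continuous f}.

Definition triple_norm f : R :=
  Num.sqrt (f 0 ^+ 2 + f 1 ^+ 2 + L2norm (wD f) ^+ 2).

(* The Bochner space L^2(0,T; H^m(0,1)), with elements represented by jointly
   measurable functions of (t, x). *)
Definition L2L2 (T : R) (u : R -> R -> R) : Prop :=
  measurable_fun ((`]0, T[%classic : set R) `*` I01)
    (fun p : R * R => u p.1 p.2) /\
  (\int[leb]_(t in `]0%R, T[) \int[leb]_(x in I01) (u t x ^+ 2)%:E < +oo)%E.

Fixpoint L2Hm (m : nat) (T : R) (u : R -> R -> R) : Prop :=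
  if m is m'.+1 then
    L2L2 T u /\
    exists2 ux : R -> R -> R,
      {ae leb, forall t, t \in `]0, T[ -> weak_deriv `]0, 1[ (u t) (ux t)} &
      L2Hm m' T ux
  else L2L2 T u.

End Sobolev.

Section BBMBurgers.
Context {R : realType}.
Variables (mu nu wd : R) (c : 'I_2 -> R).
Implicit Types (u ut v chi : R -> R) (w wt wh : R -> R -> R) (t : R).

Local Notation leb := (@lebesgue_measure R).

(* Multiply the equation by v, integrate over (0,1), integrate both second
   order terms by parts, and insert the boundary conditions (for nu w_x) and
   their time derivatives (for mu w_xt). *)
Definition weak_form u ut v : R :=
  ip ut v + mu * ip (wD ut) (wD v) + nu * ip (wD u) (wD v)
  + (1 + wd) * ip (wD u) v + ip (u \* wD u) v
  + \sum_(i < 2) ((1 + c i + wd) * u i%:R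
                  + 2 / (9 * c i) * u i%:R ^+ 3) * v i%:R
  + mu / nu * \sum_(i < 2) ((c i + 1 + wd) * ut i%:R
                  + 2 / (3 * c i) * u i%:R ^+ 2 * ut i%:R) * v i%:R.

(* w t is the state at time t and wt its time derivative, in the sense of
   L^2(0,1)-valued distributions on (0, +oo). *)
Record weak_solution (w0 : R -> R) w wt : Prop := {
  weak_solution_H1 : forall t, 0 <= t -> Hm 1 (w t) /\ cont01 (w t);
  weak_solution_continuous : forall t, 0 <= t ->
    L2norm (w s \- w t) @[s --> within `[0, +oo[ (nbhs t)] --> 0;
  weak_solution_init : ae_eq leb `]0%R, 1%R[%classic (w 0) w0;
  weak_solution_L2H1 : forall T : R, 0 < T -> L2Hm 1 T wt;
  weak_solution_wt_cont : {ae leb, forall t, 0 < t -> cont01 (wt t)};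
  weak_solution_deriv : forall v, L2 v ->
    weak_deriv `]0, +oo[ (fun t => ip (w t) v) (fun t => ip (wt t) v);
  weak_solution_eq : {ae leb, forall t, 0 < t ->
    forall v, Hm 1 v -> cont01 v -> weak_form (w t) (wt t) v = 0} }.

Record regular_solution w wt : Prop := {
  regular_H2 : forall t, 0 <= t -> Hm 2 (w t);
  regular_L2H2 : forall T : R, 0 < T -> L2Hm 2 T wt;
  regular_bound : exists C : R, {ae leb, forall t, 0 < t ->
    ((Hnorm 2 (w t) ^+ 2 + L2norm (wt t) ^+ 2
        + mu * L2norm (wD (wt t)) ^+ 2)%:E
     + \int[leb]_(s in `]0%R, t[)
        (Hnorm 1 (wt s) ^+ 2 + mu * L2norm (wD (wD (wt s))) ^+ 2)%:E
     <= C%:E)%E} }.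

(* A partition 0 = x_0 < x_1 < ... < x_N = 1 is given by s = [:: x_1; ...; x_N]
   with itv_partition 0 1 s. *)
Definition node (s : seq R) (j : nat) : R := nth 0 (0 :: s) j.

Definition mesh_size (s : seq R) : R :=
  \big[Num.max/0]_(j < size s) (node s j.+1 - node s j).

Definition fe_space (s : seq R) chi : Prop :=
  cont01 chi /\
  forall j : nat, (j < size s)%N -> exists a b : R,
    forall x, x \in `]node s j, node s j.+1[ -> chi x = a * x + b.

Definition dt wh (t : R) : R -> R := fun x => (fun tau => wh tau x)^`()%classic t.

Definition H1_projection (lam : R) (s : seq R) (w0 w0h : R -> R) : Prop :=
  fe_space s w0h /\
  forall chi, fe_space s chi ->
    ip (wD w0 \- wD w0h) (wD chi) + lam * ip (w0 \- w0h) chi = 0.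

Record semidiscrete_solution (lam : R) (s : seq R) (w0 : R -> R) wh : Prop := {
  semidiscrete_fe : forall t, 0 <= t -> fe_space s (wh t);
  semidiscrete_derivable : forall t (x : R), 0 < t -> x \in `[0, 1] ->
    derivable (fun tau => wh tau x) t 1;
  semidiscrete_continuous0 : forall x : R, x \in `[0, 1] ->
    wh t x @[t --> 0^'+] --> wh 0 x;
  semidiscrete_init : H1_projection lam s w0 (wh 0);
  semidiscrete_eq : forall t, 0 < t -> forall chi, fe_space s chi ->
    weak_form (wh t) (dt wh t) chi = 0 }.

Definition max_decay_rate : R :=
  2^-1 * Num.min (nu / (mu + 1))
    (Num.min (nu / (2 * mu + nu))
      (Num.min (nu * (1 + c 0 + wd) / (nu + (1 + c 0 + wd) * mu))
               (nu * (1 + c 1 + wd) / (nu + (1 + c 1 + wd) * mu)))).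

End BBMBurgers.

(* Main.v *)
Require Import Defs.
From HB Require Import structures.
From mathcomp Require Import all_boot all_order all_algebra.
From mathcomp Require Import all_classical all_reals all_analysis.
From mathcomp Require Import measurable_realfun ring lra.
Set Implicit Arguments.
Unset Strict Implicit.
Unset Printing Implicit Defensive.
Import Order.TTheory GRing.Theory Num.Theory.
Import numFieldNormedType.Exports.
Local Open Scope classical_set_scope.
Local Open Scope ring_scope.

(* For the dissipative form A(u; u_t, v) + B(u, v) = 0 of both problems, testing
   with the solution gives (E(u))' <= -2r E(u) for an energy E equivalent to the
   square of |||u||| and for some r > alpha, so w and w_h decay like e^{-rt}. Let P w
   be the nodal interpolant of w. Its error eta = w - P w has no endpoint values and is
   d-orthogonal to V_h, so testing the equation of w with eta gives |||eta||| = O(h e^{-rt})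
   without any H^2 bound on w(t), and ||eta|| <= h |||eta||| by Poincare on each
   element. The difference theta = P w - w_h is superconvergent: y = |||theta|||^2
   satisfies y' + 2 alpha y <= C e^{-(r - alpha) t}(y + h^4 e^{-2 alpha t}), and
   Gronwall gives |||theta||| = O(h^2 e^{-alpha t}).

   Since w is differentiable in time only in a distributional sense, no time derivative
   of an energy is ever taken: w is shown to be Lipschitz into H^1 and to satisfy its
   equation up to o(t - s) uniformly over test functions in the unit ball, and the
   differential inequalities are read as bounds on upper right Dini derivatives. *)

(** * Dini derivatives and Gronwall's inequality *)

(** Both solutions go through one set of lemmas over an abstract [h1_model], with test space [X]
    either everything or V_h; analysis enters only where the axioms of the model and the hypothesis
    [evolves] are verified. The boundary coefficient 2/(9c) is what makes the energy inequality
    close: Young's inequality on the cubic endpoint terms |x|^3/3 consumes c/2 x^2 and x^4/(18c),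
    and 2/9 - 1/18 = 1/6 leaves exactly the quartic density of [energy]. In the equation of theta
    the remaining terms in eta are integrated by parts until eta is undifferentiated, so that only
    its L^2 norm, of order h^2, is felt. The rate r must exceed alpha strictly, because e^{-(r -
    alpha) t} is the coefficient of the perturbation in Gronwall's inequality and its integral over
    all times has to be finite for a constant independent of t. Uniformity over test functions
    matters because the decisive test functions, the increments themselves, vary with t. *)

Section Dini.
Context {R : realType}.
Implicit Types (f g m : R -> R) (s a b df eps del : R).

Definition continuous_ray f := forall s, 0 <= s -> forall eps, 0 < eps ->
  exists2 del, 0 < del &
    forall t, 0 <= t -> `|t - s| < del -> `|f t - f s| <= eps.

(** The constant [C] may depend on [s] but not on [eps], so that an estimate can end in any fixed
    multiple of [eps]; [dini_leP] normalises it away. Having [eps <= 1] keeps the auxiliary bounds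
    inside such estimates independent of [eps]. *)
Definition dini_le f s a := exists C, forall eps, 0 < eps <= 1 ->
  exists2 del, 0 < del &
    forall t, s < t < s + del -> f t - f s <= (t - s) * (a + C * eps).

Lemma dini_leP f s a : dini_le f s a -> forall eps, 0 < eps ->
  exists2 del, 0 < del &
    forall t, s < t < s + del -> f t - f s <= (t - s) * (a + eps).
Proof.
move=> [C HC] eps e0.
have C0 : 0 < `|C| + 1 by rewrite ltr_wpDl.
have [|del d0 Hd] := HC (Num.min 1 (eps / (`|C| + 1))).
  by rewrite lt_min ltr01 divr_gt0//= ge_min lexx.
exists del => // t Ht; apply: (le_trans (Hd t Ht)).
rewrite ler_pM2l; last by case/andP: Ht => ? _; rewrite subr_gt0.
rewrite lerD2l.
have m0 : 0 < Num.min 1 (eps / (`|C| + 1)) by rewrite lt_min ltr01 divr_gt0.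
apply: (@le_trans _ _ ((`|C| + 1) * Num.min 1 (eps / (`|C| + 1)))).
  by rewrite ler_pM2r// (le_trans (ler_norm _))// lerDl.
by rewrite mulrC -ler_pdivlMr// ge_min lexx orbT.
Qed.

(** For every [e > 0] the graph stays below the line of slope [e] issuing from the point at [a]: at
    the supremum of the times up to which this holds, continuity gives the bound and the Dini
    hypothesis carries it further. Time 0, where nothing is assumed on the derivative, is reached by
    continuity. *)
Lemma dini_nonincreasing f : continuous_ray f ->
  (forall s, 0 < s -> dini_le f s 0) ->
  forall a b, 0 <= a -> a <= b -> f b <= f a.
Proof.
move=> fc fd.
have pos a b : 0 < a -> a <= b -> f b <= f a.
  move=> a0 ab; apply/ler_addgt0Pr => e1 e10.
  (* With this slope the total rise over [a, b] stays below the tolerance [e1], also when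
     [a = b]. *)
  pose e := e1 / (b - a + 1).
  have ba1 : 0 < b - a + 1 by lra.
  have e0 : 0 < e by rewrite divr_gt0.
  suff H : f b <= f a + e * (b - a).
    apply: (le_trans H); rewrite lerD2l.
    have <- : e * (b - a + 1) = e1 by rewrite /e divfK// gt_eqF.
    by rewrite ler_pM2l// lerDl.
  pose S := [set t | a <= t <= b /\
    forall r, a <= r <= t -> f r <= f a + e * (r - a)].
  have Sa : S a.
    split; first by rewrite lexx ab.
    by move=> r /le_anti <-; rewrite subrr mulr0 addr0.
  have Sup : has_sup S.
    by split; [exists a|exists b; move=> t [/andP[_ ?] _]].
  pose u := sup S.
  have au : a <= u := ub_le_sup (proj2 Sup) Sa.
  have ub : u <= b.
    by apply: ge_sup; [exists a|move=> t [/andP[_ ?] _]].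
  have u0 : 0 < u by lra.
  have Hlt r : a <= r < u -> f r <= f a + e * (r - a).
    move=> /andP[ar ru].
    have [|t [_ Ht] ut] := @sup_adherent _ S (u - r) _ Sup; first by lra.
    by apply: Ht; move: ut; rewrite -/u; lra.
  have Hu : f u <= f a + e * (u - a).
    rewrite leNgt; apply/negP => Hc.
    pose gam := f u - (f a + e * (u - a)).
    have g0 : 0 < gam by rewrite /gam; lra.
    have [del d0 Hd] := fc u (ltW u0) (gam / 2) ltac:(lra).
    have [eau|nau] := eqVneq u a; first by move: Hc; rewrite eau; lra.
    have au' : a < u by rewrite lt_neqAle eq_sym nau.
    pose r := Num.max a (u - del / 2).
    have ar : a <= r by rewrite le_max lexx.
    have ru : r < u by rewrite gt_max au'/=; lra.
    have ru2 : u - del / 2 <= r by rewrite le_max lexx orbT.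
    have := Hd r ltac:(lra); rewrite ler0_norm; last by lra.
    move=> /(_ ltac:(lra)) /ler_normlP[].
    have := Hlt r ltac:(lra).
    have : e * (r - a) <= e * (u - a) by rewrite ler_pM2l//; lra.
    by rewrite /gam in g0 *; lra.
  have [->//|nub] := eqVneq b u; have ltub : u < b by rewrite lt_neqAle eq_sym nub.
  have [del d0 Hd] := dini_leP (fd u u0) e0.
  pose t := u + Num.min (b - u) (del / 2).
  have m0 : 0 < Num.min (b - u) (del / 2) by rewrite lt_min; lra.
  have m1 : Num.min (b - u) (del / 2) <= b - u by rewrite ge_min lexx.
  have m2 : Num.min (b - u) (del / 2) <= del / 2 by rewrite ge_min lexx orbT.
  have : S t.
    split; first by rewrite /t; lra.
    move=> r /andP[ar rt].
    have [ru|ur] := ltP r u; first by apply: Hlt; rewrite ar.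
    have [->//|nur] := eqVneq r u.
    have ur' : u < r by rewrite lt_neqAle eq_sym nur.
    have := Hd r; rewrite ur' /= => /(_ ltac:(rewrite /t in rt; lra)).
    nra.
  move=> /(ub_le_sup (proj2 Sup)); rewrite -/u /t; lra.
move=> a b a0 ab.
have [a_eq0|na] := eqVneq a 0; last first.
  by apply: pos => //; rewrite lt_neqAle eq_sym na.
rewrite a_eq0 in ab *.
have [->//|nb] := eqVneq b 0.
have b0 : 0 < b by rewrite lt_neqAle eq_sym nb.
apply/ler_addgt0Pr => e e0.
have [del d0 Hd] := fc 0 (lexx _) e e0.
pose r := Num.min b (del / 2).
have r0 : 0 < r by rewrite lt_min b0/=; lra.
have rb : r <= b by rewrite ge_min lexx.
have rd : r <= del / 2 by rewrite ge_min lexx orbT.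
have := Hd r (ltW r0); rewrite subr0 gtr0_norm// => /(_ ltac:(lra)) /ler_normlP[_].
have := pos r b r0 rb; lra.
Qed.

Lemma continuous_rayM f g : continuous_ray f -> continuous_ray g ->
  continuous_ray (fun t => f t * g t).
Proof.
move=> fc gc s s0 eps e0.
pose M := `|f s| + `|g s| + 2.
have M0 : 0 < M by rewrite /M; have := normr_ge0 (f s); have := normr_ge0 (g s); lra.
pose e := Num.min 1 (eps / M).
have ep : 0 < e by rewrite lt_min ltr01 divr_gt0.
have e1 : e <= 1 by rewrite ge_min lexx.
have e2 : e * M <= eps by rewrite -ler_pdivlMr// ge_min lexx orbT.
have [d1 d10 H1] := fc s s0 e ep; have [d2 d20 H2] := gc s s0 e ep.
exists (Num.min d1 d2); first by rewrite lt_min d10.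
move=> t t0; rewrite lt_min => /andP[/(H1 t t0) Hf /(H2 t t0) Hg].
have -> : f t * g t - f s * g s =
  (f t - f s) * (g t - g s) + f s * (g t - g s) + (f t - f s) * g s by ring.
apply: (le_trans (ler_normD _ _)).
have := ler_normD ((f t - f s) * (g t - g s)) (f s * (g t - g s)).
rewrite !normrM.
have := normr_ge0 (f s); have := normr_ge0 (g s).
have := normr_ge0 (f t - f s); have := normr_ge0 (g t - g s).
move: Hf Hg; set a := `|f t - f s|; set b := `|g t - g s|; set c := `|f s|; set d := `|g s|.
move=> ae be b0 a0 d0 c0 HH.
have : a * b <= e * 1 by apply: ler_pM => //; lra.
have : c * b <= c * e by apply: ler_wpM2l.
have : a * d <= e * d by apply: ler_wpM2r.
by move: e2; rewrite /M -/c -/d; nra.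
Qed.

Lemma continuous_rayD f g : continuous_ray f -> continuous_ray g ->
  continuous_ray (fun t => f t + g t).
Proof.
move=> fc gc s s0 eps e0.
have [d1 d10 H1] := fc s s0 (eps / 2) ltac:(lra).
have [d2 d20 H2] := gc s s0 (eps / 2) ltac:(lra).
exists (Num.min d1 d2); first by rewrite lt_min d10.
move=> t t0; rewrite lt_min => /andP[/(H1 t t0) Hf /(H2 t t0) Hg].
have -> : f t + g t - (f s + g s) = (f t - f s) + (g t - g s) by ring.
apply: (le_trans (ler_normD _ _)); lra.
Qed.

Lemma continuous_ray_cst a : continuous_ray (fun=> a).
Proof. by move=> s _ e e0; exists 1 => // t _ _; rewrite subrr normr0 ltW. Qed.

Lemma continuous_continuous_ray f : continuous f -> continuous_ray f.
Proof.
move=> cf s s0 e e0.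
have /cvgrPdist_le/(_ e e0)/nbhs_ballP[del /= d0 H] := cf s.
exists del => // t t0 ts.
by rewrite distrC; apply: H; rewrite /ball/= distrC.
Qed.

Lemma derive_increment f s df eps : is_derive s 1 f df -> 0 < eps ->
  exists2 del, 0 < del &
    forall t, s < t < s + del -> `|f t - f s - (t - s) * df| <= (t - s) * eps.
Proof.
move=> [fd <-] e0.
have /cvgrPdist_le /(_ eps e0) := fd.
rewrite /dnbhs near_withinE => /nbhs_ballP[del /= d0 H].
exists del => // t /andP[st td].
have Hd : `|'D_1 f s - (t - s)^-1 * (f t - f s)| <= eps.
  have := H (t - s); rewrite /ball /= sub0r normrN gtr0_norm ?subr_gt0//.
  move=> /(_ ltac:(lra)); rewrite gt_eqF ?subr_gt0// => /(_ isT).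
  by rewrite /GRing.scale/= mulr1 subrK.
have ts : 0 < t - s by rewrite subr_gt0.
rewrite -[X in X * eps](gtr0_norm ts) -ler_pdivrMl ?normr_gt0 ?gt_eqF//.
rewrite -normfV -normrM.
rewrite (_ : _ * _ = - ('D_1 f s - (t - s)^-1 * (f t - f s))) ?normrN//.
by rewrite mulrBr mulKf ?gt_eqF// opprB.
Qed.

Lemma dini_leD f g s a b : dini_le f s a -> dini_le g s b ->
  dini_le (fun t => f t + g t) s (a + b).
Proof.
move=> fd gd; exists 2 => eps /andP[e0 _].
have [d1 d10 H1] := dini_leP fd e0.
have [d2 d20 H2] := dini_leP gd e0.
exists (Num.min d1 d2); first by rewrite lt_min d10.
move=> t /andP[st]; rewrite -ltrBlDl lt_min => /andP[t1 t2].
have := H1 t ltac:(lra); have := H2 t ltac:(lra); nra.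
Qed.

Lemma dini_le_derive f s df : is_derive s 1 f df -> dini_le f s df.
Proof.
move=> fd; exists 1 => eps /andP[e0 _].
have [del d0 H] := derive_increment fd e0.
exists del => // t Ht; have /ler_normlP[_] := H t Ht.
nra.
Qed.

Lemma le_dini f s a b : a <= b -> dini_le f s a -> dini_le f s b.
Proof.
move=> ab fd; exists 1 => eps /andP[e0 _]; have [d d0 H] := dini_leP fd e0.
exists d => // t Ht; apply: (le_trans (H t Ht)).
by rewrite ler_pM2l; case/andP: Ht => ? ?; lra.
Qed.

(** [m] is an integrating factor. Its positivity is essential: only upper bounds on the increments
    of [f] are known, and they survive multiplication by [m]. *)
Lemma gronwall f m (r : R -> R) : continuous_ray f -> continuous m ->
  (forall t, 0 < m t) ->
  (forall s, 0 < s -> is_derive s 1 m (- (r s * m s))) ->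
  (forall s, 0 < s -> dini_le f s (r s * f s)) ->
  forall t, 0 <= t -> f t * m t <= f 0 * m 0.
Proof.
move=> fc mc m0 md fd t t0.
apply: (@dini_nonincreasing (fun t => f t * m t)) => //.
  by apply: continuous_rayM => //; exact: continuous_continuous_ray.
move=> s s0.
exists (m s + 1 + `|r s * f s| + `|f s|) => eps /andP[e0 e1].
have [d1 d10 H1] := dini_leP (fd s s0) e0.
have [d2 d20 H2] := continuous_continuous_ray mc (ltW s0) e0.
have [d3 d30 H3] := derive_increment (md s s0) e0.
exists (Num.min d1 (Num.min d2 d3)); first by rewrite !lt_min d10 d20.
move=> u /andP[su]; rewrite -ltrBlDl !lt_min => /and3P[u1 u2 u3].
have {H1} Hf := H1 u ltac:(lra).
have {H2} Hm : `|m u - m s| <= eps.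
  by apply: H2; rewrite ?gtr0_norm; lra.
have {H3} Hd := H3 u ltac:(lra).
set D := u - s in Hf Hm Hd *; have D0 : 0 < D by rewrite /D; lra.
have -> : f u * m u - f s * m s = (f u - f s) * m u + f s * (m u - m s) by ring.
have Ha : (f u - f s) * m u <= D * (r s * f s + eps) * m u.
  by apply: ler_wpM2r => //; exact: ltW.
have Hb : f s * (m u - m s) <= - (f s * (D * (r s * m s))) + `|f s| * (D * eps).
  have : `|f s * (m u - m s - D * - (r s * m s))| <= `|f s| * (D * eps).
    by rewrite normrM ler_wpM2l.
  by move=> /ler_normlP[_]; lra.
have Hc : r s * f s * (m u - m s) <= `|r s * f s| * eps.
  by apply: (le_trans (ler_norm _)); rewrite normrM ler_wpM2l.
have He : m u <= m s + 1 by move: Hm => /ler_normlP[_]; lra.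
have Hc' : D * (r s * f s * (m u - m s)) <= D * (`|r s * f s| * eps).
  by rewrite ler_pM2l.
have He' : D * eps * m u <= D * eps * (m s + 1).
  by apply: ler_wpM2l => //; rewrite mulr_ge0// ltW.
move: Ha Hb Hc' He'; lra.
Qed.

Lemma gronwall_exp f (G r : R -> R) : continuous_ray f -> continuous G ->
  (forall s, 0 < s -> is_derive s 1 G (r s)) ->
  (forall s, 0 < s -> dini_le f s (r s * f s)) ->
  forall t, 0 <= t -> f t <= f 0 * expR (G t - G 0).
Proof.
move=> fc Gc Gd fd t t0.
suff H : f t * expR (- G t) <= f 0 * expR (- G 0).
  have := ler_wpM2r (expR_ge0 (G t)) H.
  by rewrite -!mulrA -!expRD addNr expR0 mulr1 [- _ + _]addrC.
apply: (@gronwall f (fun t => expR (- G t)) r) => //.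
- move=> x; apply: (@continuous_comp _ _ _ (fun x => - G x) expR).
    by apply: continuousN; exact: Gc.
  exact: continuous_expR.
- by move=> x; exact: expR_gt0.
- move=> s s0.
  have h : is_derive s 1 (fun t => - G t) (- r s) by apply: is_deriveN; exact: Gd.
  apply: (is_derive_eq (is_derive1_comp (is_derive_expR _) h)).
  by rewrite mulrN mulrC.
Qed.

End Dini.

(** * The variational forms *)

(** The quadratic in [a] is tested at its minimiser [B / C], and for [C = 0], where it is affine, at
    a point where it would equal -1. *)
Lemma quadratic_cauchy (R : realType) (A B C : R) : 0 <= A -> 0 <= C ->
  (forall a, 0 <= A - 2 * a * B + a ^+ 2 * C) -> `|B| <= Num.sqrt A * Num.sqrt C.
Proof.
move=> A0 C0 key.
rewrite -(@ler_pXn2r _ 2)// ?nnegrE ?mulr_ge0 ?sqrtr_ge0//.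
rewrite exprMn !sqr_sqrtr// real_normK ?num_real//.
have [v0|vn0] := eqVneq C 0.
  have [->|un0] := eqVneq B 0; first by rewrite v0; lra.
  have := key ((A + 1) / (2 * B)).
  rewrite v0 mulr0 addr0.
  have -> : 2 * ((A + 1) / (2 * B)) * B = A + 1 by field.
  lra.
have v0 : 0 < C by rewrite lt_neqAle eq_sym vn0.
have /(ler_wpM2l (ltW v0)) := key (B / C).
rewrite mulr0.
have -> : C * (A - 2 * (B / C) * B + (B / C) ^+ 2 * C) = A * C - B ^+ 2 by field.
lra.
Qed.

(** * Semi-inner products and their seminorms *)

Section SemiInner.
Context {R : realType} {V : lmodType R}.

Record semi_inner (q : V -> V -> R) : Prop := {
  semi_lin : forall a u v z, q (a *: u + v) z = a * q u z + q v z;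
  semi_sym : forall u v, q u v = q v u;
  semi_ge0 : forall u, 0 <= q u u }.

Variables (q : V -> V -> R) (qP : semi_inner q).

Lemma semiDl u v z : q (u + v) z = q u z + q v z.
Proof. by have := semi_lin qP 1 u v z; rewrite scale1r mul1r. Qed.

Lemma semi0l z : q 0 z = 0.
Proof. by have := semiDl 0 0 z; rewrite addr0; lra. Qed.

Lemma semiZl a u z : q (a *: u) z = a * q u z.
Proof. by have := semi_lin qP a u 0 z; rewrite addr0 semi0l addr0. Qed.

Lemma semiNl u z : q (- u) z = - q u z.
Proof. by rewrite -scaleN1r semiZl mulN1r. Qed.

Lemma semiBl u v z : q (u - v) z = q u z - q v z.
Proof. by rewrite semiDl semiNl. Qed.

Lemma semiDr u v z : q z (u + v) = q z u + q z v.
Proof. by rewrite !(semi_sym qP z) semiDl. Qed.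

Lemma semiZr a u z : q z (a *: u) = a * q z u.
Proof. by rewrite !(semi_sym qP z) semiZl. Qed.

Lemma semiNr u z : q z (- u) = - q z u.
Proof. by rewrite !(semi_sym qP z) semiNl. Qed.

Lemma semiBr u v z : q z (u - v) = q z u - q z v.
Proof. by rewrite !(semi_sym qP z) semiBl. Qed.

Lemma semi_sqB u v : q (u - v) (u - v) = q u u - 2 * q u v + q v v.
Proof. by rewrite !(semiBl, semiBr) (semi_sym qP v u); ring. Qed.

Lemma semi_sqD u v : q (u + v) (u + v) = q u u + 2 * q u v + q v v.
Proof. by rewrite !(semiDl, semiDr) (semi_sym qP v u); ring. Qed.

Definition snorm u := Num.sqrt (q u u).

Lemma snorm_ge0 u : 0 <= snorm u. Proof. exact: sqrtr_ge0. Qed.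

Lemma sqr_snorm u : snorm u ^+ 2 = q u u.
Proof. by rewrite sqr_sqrtr// semi_ge0. Qed.

Lemma semi_cauchy u v : `|q u v| <= snorm u * snorm v.
Proof.
apply: quadratic_cauchy; try exact: semi_ge0.
move=> a; have := semi_ge0 qP (u - a *: v).
by rewrite semi_sqB semiZr semiZl semiZr; nra.
Qed.

Lemma snormD u v : snorm (u + v) <= snorm u + snorm v.
Proof.
rewrite -(@ler_pXn2r _ 2)// ?nnegrE ?addr_ge0 ?snorm_ge0//.
rewrite sqrrD !sqr_snorm semi_sqD.
have := ler_norm (q u v); have := semi_cauchy u v; lra.
Qed.

Lemma snormN u : snorm (- u) = snorm u.
Proof. by rewrite /snorm semiNl semiNr opprK. Qed.

Lemma snormB u v : snorm (u - v) <= snorm u + snorm v.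
Proof. by rewrite (le_trans (snormD _ _))// snormN. Qed.

Lemma snormBC u v : snorm (u - v) = snorm (v - u).
Proof. by rewrite -snormN opprB. Qed.

End SemiInner.

(* [T a b c] models the integral of [a b_x c], [g u v] that of [u_x v], and
   [e0], [e1] are the values at the endpoints. *)
Record h1_model (R : realType) (V : lmodType R) := {
  e0 : V -> R; e1 : V -> R;
  p : V -> V -> R; d : V -> V -> R; g : V -> V -> R; T : V -> V -> V -> R;
  e0_lin : forall a u v, e0 (a *: u + v) = a * e0 u + e0 v;
  e1_lin : forall a u v, e1 (a *: u + v) = a * e1 u + e1 v;
  p_semi : semi_inner p;
  d_semi : semi_inner d;
  g_linl : forall a u v z, g (a *: u + v) z = a * g u z + g v z;
  g_parts : forall u v, g u v + g v u = e1 u * e1 v - e0 u * e0 v;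
  g_le : forall u v, `|g u v| <= snorm d u * snorm p v;
  T_linl : forall a u v y z, T (a *: u + v) y z = a * T u y z + T v y z;
  T_linm : forall a u v y z, T y (a *: u + v) z = a * T y u z + T y v z;
  T_sym : forall u y z, T u y z = T z y u;
  T_parts : forall u v z, T u v z + T v u z + T u z v =
    e1 u * e1 v * e1 z - e0 u * e0 v * e0 z;
  T_le : forall u v z, `|T u v z| <=
    Num.sqrt (e0 u ^+ 2 + e1 u ^+ 2 + d u u) * snorm d v * snorm p z;
  e0_trace : forall u, e0 u ^+ 2 <= 2 * (p u u + d u u);
  e1_trace : forall u, e1 u ^+ 2 <= 2 * (p u u + d u u);
  p_le : forall u, p u u <= 3 / 4 * (e0 u ^+ 2 + e1 u ^+ 2 + d u u) }.

Record bbm_params (R : realType) := {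
  pmu : R; pnu : R; pwd : R; pc0 : R; pc1 : R;
  pmu_gt0 : 0 < pmu; pnu_gt0 : 0 < pnu; pwd_ge0 : 0 <= pwd;
  pc0_gt0 : 0 < pc0; pc1_gt0 : 0 < pc1 }.

Definition pk0 (R : realType) (Q : bbm_params R) := pc0 Q + 1 + pwd Q.
Definition pk1 (R : realType) (Q : bbm_params R) := pc1 Q + 1 + pwd Q.
Lemma pk0E (R : realType) (Q : bbm_params R) : pk0 Q = pc0 Q + 1 + pwd Q.
Proof. by []. Qed.
Lemma pk1E (R : realType) (Q : bbm_params R) : pk1 Q = pc1 Q + 1 + pwd Q.
Proof. by []. Qed.

Section Model.
Context {R : realType} {V : lmodType R} (M : h1_model V).
Local Notation e0 := (e0 M).
Local Notation e1 := (e1 M).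
Local Notation p := (p M).
Local Notation d := (d M).
Local Notation g := (g M).
Local Notation T := (T M).

Lemma e0D u v : e0 (u + v) = e0 u + e0 v.
Proof. by have := e0_lin M 1 u v; rewrite scale1r mul1r. Qed.
Lemma e1D u v : e1 (u + v) = e1 u + e1 v.
Proof. by have := e1_lin M 1 u v; rewrite scale1r mul1r. Qed.
Lemma e0_0 : e0 0 = 0. Proof. by have := e0D 0 0; rewrite addr0; lra. Qed.
Lemma e1_0 : e1 0 = 0. Proof. by have := e1D 0 0; rewrite addr0; lra. Qed.
Lemma e0Z a u : e0 (a *: u) = a * e0 u.
Proof. by have := e0_lin M a u 0; rewrite !addr0 e0_0 addr0. Qed.
Lemma e1Z a u : e1 (a *: u) = a * e1 u.
Proof. by have := e1_lin M a u 0; rewrite !addr0 e1_0 addr0. Qed.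
Lemma e0B u v : e0 (u - v) = e0 u - e0 v.
Proof. by rewrite e0D -scaleN1r e0Z mulN1r. Qed.
Lemma e1B u v : e1 (u - v) = e1 u - e1 v.
Proof. by rewrite e1D -scaleN1r e1Z mulN1r. Qed.

Lemma gDl u v z : g (u + v) z = g u z + g v z.
Proof. by have := g_linl M 1 u v z; rewrite scale1r mul1r. Qed.
Lemma gBl u v z : g (u - v) z = g u z - g v z.
Proof. by have := g_linl M (-1) v u z; rewrite addrC scaleN1r => ->; ring. Qed.

Lemma TBl u v y z : T (u - v) y z = T u y z - T v y z.
Proof. by have := T_linl M (-1) v u y z; rewrite addrC scaleN1r => ->; ring. Qed.
Lemma TDl u v y z : T (u + v) y z = T u y z + T v y z.
Proof. by have := T_linl M 1 u v y z; rewrite scale1r mul1r. Qed.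
Lemma TBm u v y z : T y (u - v) z = T y u z - T y v z.
Proof. by have := T_linm M (-1) v u y z; rewrite addrC scaleN1r => ->; ring. Qed.
Lemma TDm u v y z : T y (u + v) z = T y u z + T y v z.
Proof. by have := T_linm M 1 u v y z; rewrite scale1r mul1r. Qed.

Definition trip u v := e0 u * e0 v + e1 u * e1 v + d u v.

Lemma trip_semi : semi_inner trip.
Proof.
split.
- by move=> a u v z; rewrite /trip e0_lin e1_lin (semi_lin (d_semi M)); ring.
- by move=> u v; rewrite /trip (semi_sym (d_semi M)); ring.
- by move=> u; rewrite /trip !addr_ge0 -?expr2 ?sqr_ge0 ?(semi_ge0 (d_semi M)).
Qed.

Local Notation N := (snorm trip).
Local Notation np := (snorm p).
Local Notation nd := (snorm d).

Lemma sqr_N u : N u ^+ 2 = e0 u ^+ 2 + e1 u ^+ 2 + d u u.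
Proof. by rewrite (sqr_snorm trip_semi) /trip !expr2. Qed.

Lemma N_ge0 u : 0 <= N u. Proof. exact: snorm_ge0. Qed.

Lemma le_sqr_N x u : x ^+ 2 <= N u ^+ 2 -> `|x| <= N u.
Proof.
move=> H; rewrite -(@ler_pXn2r _ 2)// ?nnegrE ?N_ge0//.
by rewrite real_normK ?num_real.
Qed.

Lemma e0_le u : `|e0 u| <= N u.
Proof.
apply: le_sqr_N; rewrite sqr_N.
by have := sqr_ge0 (e1 u); have := semi_ge0 (d_semi M) u; lra.
Qed.

Lemma e1_le u : `|e1 u| <= N u.
Proof.
apply: le_sqr_N; rewrite sqr_N.
by have := sqr_ge0 (e0 u); have := semi_ge0 (d_semi M) u; lra.
Qed.

Lemma nd_le u : nd u <= N u.
Proof.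
rewrite -[nd u]ger0_norm ?snorm_ge0//; apply: le_sqr_N.
rewrite sqr_N (sqr_snorm (d_semi M)).
by have := sqr_ge0 (e0 u); have := sqr_ge0 (e1 u); lra.
Qed.

Lemma np_le u : np u <= N u.
Proof.
rewrite -[np u]ger0_norm ?snorm_ge0//; apply: le_sqr_N.
rewrite (sqr_snorm (p_semi M)) (le_trans (p_le M u))// -sqr_N.
by have := sqr_ge0 (N u); lra.
Qed.

Lemma T_leN u v z : `|T u v z| <= N u * nd v * np z.
Proof. by rewrite (le_trans (T_le M u v z))// /snorm /trip !expr2. Qed.

Variable Q : bbm_params R.
Local Notation mu := (pmu Q).
Local Notation nu := (pnu Q).
Local Notation wd := (pwd Q).
Local Notation c0 := (pc0 Q).
Local Notation c1 := (pc1 Q).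
Local Notation k0 := (pk0 Q).
Local Notation k1 := (pk1 Q).
Let mu0 : 0 < mu := pmu_gt0 Q.
Let nu0 : 0 < nu := pnu_gt0 Q.
Let wd0 : 0 <= wd := pwd_ge0 Q.
Let c00 : 0 < c0 := pc0_gt0 Q.
Let c10 : 0 < c1 := pc1_gt0 Q.
Let k0E : k0 = c0 + 1 + wd := pk0E Q.
Let k1E : k1 = c1 + 1 + wd := pk1E Q.

(** The weak form splits as [fA u u_t v + fB u v]; [fb] is the part of [fA] whose coefficients do
    not depend on the state [u]. *)
Definition fb z v := p z v + mu * d z v + mu / nu * (k0 * e0 z * e0 v + k1 * e1 z * e1 v).
Definition fA u z v := fb z v + mu / nu * (2 / (3 * c0) * e0 u ^+ 2 * e0 z * e0 v
   + 2 / (3 * c1) * e1 u ^+ 2 * e1 z * e1 v).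
Definition fB u v := nu * d u v + (1 + wd) * g u v + T u u v
  + ((k0 * e0 u + 2 / (9 * c0) * e0 u ^+ 3) * e0 v
   + (k1 * e1 u + 2 / (9 * c1) * e1 u ^+ 3) * e1 v).
(** Its derivative at [u] in the direction [z] is [fA u z u]: the quartic terms are the primitives
    of the state-dependent endpoint terms of [fA] tested with [u]. *)
Definition energy u := fb u u / 2 + mu / nu * (e0 u ^+ 4 / (6 * c0) + e1 u ^+ 4 / (6 * c1)).

Let k00 : 0 < k0. Proof. by rewrite k0E ltr_wpDr// addr_gt0. Qed.
Let k10 : 0 < k1. Proof. by rewrite k1E ltr_wpDr// addr_gt0. Qed.
Let mn0 : 0 < mu / nu. Proof. exact: divr_gt0. Qed.

Let sqr_scale_ge0 (a x : R) : 0 <= a -> 0 <= a * x * x.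
Proof. by move=> a0; rewrite -mulrA -expr2 mulr_ge0 ?sqr_ge0. Qed.

Lemma fb_semi : semi_inner fb.
Proof.
split.
- move=> a u v z; rewrite /fb e0_lin e1_lin (semi_lin (d_semi M)) (semi_lin (p_semi M)); ring.
- by move=> u v; rewrite /fb (semi_sym (d_semi M)) (semi_sym (p_semi M)); ring.
- move=> u; rewrite /fb; apply: addr_ge0.
    by rewrite addr_ge0 ?mulr_ge0 ?(ltW mu0) ?(semi_ge0 (p_semi M)) ?(semi_ge0 (d_semi M)).
  by rewrite mulr_ge0 ?(ltW mn0)// addr_ge0// sqr_scale_ge0// ltW.
Qed.

Definition coer := Num.min mu (Num.min (mu / nu * k0) (mu / nu * k1)).

Lemma coer_gt0 : 0 < coer.
Proof. by rewrite /coer !lt_min mu0 !(mulr_gt0 mn0). Qed.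

Lemma fb_coercive z : coer * N z ^+ 2 <= fb z z.
Proof.
rewrite sqr_N /fb.
have h1 : coer <= mu by rewrite ge_min lexx.
have h2 : coer <= mu / nu * k0 by rewrite /coer !ge_min lexx orbT.
have h3 : coer <= mu / nu * k1 by rewrite /coer !ge_min lexx !orbT.
have := semi_ge0 (p_semi M) z.
have := ler_wpM2r (semi_ge0 (d_semi M) z) h1.
have := ler_wpM2r (sqr_ge0 (e0 z)) h2.
have := ler_wpM2r (sqr_ge0 (e1 z)) h3.
lra.
Qed.

Lemma fA_coercive u z : coer * N z ^+ 2 <= fA u z z.
Proof.
rewrite (le_trans (fb_coercive z))// /fA lerDl mulr_ge0 ?(ltW mn0)//.
by rewrite addr_ge0// sqr_scale_ge0// mulr_ge0 ?sqr_ge0// divr_ge0// mulr_ge0// ltW.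
Qed.

Lemma fb_le : exists2 C, 0 <= C & forall z v, `|fb z v| <= C * (N z * N v).
Proof.
exists (1 + mu + mu / nu * (k0 + k1)).
  by rewrite !addr_ge0 ?mulr_ge0 ?addr_ge0 ?invr_ge0 // ltW.
move=> z v; rewrite /fb.
have Np := ler_pM (snorm_ge0 _ _) (snorm_ge0 _ _) (np_le z) (np_le v).
have Nd := ler_pM (snorm_ge0 _ _) (snorm_ge0 _ _) (nd_le z) (nd_le v).
have N0 := ler_pM (normr_ge0 _) (normr_ge0 _) (e0_le z) (e0_le v).
have N1 := ler_pM (normr_ge0 _) (normr_ge0 _) (e1_le z) (e1_le v).
have {}Np := le_trans (semi_cauchy (p_semi M) z v) Np.
have {}Nd := le_trans (semi_cauchy (d_semi M) z v) Nd.
rewrite -!normrM in N0 N1.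
have absM (a x y : R) : 0 <= a -> `|x| <= y -> `|a * x| <= a * y.
  by move=> a0 xy; rewrite normrM ger0_norm// ler_wpM2l.
have H : `|k0 * e0 z * e0 v + k1 * e1 z * e1 v| <= (k0 + k1) * (N z * N v).
  rewrite -[k0 * _ * _]mulrA -[k1 * _ * _]mulrA (le_trans (ler_normD _ _))// (mulrDl k0).
by rewrite lerD// absM// ltW.
rewrite (le_trans (ler_normD _ _))// (mulrDl (1 + mu)) (mulrDl 1 mu) mul1r -[_ * (k0 + k1) * _]mulrA lerD//.
  by rewrite (le_trans (ler_normD _ _))// lerD// absM// ltW.
by rewrite absM// ltW.
Qed.

Definition fBlin u v := nu * d u v + (1 + wd) * g u v
  + (k0 * e0 u * e0 v + k1 * e1 u * e1 v).

Let absM (a x y : R) : 0 <= a -> `|x| <= y -> `|a * x| <= a * y.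
Proof. by move=> a0 xy; rewrite normrM ger0_norm// ler_wpM2l. Qed.

Lemma fB_le : exists2 C, 0 <= C &
  forall u v, `|fB u v| <= C * (1 + N u ^+ 2) * N u * N v.
Proof.
pose b0 := 2 / (9 * c0); pose b1 := 2 / (9 * c1).
have b00 : 0 < b0 by rewrite divr_gt0 ?mulr_gt0.
have b10 : 0 < b1 by rewrite divr_gt0 ?mulr_gt0.
exists (nu + (1 + wd) + 1 + (k0 + b0) + (k1 + b1)).
  by rewrite !addr_ge0// ltW.
move=> u v; rewrite /fB -/b0 -/b1.
set n := N u; set m := N v.
have n0 : 0 <= n := N_ge0 u; have m0 : 0 <= m := N_ge0 v.
have Hd : `|nu * d u v| <= nu * (n * m).
  rewrite (absM (ltW nu0))// (le_trans (semi_cauchy (d_semi M) _ _))//.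
  by rewrite ler_pM ?snorm_ge0 ?nd_le.
have Hg : `|(1 + wd) * g u v| <= (1 + wd) * (n * m).
  rewrite (absM (addr_ge0 ler01 wd0))// (le_trans (g_le M _ _))//.
  by rewrite ler_pM ?snorm_ge0 ?nd_le ?np_le.
have HT : `|T u u v| <= n * n * m.
  rewrite (le_trans (T_leN _ _ _))//.
  by rewrite ler_pM ?ler_pM ?mulr_ge0 ?snorm_ge0 ?nd_le ?np_le.
have key (k b x y : R) : 0 < k -> 0 < b -> `|x| <= n -> `|y| <= m ->
    `|(k * x + b * x ^+ 3) * y| <= (k * n + b * n ^+ 3) * m.
  move=> kk bb xn ym; rewrite normrM ler_pM//.
  rewrite (le_trans (ler_normD _ _))// lerD// (absM (ltW _))//.
  by rewrite normrX lerXn2r ?nnegrE.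
have H0 := key _ _ _ _ k00 b00 (e0_le u) (e0_le v).
have H1 := key _ _ _ _ k10 b10 (e1_le u) (e1_le v).
rewrite (le_trans (ler_normD _ _))//.
have := ler_normD (nu * d u v + (1 + wd) * g u v) (T u u v).
have := ler_normD (nu * d u v) ((1 + wd) * g u v).
have := ler_normD ((k0 * e0 u + b0 * e0 u ^+ 3) * e0 v) ((k1 * e1 u + b1 * e1 u ^+ 3) * e1 v).
move=> h1 h2 h3.
have q0 : 0 <= n * m by rewrite mulr_ge0.
have nq : n * (n * m) <= (1 + n ^+ 2) * (n * m).
  by rewrite ler_wpM2r//; have := sqr_ge0 (n - 1); rewrite !expr2; lra.
have n2q : 0 <= n ^+ 2 * (n * m) by rewrite mulr_ge0 ?sqr_ge0.
have a1 := mulr_ge0 (ltW nu0) n2q.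
have a2 := mulr_ge0 (addr_ge0 ler01 wd0) n2q.
have a3 := mulr_ge0 (ltW k00) n2q.
have a4 := mulr_ge0 (ltW k10) n2q.
have a5 := mulr_ge0 (ltW b00) q0.
have a6 := mulr_ge0 (ltW b10) q0.
move: Hd Hg HT H0 H1 h1 h2 h3 nq n2q a1 a2 a3 a4 a5 a6; rewrite !exprS expr0; lra.
Qed.

Section Dissipation.
Variable r : R.
Hypotheses (r0 : 0 <= r) (r1 : r * (3 / 4 + mu) <= nu)
  (r2 : r * (3 / 4 + mu / nu * k0) <= k0 / 2)
  (r3 : r * (3 / 4 + mu / nu * k1) <= k1 / 2)
  (r4 : 2 * r * (mu / nu) <= 1).

(** [g u u] is half the difference of the squared endpoint values, so at the left end convection
    takes (1 + wd)/2 from [k0] and leaves k0/2 + c0/2; at the right end it only helps. The halves of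
    [k0] and [k1] pay for [r * fb u u], and those of [c0] and [c1] are set aside for the cubic terms
    in [fB_energy]. *)
Lemma fBlin_ge u :
  r * fb u u + (c0 / 2 * e0 u ^+ 2 + c1 / 2 * e1 u ^+ 2) <= fBlin u u.
Proof.
rewrite /fb /fBlin.
have -> : g u u = (e1 u ^+ 2 - e0 u ^+ 2) / 2.
  by have := g_parts M u u; rewrite !expr2; lra.
have := p_le M u => /(ler_wpM2l r0).
have := ler_wpM2r (semi_ge0 (d_semi M) u) r1.
have := ler_wpM2r (sqr_ge0 (e0 u)) r2.
have := ler_wpM2r (sqr_ge0 (e1 u)) r3.
have wdle0 : 0 <= wd * e1 u ^+ 2 by rewrite mulr_ge0 ?sqr_ge0.
have := sqr_ge0 (e1 u).
rewrite k0E k1E !expr2; set q := mu / nu.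
lra.
Qed.

Lemma fB_energy u : 2 * r * energy u <= fB u u.
Proof.
have -> : fB u u = fBlin u u + (e1 u ^+ 3 - e0 u ^+ 3) / 3
    + 2 / (9 * c0) * e0 u ^+ 4 + 2 / (9 * c1) * e1 u ^+ 4.
  have HT : T u u u = (e1 u ^+ 3 - e0 u ^+ 3) / 3.
    by have := T_parts M u u u; rewrite !exprS expr0 !mulr1 !mulrA; lra.
  by rewrite /fB /fBlin HT; ring.
have := fBlin_ge u.
(* A completed square in |x| and x^2 gives |x|^3/3 <= c/2 x^2 + x^4/(18c), and 2/9 - 1/18 = 1/6. *)
have key (c x : R) : 0 < c -> `|x ^+ 3| / 3 + x ^+ 4 / (6 * c) <= c / 2 * x ^+ 2 + 2 / (9 * c) * x ^+ 4.
  move=> cp.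
  suff : 0 <= (c * `|x| - x ^+ 2 / 3) ^+ 2 / (2 * c).
    have -> : (c * `|x| - x ^+ 2 / 3) ^+ 2 / (2 * c) =
      c / 2 * `|x| ^+ 2 - `|x| * x ^+ 2 / 3 + x ^+ 4 / (18 * c) by field; lra.
    have -> : `|x| * x ^+ 2 = `|x ^+ 3| by rewrite normrX [RHS]exprS real_normK ?num_real.
    have -> : x ^+ 4 / (18 * c) = 2 / (9 * c) * x ^+ 4 - x ^+ 4 / (6 * c) by field; lra.
    by rewrite real_normK ?num_real//; lra.
  by rewrite divr_ge0 ?sqr_ge0// mulr_ge0// ltW.
have pw (c x : R) : 0 < c -> 2 * r * (mu / nu) * (x ^+ 4 / (6 * c)) <= x ^+ 4 / (6 * c).
  move=> cp; rewrite -[leRHS]mul1r ler_wpM2r// divr_ge0 ?exprn_even_ge0// mulr_ge0//.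
  exact: ltW.
have := key _ (e0 u) c00; have := key _ (e1 u) c10.
have := pw _ (e0 u) c00; have := pw _ (e1 u) c10.
have := ler_norm (e0 u ^+ 3); have := lerNnormlW (lexx `|e1 u ^+ 3|).
rewrite /energy.
set q := mu / nu; set a := _ / (6 * c0); set b := _ / (6 * c1).
set a' := 2 / (9 * c0) * _; set b' := 2 / (9 * c1) * _.
lra.
Qed.

End Dissipation.

End Model.

(** * Energy decay *)

Section Evolution.
Context {R : realType} {V : lmodType R} (M : h1_model V) (Q : bbm_params R).
Local Notation e0 := (e0 M).
Local Notation e1 := (e1 M).
Local Notation N := (snorm (trip M)).
Local Notation mu := (pmu Q).
Local Notation nu := (pnu Q).
Local Notation c0 := (pc0 Q).
Local Notation c1 := (pc1 Q).
Local Notation k0 := (pk0 Q).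
Local Notation k1 := (pk1 Q).
Local Notation fb := (fb M Q).
Local Notation fA := (fA M Q).
Local Notation fB := (fB M Q).
Local Notation energy := (energy M Q).
Local Notation coer := (coer Q).
Implicit Types (s t r eps del : R).

(* The equation for [u], with the time derivative replaced by increments to the right and
   an error that is uniform over the test functions in [X]. *)
Definition evolves (X : V -> Prop) (u : R -> V) := forall s, 0 < s ->
  forall eps, 0 < eps -> exists2 del, 0 < del &
    forall t, s < t < s + del -> forall v, X v ->
      `|fA (u s) (u t - u s) v + (t - s) * fB (u s) v| <= eps * (t - s) * N v.

Definition curve_continuous (u : R -> V) := forall s, 0 <= s ->
  forall eps, 0 < eps -> exists2 del, 0 < del &
    forall t, 0 <= t -> `|t - s| < del -> N (u t - u s) <= eps.

(** The three bounds with 3/4 let [fBlin u u] absorb [r * fb u u], where 3/4 is the constant of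
    [p_le]. The last one handles the quartic part of the energy; it also says 2r <= nu/mu, so that
    the interpolation error is damped at least as fast as its forcing decays. *)
Definition admissible_rate r := [/\ 0 <= r, r * (3 / 4 + mu) <= nu,
  r * (3 / 4 + mu / nu * k0) <= k0 / 2, r * (3 / 4 + mu / nu * k1) <= k1 / 2 &
  2 * r * (mu / nu) <= 1].

Lemma sqr_N_le_energy u : coer / 2 * N u ^+ 2 <= energy u.
Proof.
have := fb_coercive M Q u.
suff : 0 <= mu / nu * (e0 u ^+ 4 / (6 * c0) + e1 u ^+ 4 / (6 * c1)).
  by rewrite /energy; set a := mu / nu * _; set b := fb u u; lra.
rewrite mulr_ge0 ?divr_ge0 ?(ltW (pmu_gt0 Q)) ?(ltW (pnu_gt0 Q))//.
by rewrite addr_ge0// divr_ge0 ?exprn_even_ge0 ?mulr_ge0// ltW// (pc0_gt0, pc1_gt0).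
Qed.

Lemma energy_le : exists2 C, 0 <= C &
  forall u, energy u <= C * (N u ^+ 2 + N u ^+ 4).
Proof.
have [C C0 HC] := fb_le M Q.
have h0 := pc0_gt0 Q; have h1 := pc1_gt0 Q.
have hm : 0 < mu / nu by rewrite divr_gt0 ?pmu_gt0 ?pnu_gt0.
have h2 : 0 <= mu / nu * ((6 * c0)^-1 + (6 * c1)^-1).
  by rewrite mulr_ge0 ?ltW// addr_gt0// invr_gt0 mulr_gt0.
exists (C + mu / nu * ((6 * c0)^-1 + (6 * c1)^-1)); first exact: addr_ge0.
move=> u; rewrite /energy (mulrDl C).
have n2 : 0 <= N u ^+ 2 by exact: sqr_ge0.
have n4 : 0 <= N u ^+ 4 by exact: exprn_even_ge0.
have := ler_norm (fb u u); have := HC u u; rewrite -expr2 => b1 b2.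
have C2 := mulr_ge0 C0 n2; have C4 := mulr_ge0 C0 n4.
have key (x : R) : `|x| <= N u -> x ^+ 4 <= N u ^+ 4.
  move=> xN; rewrite (le_trans (ler_norm _))// normrX.
  by rewrite lerXn2r ?nnegrE ?N_ge0.
apply: lerD; first by lra.
rewrite -[leRHS]mulrA ler_pM2l//.
rewrite [leRHS]mulrDl.
apply: lerD; rewrite mulrC ler_pM2l ?invr_gt0 ?mulr_gt0//.
  by rewrite (le_trans (key _ (e0_le M u)))// lerDr.
by rewrite (le_trans (key _ (e1_le M u)))// lerDr.
Qed.

Section Curve.
Variable u : R -> V.
Hypothesis uc : curve_continuous u.

Lemma continuous_ray_semi q C : semi_inner q -> 0 <= C ->
  (forall z v, `|q z v| <= C * (N z * N v)) ->
  continuous_ray (fun t => q (u t) (u t)).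
Proof.
move=> qP C0 qC s s0 eps eps0.
pose n := N (u s); have n0 : 0 <= n := N_ge0 M (u s).
have D0 : 0 < C * (2 * n + 1) + 1.
  by rewrite ltr_wpDl// mulr_ge0// addr_ge0// mulr_ge0.
pose e := Num.min 1 (eps / (C * (2 * n + 1) + 1)).
have ep : 0 < e by rewrite lt_min ltr01 divr_gt0.
have e1 : e <= 1 by rewrite ge_min lexx.
have e2 : e * (C * (2 * n + 1) + 1) <= eps.
  by rewrite -ler_pdivlMr// ge_min lexx orbT.
have [del d0 H] := uc s0 ep.
exists del => // t t0 /(H t t0) Hd.
set z := u t - u s in Hd.
have -> : q (u t) (u t) - q (u s) (u s) = 2 * q z (u s) + q z z.
  by rewrite /z !(semiBl qP) !(semiBr qP) (semi_sym qP (u s) (u t)); ring.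
rewrite (le_trans (ler_normD _ _))// normrM ger0_norm//.
have := qC z (u s); have := qC z z; rewrite -/n.
have nz0 : 0 <= N z := N_ge0 M z.
move=> h1 h2.
have h3 : C * (N z * n) <= C * (e * n) by rewrite ler_wpM2l// ler_wpM2r.
have h4 : C * (N z * N z) <= C * (e * 1).
  by rewrite ler_wpM2l// ler_pM// (le_trans Hd).
lra.
Qed.

Lemma continuous_ray_e0 : continuous_ray (fun t => e0 (u t)).
Proof.
move=> s s0 eps eps0; have [del d0 H] := uc s0 eps0.
exists del => // t t0 /(H t t0); rewrite -e0B; apply: le_trans; exact: e0_le.
Qed.

Lemma continuous_ray_e1 : continuous_ray (fun t => e1 (u t)).
Proof.
move=> s s0 eps eps0; have [del d0 H] := uc s0 eps0.
exists del => // t t0 /(H t t0); rewrite -e1B; apply: le_trans; exact: e1_le.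
Qed.

Lemma continuous_ray_energy : continuous_ray (fun t => energy (u t)).
Proof.
have cM (f : R -> R) a : continuous_ray f -> continuous_ray (fun t => f t * a).
  by move=> fc; apply: continuous_rayM => //; exact: continuous_ray_cst.
have c4 (f : R -> R) : continuous_ray f -> continuous_ray (fun t => f t ^+ 4).
  move=> fc; rewrite (_ : (fun _ => _) = fun t => (f t * f t) * (f t * f t)); last first.
    by apply/funext => t; ring.
  by do 2 apply: continuous_rayM.
have [C C0 HC] := fb_le M Q.
apply: continuous_rayD; first exact/cM/(continuous_ray_semi (fb_semi M Q) C0).
apply: continuous_rayM; first exact: continuous_ray_cst.
apply: continuous_rayD; apply/cM/c4; [exact: continuous_ray_e0|exact: continuous_ray_e1].
Qed.

End Curve.

Definition sub_closed (X : V -> Prop) := forall u v, X u -> X v -> X (u - v).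

(** The test function is the increment [u t - u s], which lies in [X] because [X] is closed under
    subtraction; coercivity of [fA] then bounds it. [C] is chosen before [X], hence independent of
    the mesh. *)
Lemma evolves_increment : exists2 C, 0 <= C &
  forall X u, sub_closed X -> (forall t, 0 <= t -> X (u t)) -> evolves X u ->
  forall s, 0 < s -> forall eps, 0 < eps -> exists2 del, 0 < del &
    forall t, s < t < s + del ->
      N (u t - u s) <= (t - s) * (C * (1 + N (u s) ^+ 2) * N (u s) + eps).
Proof.
have [C C0 HC] := fB_le M Q.
have k0 := coer_gt0 Q.
exists (C / coer); first by rewrite divr_ge0// ltW.
move=> X u Xs uX ue s s0 eps eps0.
have [del d0 H] := ue s s0 (eps * coer) (mulr_gt0 eps0 k0).
exists del => // t /[dup] st /andP[lt_st _].
have t0 : 0 <= t by lra.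
have := H t st _ (Xs _ _ (uX t t0) (uX s (ltW s0))).
set z := u t - u s; set n := N (u s); set m := N z => /ler_normlP[_ Hz].
have := fA_coercive M Q (u s) z; rewrite -/m => Hc.
have m0 : 0 <= m := N_ge0 M z.
have [->|mn0] := eqVneq m 0.
  rewrite mulr_ge0//; first lra.
  by rewrite addr_ge0 ?(ltW eps0)// !mulr_ge0// ?invr_ge0 ?(ltW k0) ?addr_ge0 ?sqr_ge0// /n N_ge0.
have mp : 0 < m by rewrite lt_neqAle eq_sym mn0.
have D0 : 0 < t - s by lra.
have := HC (u s) z; rewrite -/n -/m => /ler_normlP[HB _].
rewrite -(ler_pM2r mp) -(ler_pM2l k0).
have -> : coer * ((t - s) * (C / coer * (1 + n ^+ 2) * n + eps) * m) =
  (t - s) * (C * (1 + n ^+ 2) * n * m) + eps * coer * (t - s) * m.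
  by field; rewrite gt_eqF.
rewrite -expr2 (le_trans Hc)//.
have := ler_wpM2l (ltW D0) HB.
lra.
Qed.

(** The test function is [u s]: the first-order part of the energy increment is [fA (u s) z (u s)],
    and the remainders are quadratic in [z], hence of order (t - s)^2 by [evolves_increment]. *)
Lemma energy_dini X u s : sub_closed X -> (forall t, 0 <= t -> X (u t)) ->
  evolves X u -> 0 < s -> dini_le (fun t => energy (u t)) s (- fB (u s) (u s)).
Proof.
move=> Xs uX ue s0.
have [C C0 HI] := evolves_increment; have [Cb Cb0 Hb] := fb_le M Q.
set n := N (u s); have n0 : 0 <= n := N_ge0 M _.
pose D := C * (1 + n ^+ 2) * n + 1.
have D0 : 0 <= D by rewrite addr_ge0// !mulr_ge0// addr_ge0// sqr_ge0.
have h0 := pc0_gt0 Q; have h1 := pc1_gt0 Q.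
have hm : 0 < mu / nu by rewrite divr_gt0 ?pmu_gt0 ?pnu_gt0.
pose q := mu / nu; have q0 : 0 < q by [].
(* [G] bounds 6e^2 + 4ex + x^2, the factor left in the remainder of the fourth power once x^2 is
   taken out. *)
pose G := 6 * n ^+ 2 + 4 * n * D + D ^+ 2.
exists (n + Cb * D ^+ 2 + q * ((6 * c0)^-1 + (6 * c1)^-1) * G * D ^+ 2) => eps /andP[ep epl1].
have [d1 d10 H1] := ue s s0 eps ep.
have [d2 d20 H2] := HI X u Xs uX ue s s0 1 ltr01.
(* Requiring [t - s < eps] turns squares of [t - s] into [(t - s) * eps]. *)
exists (Num.min eps (Num.min d1 d2)); first by rewrite !lt_min ep d10.
move=> t /andP[st]; rewrite -ltrBlDl !lt_min => /and3P[te t1 t2].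
have := H1 t ltac:(lra) (u s) (uX s (ltW s0)); rewrite -/n.
have := H2 t ltac:(lra); rewrite -/n -/D.
set z := u t - u s; set Dt := t - s => Hz /ler_normlP[_ HA].
have Dt0 : 0 < Dt by rewrite /Dt; lra.
have Dt1 : Dt <= eps by exact: ltW.
have nz0 : 0 <= N z := N_ge0 M z.
have nzD : N z <= D by rewrite (le_trans Hz)// -[leRHS]mul1r ler_wpM2r//; lra.
have nz2 : N z ^+ 2 <= Dt * eps * D ^+ 2.
  apply: (@le_trans _ _ ((Dt * D) ^+ 2)).
    by rewrite lerXn2r ?nnegrE// mulr_ge0// ltW.
  rewrite exprMn ler_wpM2r ?sqr_ge0// expr2 ler_pM2l//.
have Hbz : fb z z <= Cb * (Dt * eps * D ^+ 2).
  rewrite (le_trans (ler_norm _))// (le_trans (Hb _ _))// -expr2.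
  by rewrite ler_wpM2l.
have rem (e x : R) : `|e| <= n -> `|x| <= N z ->
    (e + x) ^+ 4 - e ^+ 4 - 4 * e ^+ 3 * x <= Dt * eps * D ^+ 2 * G.
  move=> en xn.
  have -> : (e + x) ^+ 4 - e ^+ 4 - 4 * e ^+ 3 * x = x ^+ 2 * (6 * e ^+ 2 + 4 * e * x + x ^+ 2) by ring.
  have xD : `|x| <= D := le_trans xn nzD.
  have x2 : x ^+ 2 <= Dt * eps * D ^+ 2.
    apply: le_trans nz2; rewrite -(real_normK (num_real x)).
    by rewrite lerXn2r ?nnegrE.
  apply: (@le_trans _ _ (x ^+ 2 * G)).
    rewrite ler_wpM2l ?sqr_ge0// /G.
    have : e ^+ 2 <= n ^+ 2.
      by rewrite -(real_normK (num_real e)) lerXn2r ?nnegrE.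
    have : x ^+ 2 <= D ^+ 2.
      by rewrite -(real_normK (num_real x)) lerXn2r ?nnegrE.
    have : e * x <= n * D.
      by rewrite (le_trans (ler_norm _))// normrM ler_pM.
    lra.
  rewrite ler_wpM2r// /G !addr_ge0 ?mulr_ge0 ?sqr_ge0//.
have R0 := rem (e0 (u s)) (e0 z) (e0_le M _) (e0_le M _).
have R1 := rem (e1 (u s)) (e1 z) (e1_le M _) (e1_le M _).
have ut : u t = u s + z by rewrite /z addrC subrK.
have -> : energy (u t) - energy (u s) = fA (u s) z (u s) + fb z z / 2
   + q * (((e0 (u s) + e0 z) ^+ 4 - e0 (u s) ^+ 4 - 4 * e0 (u s) ^+ 3 * e0 z) / (6 * c0)
   + ((e1 (u s) + e1 z) ^+ 4 - e1 (u s) ^+ 4 - 4 * e1 (u s) ^+ 3 * e1 z) / (6 * c1)).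
  rewrite /energy ut (semi_sqD (fb_semi M Q)) (e0D M (u s) z) (e1D M (u s) z) /fA.
  rewrite (semi_sym (fb_semi M Q) (u s) z) -/q; field; lra.
move: R0 R1; set r0 := _ - _ - _; set r1 := _ - _ - _ => R0 R1.
have i0 : 0 < (6 * c0)^-1 by rewrite invr_gt0 mulr_gt0.
have i1 : 0 < (6 * c1)^-1 by rewrite invr_gt0 mulr_gt0.
have R0' := ler_wpM2r (ltW i0) R0.
have R1' := ler_wpM2r (ltW i1) R1.
have := ler_wpM2l (ltW q0) (lerD R0' R1').
have De : 0 <= Dt * eps by rewrite mulr_ge0// ltW.
have := mulr_ge0 Cb0 (mulr_ge0 De (sqr_ge0 D)).
lra.
Qed.

Lemma energy_decay X u r : sub_closed X -> (forall t, 0 <= t -> X (u t)) ->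
  curve_continuous u -> evolves X u -> admissible_rate r ->
  forall t, 0 <= t -> energy (u t) <= energy (u 0) * expR (- (2 * r * t)).
Proof.
move=> Xs uX uc ue [r0 r1 r2 r3 r4] t t0.
have G0 : - (2 * r * t) = - (2 * r) * t - - (2 * r) * 0 by ring.
rewrite G0.
apply: (@gronwall_exp _ (fun t => energy (u t)) (fun t => - (2 * r) * t)
  (fun=> - (2 * r))) => //.
- exact: continuous_ray_energy.
- exact: mulrl_continuous.
- move=> s s0; apply: (is_derive_eq (is_deriveZ _ (is_derive_id _ _))).
  exact: mulr1.
- move=> s s0; apply: le_dini (energy_dini Xs uX ue s0).
  by rewrite mulNr lerN2 fB_energy.
Qed.

Lemma N_decay X u r : sub_closed X -> (forall t, 0 <= t -> X (u t)) ->
  curve_continuous u -> evolves X u -> admissible_rate r ->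
  forall t, 0 <= t ->
    N (u t) <= Num.sqrt (2 * energy (u 0) / coer) * expR (- (r * t)).
Proof.
move=> Xs uX uc ue ra t t0.
have k0 := coer_gt0 Q.
have E0 : 0 <= energy (u 0).
  apply: le_trans (sqr_N_le_energy _); rewrite mulr_ge0 ?sqr_ge0//.
  by rewrite divr_ge0// ltW.
rewrite -(@ler_pXn2r _ 2)// ?nnegrE ?N_ge0 ?mulr_ge0 ?sqrtr_ge0 ?expR_ge0//.
rewrite [leRHS]exprMn [X in _ <= X * _]sqr_sqrtr ?divr_ge0 ?mulr_ge0// ?(ltW k0)//.
rewrite -expRM_natl.
rewrite (_ : 2%:R * - (r * t) = - (2 * r * t)); last by ring.
rewrite mulrAC ler_pdivlMr//.
have := energy_decay Xs uX uc ue ra t0.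
have := sqr_N_le_energy (u t).
lra.
Qed.

End Evolution.

(** * Interpolation error and superconvergence *)

Section Galerkin.
Context {R : realType} {V : lmodType R} (M : h1_model V) (Q : bbm_params R).
Local Notation e0 := (e0 M).
Local Notation e1 := (e1 M).
Local Notation p := (p M).
Local Notation d := (d M).
Local Notation g := (g M).
Local Notation T := (T M).
Local Notation N := (snorm (trip M)).
Local Notation np := (snorm p).
Local Notation nd := (snorm d).
Local Notation wd := (pwd Q).
Local Notation c0 := (pc0 Q).
Local Notation c1 := (pc1 Q).
Local Notation fB := (fB M Q).
Local Notation fBlin := (fBlin M Q).
Local Notation dS := (d_semi M).
Implicit Types (s t r eps del h : R) (X : V -> Prop) (P : V -> V).

(* [X] models V_h, [P] nodal interpolation and [h] the mesh size. *)
Record galerkin X P h : Prop := {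
  gal_sub : sub_closed X;
  gal_X : forall u, X (P u);
  gal_B : forall u v, P (u - v) = P u - P v;
  gal_e0 : forall u, e0 (P u) = e0 u;
  gal_e1 : forall u, e1 (P u) = e1 u;
  gal_orth : forall u chi, X chi -> d (u - P u) chi = 0;
  gal_poincare : forall u, np (u - P u) <= h * nd (u - P u);
  gal_h : 0 <= h <= 1 }.

Section Projection.
Variables (X : V -> Prop) (P : V -> V) (h : R).
Hypothesis G : galerkin X P h.
Local Notation eta u := (u - P u).

Lemma gal_h0 : 0 <= h. Proof. by have /andP[] := gal_h G. Qed.
Lemma gal_h1 : h <= 1. Proof. by have /andP[] := gal_h G. Qed.

Lemma e0_eta u : e0 (eta u) = 0. Proof. by rewrite e0B (gal_e0 G) subrr. Qed.
Lemma e1_eta u : e1 (eta u) = 0. Proof. by rewrite e1B (gal_e1 G) subrr. Qed.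

Lemma etaB u v : eta u - eta v = eta (u - v).
Proof. by rewrite (gal_B G) !opprB addrACA [RHS]addrACA [- v + _]addrC. Qed.

Lemma N_eta u : N (eta u) = nd (eta u).
Proof. by rewrite /snorm /trip e0_eta e1_eta !mul0r !add0r. Qed.

Lemma d_eta_r u v : d u (eta v) = d (eta u) (eta v).
Proof.
rewrite [in RHS](semiBl dS) [d (P u) _](semi_sym dS) (gal_orth G) ?subr0//.
exact: (gal_X G).
Qed.

Lemma nd_eta_le u : nd (eta u) <= nd u.
Proof.
have [->|n0] := eqVneq (nd (eta u)) 0; first exact: snorm_ge0.
have np0 : 0 < nd (eta u) by rewrite lt_neqAle eq_sym n0 snorm_ge0.
rewrite -(ler_pM2r np0) -expr2 (sqr_snorm dS) -d_eta_r.
by rewrite (le_trans (ler_norm _))// (semi_cauchy dS).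
Qed.

Lemma N_P_le u : N (P u) <= N u.
Proof.
rewrite -(@ler_pXn2r _ 2)// ?nnegrE ?N_ge0// !sqr_N (gal_e0 G) (gal_e1 G) lerD2l.
rewrite -[in leRHS](subrK (P u) u) [leRHS](semi_sqD dS) (gal_orth G u (gal_X G u)).
by rewrite mulr0 addr0 lerDr (semi_ge0 dS).
Qed.

End Projection.

Lemma normM_le (x y a b : R) : `|x| <= a -> `|y| <= b -> `|x * y| <= a * b.
Proof. by move=> xa yb; rewrite normrM ler_pM. Qed.

Section Static.
Variables (Cw Ch Ce : R).
Hypotheses (Cw0 : 0 <= Cw) (Ch0 : 0 <= Ch) (Ce0 : 0 <= Ce).

(** What is linear in theta goes into [fBlin]. The terms in eta lose their derivative, by
    orthogonality in [d] and by integration by parts in [g] and [T], so only the L^2 norm of eta, of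
    order h^2, is felt. Every remaining term keeps one decaying factor [rho]. *)
Lemma fB_diff : exists2 C, 0 <= C &
  forall X P h, galerkin X P h -> forall w wh chi rho, X chi ->
  0 <= rho <= 1 -> N w <= Cw * rho -> N wh <= Ch * rho ->
  nd (w - P w) <= Ce * h * rho ->
  `|fB w chi - fB wh chi - fBlin (P w - wh) chi| <=
    C * (rho * N (P w - wh) + h ^+ 2 * rho) * N chi.
Proof.
pose b0 := 2 / (9 * c0); pose b1 := 2 / (9 * c1).
have b00 : 0 < b0 by rewrite divr_gt0 ?mulr_gt0 ?pc0_gt0.
have b10 : 0 < b1 by rewrite divr_gt0 ?mulr_gt0 ?pc1_gt0.
have wd0 := pwd_ge0 Q.
pose S2 := Cw ^+ 2 + Cw * Ch + Ch ^+ 2.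
have S20 : 0 <= S2 by rewrite !addr_ge0 ?mulr_ge0 ?sqr_ge0.
pose CA := (1 + wd) * Ce + (2 * Cw + Ch) * Ce.
pose CB := Cw + Ch + (b0 + b1) * S2.
have CA0 : 0 <= CA by rewrite addr_ge0// !mulr_ge0 ?addr_ge0// mulr_ge0.
have CB0 : 0 <= CB by rewrite !addr_ge0// mulr_ge0// addr_ge0// ltW.
exists (CA + CB); first exact: addr_ge0.
move=> X P h G w wh chi rho Xchi /andP[r0 r1] Hw Hwh He.
have h0 := gal_h0 G.
set eta := w - P w; set th := P w - wh.
have wE : w - wh = eta + th by rewrite /eta /th addrA subrK.
have e0e : e0 eta = 0 := e0_eta G w.
have e1e : e1 eta = 0 := e1_eta G w.
have npe : np eta <= Ce * h ^+ 2 * rho.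
  rewrite (le_trans (gal_poincare G w))//.
  have -> : Ce * h ^+ 2 * rho = h * (Ce * h * rho) by ring.
  by rewrite ler_wpM2l.
have n0 := N_ge0 M th; have m0 := N_ge0 M chi.
(* Where several factors [rho] occur, one is kept and the others are bounded by 1. *)
have rho2 (a : R) : 0 <= a -> a * rho ^+ 2 <= a * rho.
  by move=> a0; rewrite ler_wpM2l// expr2 -[leRHS]mulr1 ler_wpM2l.
have Hd : d w chi = d wh chi + d th chi.
  have -> : w = wh + th + eta by rewrite /th /eta [wh + _]addrC subrK addrC subrK.
  by rewrite (semiDl dS (wh + th) eta) (semiDl dS wh th) (gal_orth G w Xchi : d eta chi = 0) addr0.
have Hg : g w chi = g wh chi + g th chi - g chi eta.
  have -> : w = wh + th + eta by rewrite /th /eta [wh + _]addrC subrK addrC subrK.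
  rewrite (gDl M (wh + th) eta) (gDl M wh th); have := g_parts M eta chi; rewrite e0e e1e; lra.
(* No derivative may fall on [eta]: [T_parts], with zero endpoint values of [eta], rewrites
   [T w eta chi], and [T_sym] moves [eta] to the last slot, the one that [T_leN] measures in L^2. *)
have HT : T w w chi - T wh wh chi =
    T w th chi + T th wh chi + T chi wh eta - T chi w eta - T w chi eta.
  have -> : T w w chi - T wh wh chi = T w (w - wh) chi + T (w - wh) wh chi.
    by rewrite (TBm M w wh) (TBl M w wh); ring.
  rewrite wE (TDm M eta th) (TDl M eta th) (T_sym M chi wh eta) (T_sym M chi w eta).
  have := T_parts M w eta chi; rewrite e0e e1e; lra.
have Hc (e : V -> R) (b : R) : 0 < b -> (forall u, `|e u| <= N u) -> e w = e wh + e th ->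
    `|b * (e w ^+ 3 - e wh ^+ 3) * e chi| <= b * S2 * (rho * N th) * N chi.
  move=> bp eN ew.
  have -> : b * (e w ^+ 3 - e wh ^+ 3) * e chi =
     b * (e w ^+ 2 + e w * e wh + e wh ^+ 2) * e th * e chi by rewrite ew; ring.
  apply: normM_le => //.
  have -> : b * S2 * (rho * N th) = b * (S2 * rho) * N th by ring.
  apply: normM_le => //; rewrite normrM (gtr0_norm bp) ler_wpM2l ?(ltW bp)//.
  apply: le_trans (rho2 _ S20).
  have ww := le_trans (eN w) Hw; have wwh := le_trans (eN wh) Hwh.
  have h1 := normM_le ww ww; have h2 := normM_le ww wwh; have h3 := normM_le wwh wwh.
  rewrite !expr2 (le_trans (ler_normD _ _))//.
  have := ler_normD (e w * e w) (e w * e wh).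
  by rewrite /S2; lra.
have H0 := Hc e0 b0 b00 (e0_le M) ltac:(rewrite -e0D /th [wh + _]addrC subrK (gal_e0 G)//).
have H1 := Hc e1 b1 b10 (e1_le M) ltac:(rewrite -e1D /th [wh + _]addrC subrK (gal_e1 G)//).
have -> : fB w chi - fB wh chi - fBlin th chi = - ((1 + wd) * g chi eta)
    + (T w th chi + T th wh chi + T chi wh eta - T chi w eta - T w chi eta)
    + (b0 * (e0 w ^+ 3 - e0 wh ^+ 3) * e0 chi + b1 * (e1 w ^+ 3 - e1 wh ^+ 3) * e1 chi).
  rewrite -HT /fB /fBlin Hd Hg.
  have -> : e0 th = e0 w - e0 wh by rewrite /th e0B (gal_e0 G).
  have -> : e1 th = e1 w - e1 wh by rewrite /th e1B (gal_e1 G).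
  rewrite -/b0 -/b1; ring.
have T1 : `|T w th chi| <= Cw * (rho * N th) * N chi.
  rewrite (le_trans (T_leN _ _ _ _))// mulrA.
  by rewrite !ler_pM ?mulr_ge0 ?snorm_ge0 ?nd_le ?np_le.
have T2 : `|T th wh chi| <= Ch * (rho * N th) * N chi.
  rewrite (le_trans (T_leN _ _ _ _))// mulrA [Ch * rho * _]mulrC.
  by rewrite !ler_pM ?mulr_ge0 ?snorm_ge0 ?np_le// (le_trans (nd_le _ _)).
have Tgen (a b : V) (A B : R) : N a <= A -> nd b <= B ->
    `|T a b eta| <= A * B * (Ce * h ^+ 2 * rho).
  move=> aA bB; rewrite (le_trans (T_leN _ _ _ _))//.
  by rewrite !ler_pM ?mulr_ge0 ?snorm_ge0.
have T3 := Tgen chi wh _ _ (lexx _) (le_trans (nd_le _ _) Hwh).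
have T4 := Tgen chi w _ _ (lexx _) (le_trans (nd_le _ _) Hw).
have T5 := Tgen w chi _ _ Hw (nd_le _ _).
have G1 : `|(1 + wd) * g chi eta| <= (1 + wd) * (N chi * (Ce * h ^+ 2 * rho)).
  rewrite normrM ger0_norm ?addr_ge0// ler_wpM2l ?addr_ge0//.
  by rewrite (le_trans (g_le _ _ _))// ler_pM ?snorm_ge0 ?nd_le.
have q0 : 0 <= N chi * Ce * h ^+ 2 by rewrite !mulr_ge0 ?sqr_ge0.
have r3 := rho2 _ (mulr_ge0 Ch0 q0).
have r4 := rho2 _ (mulr_ge0 Cw0 q0).
have a1 : 0 <= CA * (rho * N th) * N chi by rewrite !mulr_ge0.
have a2 : 0 <= CB * (h ^+ 2 * rho) * N chi by rewrite !mulr_ge0 ?sqr_ge0.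
rewrite -normrN in G1.
move: G1; set x1 := - _ => G1.
rewrite (le_trans (ler_normD _ _))//.
set y1 := b0 * _ * _ in H0 *; set y2 := b1 * _ * _ in H1 *.
have n1 := ler_normD y1 y2.
have n2 := ler_normD x1 (T w th chi + T th wh chi + T chi wh eta - T chi w eta - T w chi eta).
have n3 := ler_normB (T w th chi + T th wh chi + T chi wh eta - T chi w eta) (T w chi eta).
have n4 := ler_normB (T w th chi + T th wh chi + T chi wh eta) (T chi w eta).
have n5 := ler_normD (T w th chi + T th wh chi) (T chi wh eta).
have n6 := ler_normD (T w th chi) (T th wh chi).
move: a1 a2 T1 T2 T3 T4 T5 G1 H0 H1 r3 r4 n1 n2 n3 n4 n5 n6; rewrite /CA /CB !expr2; lra.
Qed.

End Static.

End Galerkin.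

(** * Time-dependent estimates for the interpolation error and for theta *)

Section Galerkin.
Context {R : realType} {V : lmodType R} (M : h1_model V) (Q : bbm_params R).
Local Notation e0 := (e0 M).
Local Notation e1 := (e1 M).
Local Notation p := (p M).
Local Notation d := (d M).
Local Notation g := (g M).
Local Notation T := (T M).
Local Notation N := (snorm (trip M)).
Local Notation np := (snorm p).
Local Notation nd := (snorm d).
Local Notation mu := (pmu Q).
Local Notation nu := (pnu Q).
Local Notation wd := (pwd Q).
Local Notation c0 := (pc0 Q).
Local Notation c1 := (pc1 Q).
Local Notation k0 := (pk0 Q).
Local Notation k1 := (pk1 Q).
Local Notation fb := (fb M Q).
Local Notation fA := (fA M Q).
Local Notation fB := (fB M Q).
Local Notation fBlin := (fBlin M Q).
Local Notation energy := (energy M Q).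
Local Notation coer := (coer Q).
Local Notation pS := (p_semi M).
Local Notation dS := (d_semi M).
Local Notation nS := (trip_semi M).
Implicit Types (s t r eps del h : R) (X : V -> Prop) (P : V -> V).

Local Notation galerkin := (galerkin M).
Variables (w : R -> V) (q0 : V) (r alpha : R).
Hypotheses (w_cont : curve_continuous M w) (w_evol : evolves M Q (fun=> True) w).
(** [q0] stands for w_0x as an element of H^1; this is the form in which w_0 in H^2 enters the
    model. *)
Hypothesis (w_init : forall v, d (w 0) v = g v q0).
Hypothesis (r_adm : admissible_rate Q r).

Local Notation rho t := (expR (- (r * t))).

Let r0 : 0 <= r. Proof. by case: r_adm. Qed.

Let rho_ge0 t : 0 <= rho t. Proof. exact: expR_ge0. Qed.
Let rho_le1 t : 0 <= t -> rho t <= 1.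
Proof. by move=> t0; rewrite -expR0 ler_expR oppr_le0 mulr_ge0. Qed.
Let rho01 t : 0 <= t -> 0 <= rho t <= 1.
Proof. by move=> t0; rewrite rho_ge0 rho_le1. Qed.

Lemma N_w_decay : exists2 C, 0 <= C & forall t, 0 <= t -> N (w t) <= C * rho t.
Proof.
exists (Num.sqrt (2 * energy (w 0) / coer)); first exact: sqrtr_ge0.
by move=> t t0; apply: (@N_decay R V M Q (fun=> True)).
Qed.

Lemma N_w_increment : exists2 C, 0 <= C & forall s, 0 < s -> forall eps, 0 < eps ->
  exists2 del, 0 < del & forall t, s < t < s + del ->
    N (w t - w s) <= (t - s) * (C * rho s + eps).
Proof.
have [C C0 HC] := evolves_increment M Q.
have [Cw Cw0 HCw] := N_w_decay.
exists (C * (1 + Cw ^+ 2) * Cw); first by rewrite !mulr_ge0// addr_ge0// sqr_ge0.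
move=> s s0 eps eps0.
have [del d0 H] := HC (fun=> True) w (fun _ _ _ _ => I) (fun _ _ => I) w_evol s s0 eps eps0.
exists del => // t st; apply: (le_trans (H t st)).
rewrite ler_wpM2l//; first by case/andP: st; lra.
rewrite lerD2r -[leRHS]mulrA.
have h := HCw s (ltW s0); have n0 := N_ge0 M (w s).
rewrite ler_pM ?mulr_ge0 ?addr_ge0 ?sqr_ge0// ler_wpM2l// lerD2l.
rewrite lerXn2r ?nnegrE// (le_trans h)// -[leRHS]mulr1 ler_wpM2l//.
exact/rho_le1/ltW.
Qed.

Section Eta.

(** Endpoint terms vanish, the second-order term reduces to the two interpolation errors, and in the
    convection terms the test function is undifferentiated, which gains a Poincare factor [h]. *)
Let fB_eta (Cw : R) : 0 <= Cw -> forall X P h, galerkin X P h -> forall u v x,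
  0 <= x <= 1 -> N u <= Cw * x ->
  `|fB u (v - P v) - nu * d (u - P u) (v - P v)| <=
    ((1 + wd + Cw) * Cw) * x * (h * nd (v - P v)).
Proof.
move=> Cw0 X P h G u v x /andP[x0 x1] Hu.
set y := v - P v.
have wd0 := pwd_ge0 Q.
have -> : fB u y - nu * d (u - P u) y = (1 + wd) * g u y + T u u y.
  by rewrite /fB /y (e0_eta G) (e1_eta G) (d_eta_r G u v); ring.
have npy : np y <= h * nd y := gal_poincare G v.
have y0 : 0 <= h * nd y by rewrite mulr_ge0 ?(gal_h0 G) ?snorm_ge0.
have h1 : `|(1 + wd) * g u y| <= (1 + wd) * (Cw * x * (h * nd y)).
  rewrite normrM ger0_norm ?addr_ge0// ler_wpM2l ?addr_ge0//.
  rewrite (le_trans (g_le _ _ _))// ler_pM ?snorm_ge0//.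
  by rewrite (le_trans (nd_le _ _)).
have h2 : `|T u u y| <= Cw * (Cw * x) * (h * nd y).
  rewrite (le_trans (T_leN _ _ _ _))// !ler_pM ?mulr_ge0 ?snorm_ge0//.
    by rewrite (le_trans Hu)// -[leRHS]mulr1 ler_wpM2l.
  by rewrite (le_trans (nd_le _ _)).
rewrite (le_trans (ler_normD _ _))//; lra.
Qed.

Let young (a x y : R) : 0 < a -> 2 * x * y <= a * y ^+ 2 + x ^+ 2 / a.
Proof.
move=> a0; have := sqr_ge0 (a * y - x) => H.
have : 0 <= (a * y - x) ^+ 2 / a by rewrite divr_ge0// ltW.
have -> : (a * y - x) ^+ 2 / a = a * y ^+ 2 - 2 * x * y + x ^+ 2 / a.
  by field; rewrite gt_eqF.
lra.
Qed.

(** ||eta_x||^2 = (w_0x, eta_x) = -(w_0xx, eta), and Poincare bounds ||eta|| by h ||eta_x||. *)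
Lemma eta_init X P h : galerkin X P h -> nd (w 0 - P (w 0)) <= nd q0 * h.
Proof.
move=> G; set y := w 0 - P (w 0).
have [->|n0] := eqVneq (nd y) 0; first by rewrite mulr_ge0 ?snorm_ge0 ?(gal_h0 G).
have yp : 0 < nd y by rewrite lt_neqAle eq_sym n0 snorm_ge0.
rewrite -(ler_pM2r yp) -expr2 (sqr_snorm dS) /y -(d_eta_r G) w_init -/y.
have -> : g y q0 = - g q0 y.
  have := g_parts M y q0; rewrite (e0_eta G) (e1_eta G); lra.
rewrite (le_trans (ler_norm _))// normrN (le_trans (g_le _ _ _))//.
by rewrite -mulrA ler_wpM2l ?snorm_ge0// (gal_poincare G).
Qed.

(** With a = nu/mu and y = ||eta_x||^2, testing with eta gives y' <= -2ay + O(h rho) sqrt(y), and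
    Young's inequality leaves y' <= -(3/2) a y + K h^2 rho^2. Since 2r <= a, the damping outpaces
    the decay of the forcing and y is of the size of the latter. *)
Lemma eta_decay : exists2 C, 0 <= C & forall X P h, galerkin X P h ->
  forall t, 0 <= t -> nd (w t - P (w t)) <= C * h * rho t.
Proof.
have [Cw Cw0 HCw] := N_w_decay.
have [C3 C30 HC3] := N_w_increment.
have mu0 := pmu_gt0 Q; have nu0 := pnu_gt0 Q; have wd0 := pwd_ge0 Q.
pose a := nu / mu; have a0 : 0 < a by rewrite divr_gt0.
have ra : 2 * r <= a.
  case: r_adm => _ _ _ _; rewrite /a ler_pdivlMr//.
  by rewrite mulrA ler_pdivrMr// mul1r.
pose C5 := (1 + wd + Cw) * Cw + C3.
have C50 : 0 <= C5 by rewrite !addr_ge0// mulr_ge0// !addr_ge0.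
(* [K] comes from Young's inequality with weight a/2. With [K'] below, K' h^2 rho^2 is a
   supersolution of the forced inequality, because 3a/2 - 2r >= a/2. *)
pose K := 2 * (C5 / mu) ^+ 2 / a.
have K0 : 0 <= K.
  by apply: divr_ge0 (ltW a0); apply: mulr_ge0 => //; exact: sqr_ge0.
pose K' := 2 * K / a.
have K'0 : 0 <= K'.
  by apply: divr_ge0 (ltW a0); exact: mulr_ge0.
exists (Num.sqrt (nd q0 ^+ 2 + K')); first exact: sqrtr_ge0.
move=> X P h G t t0.
have h0 := gal_h0 G; have h1 := gal_h1 G.
pose eta t := w t - P (w t).
have eta_c : curve_continuous M eta.
  move=> s s0 eps eps0; have [del d0 H] := w_cont s0 eps0.
  exists del => // u u0 /(H u u0); apply: le_trans.
  by rewrite /eta (etaB G) (N_eta G) (le_trans (nd_eta_le G _))// nd_le.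
have Yc : continuous_ray (fun t => d (eta t) (eta t)).
  apply: (continuous_ray_semi eta_c dS ler01) => z v; rewrite mul1r.
  by rewrite (le_trans (semi_cauchy dS _ _))// ler_pM ?snorm_ge0 ?nd_le.
have Yd s : 0 < s -> dini_le (fun t => d (eta t) (eta t)) s
    (- (3 / 2 * a) * d (eta s) (eta s) + K * (h * rho s) ^+ 2).
  move=> s0.
  set y := nd (eta s); have y0 : 0 <= y := snorm_ge0 _ _.
  pose D := C3 + 1; have D0 : 0 <= D by rewrite addr_ge0.
  exists (4 * y / mu + D ^+ 2) => eps /andP[ep epl1].
  have [d1 d10 H1] := w_evol s0 ep.
  have [d2 d20 H2] := HC3 s s0 eps ep.
  exists (Num.min eps (Num.min d1 d2)); first by rewrite !lt_min ep d10.
  move=> u /andP[su]; rewrite -ltrBlDl !lt_min => /and3P[ue u1 u2].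
  have Dt0 : 0 < u - s by lra.
  have := H2 u ltac:(lra); set z := w u - w s => Hz.
  have := H1 u ltac:(lra) (eta s) I; rewrite -/z.
  set Dt := u - s in Dt0 ue Hz *.
  have rs := rho01 (ltW s0).
  have /andP[rs0 rs1] := rs.
  have zD : N z <= Dt * D.
    rewrite (le_trans Hz)// ler_wpM2l ?(ltW Dt0)// lerD//.
    by rewrite -[leRHS]mulr1 ler_wpM2l.
  have npe : np (eta s) <= h * y := gal_poincare G _.
  have Ne : N (eta s) = y := N_eta G _.
  have -> : fA (w s) z (eta s) = p z (eta s) + mu * d (z - P z) (eta s).
    by rewrite /fA /fb /eta (e0_eta G) (e1_eta G) (d_eta_r G z (w s)); ring.
  have := fB_eta Cw0 G (w s) rs (HCw s (ltW s0)).
  rewrite -/(eta s) Ne -/y.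
  set b := fB _ _; set de := z - P z.
  move=> /ler_normlP[HB _] /ler_normlP[_ HA].
  have Hp : `|p z (eta s)| <= Dt * (C3 * rho s + eps) * (h * y).
    rewrite (le_trans (semi_cauchy pS _ _))// ler_pM ?snorm_ge0//.
    by rewrite (le_trans (np_le _ _)).
  have {Hp} /ler_normlP[Hp _] := Hp.
  have hy : h * y <= y by rewrite -[leRHS]mul1r ler_wpM2r.
  have hy0 : 0 <= h * y by rewrite mulr_ge0.
  have -> : d (eta u) (eta u) - d (eta s) (eta s) = 2 * d de (eta s) + d de de.
    have -> : eta u = de + eta s.
      by rewrite /de /z -(etaB G) /eta subrK.
    by rewrite (semi_sqD dS) addrK addrC; ring.
  have dd : d de de <= Dt * eps * D ^+ 2.
    rewrite -(sqr_snorm dS).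
    have : nd de <= Dt * D.
      by rewrite (le_trans (nd_eta_le G _))// (le_trans (nd_le _ _)).
    move=> hd; apply: (@le_trans _ _ ((Dt * D) ^+ 2)).
      by rewrite lerXn2r ?nnegrE ?snorm_ge0// mulr_ge0// ltW.
    by rewrite exprMn ler_wpM2r ?sqr_ge0// expr2 ler_pM2l// ltW.
  have Y2 : d (eta s) (eta s) = y ^+ 2 by rewrite /y (sqr_snorm dS).
  rewrite -/(eta s) Y2 in HB.
  rewrite Y2.
  have key : mu * d de (eta s) <= Dt * (- (nu * y ^+ 2) + C5 * rho s * (h * y) + 2 * y * eps).
    have := ler_wpM2l (ltW Dt0) HB.
    have := ler_wpM2l (ltW (mulr_gt0 Dt0 ep)) hy.
    by rewrite /C5; lra.
  have key2 : d de (eta s) <= Dt * (- (a * y ^+ 2) + C5 / mu * rho s * (h * y) + 2 * y / mu * eps).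
    rewrite -(ler_pM2l mu0) (le_trans key)// le_eqVlt; apply/orP; left; apply/eqP.
    by rewrite /a; field; rewrite gt_eqF.
  have := @young (a / 2) (C5 / mu * (h * rho s)) y ltac:(rewrite divr_gt0//).
  have -> : (C5 / mu * (h * rho s)) ^+ 2 / (a / 2) = K * (h * rho s) ^+ 2.
    by rewrite /K; field; rewrite !gt_eqF.
  move=> yg; have := ler_wpM2l (ltW Dt0) yg.
  lra.
(* Subtracting the supersolution leaves a homogeneous inequality of rate 3a/2. *)
have := @gronwall_exp R (fun t => d (eta t) (eta t) - K' * h ^+ 2 * expR (- (2 * r) * t))
  (fun t => - (3 / 2 * a) * t) (fun=> - (3 / 2 * a)).
move=> /(_ _ _ _ _ t t0).
have rho2 s : expR (- (2 * r) * s) = rho s ^+ 2.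
  by rewrite -expRM_natl; congr expR; ring.
rewrite !rho2 !mulr0 subr0 oppr0 expR0 => Hgr.
have {}Hgr : d (eta t) (eta t) - K' * h ^+ 2 * rho t ^+ 2 <=
  (d (eta 0) (eta 0) - K' * h ^+ 2 * 1 ^+ 2) * expR (- (3 / 2 * a) * t).
  apply: Hgr.
  - apply: continuous_rayD => //; apply: continuous_continuous_ray => x.
    apply: (@continuousN _ _ _ (fun t => K' * h ^+ 2 * expR (- (2 * r) * t))).
    apply: continuousM; first exact: cst_continuous.
    apply: (@continuous_comp _ _ _ (fun x => - (2 * r) * x) expR).
      exact: mulrl_continuous.
    exact: continuous_expR.
  - exact: mulrl_continuous.
  - move=> s s0; apply: (is_derive_eq (is_deriveZ _ (is_derive_id _ _))).
    exact: mulr1.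
  - move=> s s0.
    have hd : is_derive s 1 (fun t => - (K' * h ^+ 2 * expR (- (2 * r) * t)))
        (- (K' * h ^+ 2 * (- (2 * r) * expR (- (2 * r) * s)))).
      apply: is_deriveN; apply: is_deriveZ.
      have hh : is_derive s 1 (fun t : R => - (2 * r) * t) (- (2 * r)).
        by apply: (is_derive_eq (is_deriveZ _ (is_derive_id _ _))); exact: mulr1.
      apply: (is_derive_eq (is_derive1_comp (is_derive_expR _) hh)).
      by rewrite mulrC.
    apply: le_dini (dini_leD (Yd s s0) (dini_le_derive hd)).
    rewrite rho2; set Y := d _ _; set x := rho s.
    have : 0 <= (3 / 2 * a - 2 * r - a / 2) * (K' * (h ^+ 2 * x ^+ 2)).
      apply: mulr_ge0; first lra.
      by apply: mulr_ge0 => //; apply: mulr_ge0; exact: sqr_ge0.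
    have -> : K * (h * x) ^+ 2 = a / 2 * (K' * (h ^+ 2 * x ^+ 2)).
      by rewrite /K' exprMn; field; rewrite gt_eqF.
    lra.
have hr0 : 0 <= h * rho t by rewrite mulr_ge0.
rewrite -mulrA -(@ler_pXn2r _ 2)// ?nnegrE ?snorm_ge0 ?mulr_ge0 ?sqrtr_ge0//.
rewrite [leRHS]exprMn [X in _ <= X * _]sqr_sqrtr ?addr_ge0 ?sqr_ge0//.
rewrite [leLHS](sqr_snorm dS) -/(eta t).
have Y0 : d (eta 0) (eta 0) <= nd q0 ^+ 2 * h ^+ 2.
  rewrite -(sqr_snorm dS) -exprMn lerXn2r ?nnegrE ?mulr_ge0 ?snorm_ge0//.
  exact: (eta_init G).
have ex : expR (- (3 / 2 * a) * t) <= rho t ^+ 2.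
  rewrite -rho2 ler_expR; apply: ler_wpM2r => //; lra.
have ex0 := expR_ge0 (- (3 / 2 * a) * t).
have s1 := ler_wpM2r ex0 Y0.
have s2 := ler_wpM2l (mulr_ge0 (sqr_ge0 (nd q0)) (sqr_ge0 h)) ex.
have s3 := mulr_ge0 (mulr_ge0 K'0 (sqr_ge0 h)) ex0.
rewrite exprMn.
move: Hgr s1 s2 s3. rewrite expr1n mulr1; lra.
Qed.

(** The time derivative of eta is O(h) in the H^1 seminorm, hence O(h^2) in L^2 by Poincare, as the
    mass term [p de chi] in the equation of theta requires. The test function is the increment of
    eta itself. *)
Lemma eta_increment : exists2 C, 0 <= C & forall X P h, galerkin X P h ->
  forall s, 0 < s -> forall eps, 0 < eps ->
  exists2 del, 0 < del & forall t, s < t < s + del ->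
    nd (w t - w s - P (w t - w s)) <= (t - s) * (C * h * rho s + eps).
Proof.
have [Cw Cw0 HCw] := N_w_decay.
have [C3 C30 HC3] := N_w_increment.
have [Ce Ce0 HCe] := eta_decay.
have mu0 := pmu_gt0 Q; have nu0 := pnu_gt0 Q; have wd0 := pwd_ge0 Q.
pose C5 := (1 + wd + Cw) * Cw.
have C50 : 0 <= C5 by rewrite mulr_ge0// !addr_ge0.
exists ((C3 + nu * Ce + C5) / mu).
  by rewrite divr_ge0 ?(ltW mu0)// !addr_ge0// mulr_ge0// ltW.
move=> X P h G s s0 eps eps0.
have h0 := gal_h0 G; have h1 := gal_h1 G.
have em0 : 0 < eps * mu / 2 by rewrite divr_gt0// mulr_gt0.
have [d1 d10 H1] := w_evol s0 em0.
have [d2 d20 H2] := HC3 s s0 _ em0.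
exists (Num.min d1 d2); first by rewrite lt_min d10.
move=> t /andP[st]; rewrite -ltrBlDl lt_min => /andP[t1 t2].
have Dt0 : 0 < t - s by lra.
have := H2 t ltac:(lra); set z := w t - w s => Hz.
set y := z - P z; set m := nd y.
have m0 : 0 <= m := snorm_ge0 _ _.
have := H1 t ltac:(lra) y I; rewrite -/z.
have /andP[rs0 rs1] := rho01 (ltW s0).
have -> : fA (w s) z y = p z y + mu * d y y.
  by rewrite /fA /fb /y (e0_eta G) (e1_eta G) (d_eta_r G z z); ring.
have Ny : N y = m := N_eta G _.
have npy : np y <= h * m := gal_poincare G _.
rewrite Ny -(sqr_snorm dS) -/m => /ler_normlP[_ HA].
have := fB_eta Cw0 G z (rho01 (ltW s0)) (HCw s (ltW s0)).
rewrite -/y -/m -/C5 => /ler_normlP[HB _].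
have /ler_normlP[Hd _] : `|nu * d (w s - P (w s)) y| <= nu * (Ce * h * rho s * m).
  rewrite normrM gtr0_norm// ler_wpM2l ?(ltW nu0)//.
  rewrite (le_trans (semi_cauchy dS _ _))// ler_wpM2r//.
  exact: (HCe _ _ _ G s (ltW s0)).
have /ler_normlP[Hp _] : `|p z y| <= (t - s) * (C3 * rho s + eps * mu / 2) * (h * m).
  rewrite (le_trans (semi_cauchy pS _ _))// ler_pM ?snorm_ge0//.
  by rewrite (le_trans (np_le _ _)).
have [->|mn0] := eqVneq m 0.
  rewrite mulr_ge0 ?(ltW Dt0)// addr_ge0 ?(ltW eps0)//.
  by rewrite !mulr_ge0 ?invr_ge0 ?(ltW mu0)// !addr_ge0// mulr_ge0// ltW.
have mp : 0 < m by rewrite lt_neqAle eq_sym mn0.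
rewrite -(ler_pM2r mp) -(ler_pM2l mu0).
have -> : mu * ((t - s) * ((C3 + nu * Ce + C5) / mu * h * rho s + eps) * m) =
  (t - s) * ((C3 + nu * Ce + C5) * h * rho s * m + mu * eps * m).
  by field; rewrite gt_eqF.
have hm : h * m <= m by rewrite -[leRHS]mul1r ler_wpM2r.
have := ler_wpM2l (ltW (mulr_gt0 Dt0 em0)) hm.
have := ler_wpM2l (ltW Dt0) HB; have := ler_wpM2l (ltW Dt0) Hd.
rewrite -expr2; lra.
Qed.

End Eta.

Lemma fBlin_le : exists2 C, 0 <= C & forall u v, `|fBlin u v| <= C * (N u * N v).
Proof.
have nu0 := pnu_gt0 Q; have wd0 := pwd_ge0 Q.
have h0 := pc0_gt0 Q; have h1 := pc1_gt0 Q.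
have k00 : 0 < k0 by rewrite pk0E; lra.
have k10 : 0 < k1 by rewrite pk1E; lra.
exists (nu + (1 + wd) + (k0 + k1)); first by rewrite !addr_ge0// ltW.
move=> u v.
have a1 : `|d u v| <= N u * N v.
  by rewrite (le_trans (semi_cauchy dS _ _))// ler_pM ?snorm_ge0 ?nd_le.
have a2 : `|g u v| <= N u * N v.
  by rewrite (le_trans (g_le _ _ _))// ler_pM ?snorm_ge0 ?nd_le ?np_le.
have a3 := normM_le (e0_le M u) (e0_le M v).
have a4 := normM_le (e1_le M u) (e1_le M v).
have aM (a x y : R) : 0 <= a -> `|x| <= y -> `|a * x| <= a * y.
  by move=> ? ?; rewrite normrM ger0_norm// ler_wpM2l.
rewrite /fBlin -[k0 * _ * _]mulrA -[k1 * _ * _]mulrA.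
have := aM _ _ _ (ltW nu0) a1; have := aM _ _ _ (addr_ge0 ler01 wd0) a2.
have := aM _ _ _ (ltW k00) a3; have := aM _ _ _ (ltW k10) a4.
set x1 := nu * _; set x2 := (1 + wd) * _; set x3 := k0 * _; set x4 := k1 * _.
have := ler_normD (x1 + x2) (x3 + x4); have := ler_normD x1 x2; have := ler_normD x3 x4.
lra.
Qed.

Section Theta.
Variable lam : R.
Hypotheses (lam0 : 0 < lam) (al0 : 0 <= alpha) (alr : alpha < r).

(** As eta is [d]-orthogonal to V_h, the projection equation tested with theta reads ||theta_x||^2 +
    lam ||theta||^2 = -lam (eta, theta), where only ||eta|| = O(h^2) enters. The 5 stems from the
    traces: |||theta|||^2 <= 4 ||theta||^2 + 5 ||theta_x||^2. *)
Let theta_init : exists2 C, 0 <= C & forall X P h, galerkin X P h -> forall wh0, X wh0 ->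
  (forall chi, X chi -> d (w 0 - wh0) chi + lam * p (w 0 - wh0) chi = 0) ->
  N (P (w 0) - wh0) <= C * h ^+ 2.
Proof.
exists (Num.sqrt (5 * (1 + lam)) * nd q0); first by rewrite mulr_ge0 ?sqrtr_ge0 ?snorm_ge0.
move=> X P h G wh0 Xwh Hp.
have h0 := gal_h0 G.
set eta := w 0 - P (w 0); set th := P (w 0) - wh0.
have Xth : X th := gal_sub G (gal_X G _) Xwh.
have npe : np eta <= nd q0 * h ^+ 2.
  rewrite (le_trans (gal_poincare G _))// expr2 mulrCA ler_wpM2l//.
  exact: (eta_init G).
have := Hp th Xth.
have -> : w 0 - wh0 = eta + th by rewrite /eta /th addrA subrK.
rewrite (semiDl dS eta th) (gal_orth G (w 0) Xth : d eta th = 0) add0r.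
rewrite (semiDl pS eta th) -(sqr_snorm pS th) -(sqr_snorm dS th) => H.
have /ler_normlP[H1 _] := semi_cauchy pS eta th.
set a := np eta in H1 npe *; set b := np th in H H1 *.
have a0 : 0 <= a := snorm_ge0 _ _; have b0 : 0 <= b := snorm_ge0 _ _.
have ba : b <= a.
  have [->//|bn0] := eqVneq b 0; have bp : 0 < b by rewrite lt_neqAle eq_sym bn0.
  rewrite -(ler_pM2r bp) -(ler_pM2l lam0).
  have := ler_wpM2l (ltW lam0) H1; have := sqr_ge0 (nd th); rewrite !expr2 in H *; lra.
have dth : nd th ^+ 2 <= lam * a ^+ 2.
  have := ler_wpM2l (ltW lam0) H1.
  have := ler_wpM2l (ltW lam0) (ler_wpM2l a0 ba).
  have := mulr_ge0 (ltW lam0) (sqr_ge0 b).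
  rewrite !expr2 in H *; lra.
have c00 : 0 <= nd q0 * h ^+ 2 by rewrite mulr_ge0 ?snorm_ge0 ?sqr_ge0.
rewrite -mulrA -(@ler_pXn2r _ 2)// ?nnegrE ?N_ge0 ?mulr_ge0 ?sqrtr_ge0//.
have l1 : 0 <= 5 * (1 + lam) by rewrite mulr_ge0// addr_ge0// ltW.
rewrite [leRHS]exprMn [X in _ <= X * _]sqr_sqrtr// (sqr_N M th).
apply: (@le_trans _ _ (5 * (1 + lam) * a ^+ 2)); last first.
  by rewrite ler_wpM2l// lerXn2r ?nnegrE.
have := e0_trace M th; have := e1_trace M th.
rewrite -(sqr_snorm pS th) -(sqr_snorm dS th) -/b.
have : b ^+ 2 <= a ^+ 2 by rewrite lerXn2r ?nnegrE.
have := sqr_ge0 a; lra.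
Qed.

(** Energy decay from an initial value that is bounded independently of the mesh, through |||P
    w_0||| <= |||w_0||| and [theta_init]. *)
Let wh_decay : exists2 C, 0 <= C & forall X P h, galerkin X P h -> forall wh,
  (forall t, 0 <= t -> X (wh t)) -> curve_continuous M wh -> evolves M Q X wh ->
  (forall chi, X chi -> d (w 0 - wh 0) chi + lam * p (w 0 - wh 0) chi = 0) ->
  forall t, 0 <= t -> N (wh t) <= C * rho t.
Proof.
have [C C0 HC] := theta_init; have [CE CE0 HE] := energy_le M Q.
pose n := N (w 0) + C; have n0 : 0 <= n by rewrite addr_ge0// N_ge0.
have cp := coer_gt0 Q.
exists (Num.sqrt (2 * (CE * (n ^+ 2 + n ^+ 4)) / coer)); first exact: sqrtr_ge0.
move=> X P h G wh Xwh whc whe Hp t t0.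
rewrite (le_trans (N_decay (gal_sub G) Xwh whc whe r_adm t0))// ler_wpM2r//.
rewrite ler_wsqrtr// ler_pM2r ?invr_gt0// ler_pM2l// (le_trans (HE _))// ler_wpM2l//.
have hn : N (wh 0) <= n.
  have -> : wh 0 = P (w 0) - (P (w 0) - wh 0) by rewrite opprB addrC subrK.
  rewrite (le_trans (snormB nS _ _))// lerD ?(N_P_le G)//.
  rewrite (le_trans (HC _ _ _ G _ (Xwh 0 (lexx _)) Hp))// -[leRHS]mulr1 ler_wpM2l//.
  by rewrite exprn_ile1 ?(gal_h0 G) ?(gal_h1 G).
by rewrite lerD// lerXn2r ?nnegrE ?N_ge0.
Qed.

(** Theta is measured by the constant form [fb], since the endpoint weights of [fA (wh s)] vary with
    time. Their difference carries decaying endpoint values and joins the error terms, but it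
    involves the increment of theta, which therefore has to be bounded first. *)
Let theta_dini : exists2 K, 0 <= K & forall X P h, galerkin X P h -> forall wh,
  (forall t, 0 <= t -> X (wh t)) -> curve_continuous M wh -> evolves M Q X wh ->
  (forall chi, X chi -> d (w 0 - wh 0) chi + lam * p (w 0 - wh 0) chi = 0) ->
  forall s, 0 < s -> let th t := P (w t) - wh t in
  dini_le (fun t => fb (th t) (th t) / 2) s
    (- fBlin (th s) (th s) + K * (rho s * N (th s) + h ^+ 2 * rho s) * N (th s)).
Proof.
have [Cw Cw0 HCw] := N_w_decay.
have [Ch Ch0 HCh] := wh_decay.
have [C3 C30 HC3] := N_w_increment.
have [Ce Ce0 HCe] := eta_decay.
have [C4 C40 HC4] := eta_increment.
have [C5 C50 HC5] := fB_diff M Q Cw0 Ch0 Ce0.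
have [CL CL0 HCL] := fBlin_le.
have [Cb Cb0 HCb] := fb_le M Q.
have mu0 := pmu_gt0 Q; have nu0 := pnu_gt0 Q.
have c00 := pc0_gt0 Q; have c10 := pc1_gt0 Q.
have cp := coer_gt0 Q.
pose q := mu / nu; have q0' : 0 < q by rewrite divr_gt0.
pose b0 := 2 / (3 * c0); pose b1 := 2 / (3 * c1).
have b00 : 0 < b0 by rewrite divr_gt0 ?mulr_gt0.
have b10 : 0 < b1 by rewrite divr_gt0 ?mulr_gt0.
have qb : 0 <= q * (b0 + b1) by rewrite mulr_ge0 ?addr_ge0 ?ltW.
(* [Cs] bounds the change of endpoint weights between [w] and [wh], [CW] the gap between [fA (wh s)]
   and [fb], [K1] the whole perturbation in the equation of theta, and [K2] the speed of theta. *)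
pose Cs := q * (b0 + b1) * (Cw + Ch).
have Cs0 : 0 <= Cs by rewrite mulr_ge0// addr_ge0.
pose CW := q * (b0 + b1) * Ch ^+ 2.
have CW0 : 0 <= CW by rewrite mulr_ge0 ?sqr_ge0.
pose K1 := Cs * (C3 + 1) + C5 + C4.
have K10 : 0 <= K1 by rewrite !addr_ge0// mulr_ge0// addr_ge0.
pose K2 := (CL + K1) / coer.
have K20 : 0 <= K2 by apply: divr_ge0 (ltW cp); exact: addr_ge0.
exists (K1 + CW * K2); first by rewrite addr_ge0// mulr_ge0.
move=> X P h G wh Xwh whc whe Hp s s0 th.
have h0 := gal_h0 G; have h1 := gal_h1 G.
have sw := ltW s0.
have rs := rho01 sw; have /andP[rs0 rs1] := rs.
set x := rho s in rs rs0 rs1 *.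
set n := N (th s); have n0 : 0 <= n := N_ge0 M _.
have Xth : X (th s) := gal_sub G (gal_X G _) (Xwh s sw).
pose F := x * n + h ^+ 2 * x.
have F0 : 0 <= F by rewrite addr_ge0 ?mulr_ge0 ?sqr_ge0.
pose D := K2 * (n + h ^+ 2 * x) + 3 / coer.
have h2x : 0 <= h ^+ 2 * x by apply: mulr_ge0 => //; exact: sqr_ge0.
have D0 : 0 <= D.
  by apply: addr_ge0; [exact/mulr_ge0/addr_ge0|exact/divr_ge0/ltW].
exists (3 * n + CW * x * (3 / coer) * n + Cb * D ^+ 2) => eps /andP[ep epl1].
have [d1 d10 H1] := w_evol s0 ep.
have [d2 d20 H2] := whe s s0 eps ep.
have [d3 d30 H3] := HC3 s s0 eps ep.
have [d4 d40 H4] := HC4 X P h G s s0 eps ep.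
exists (Num.min eps (Num.min (Num.min d1 d2) (Num.min d3 d4))).
  by rewrite !lt_min ep d10 d20 d30.
move=> t /andP[st]; rewrite -ltrBlDl !lt_min => /and3P[te /andP[t1 t2] /andP[t3 t4]].
have tp : 0 <= t by lra.
have Dt0 : 0 < t - s by lra.
have {H3} := H3 t ltac:(lra); have {H4} := H4 t ltac:(lra).
have {H1} := H1 t ltac:(lra); have {H2} := H2 t ltac:(lra).
set dw := w t - w s; set dwh := wh t - wh s.
set Dt := t - s in Dt0 te *.
have Xdwh : X dwh := gal_sub G (Xwh t tp) (Xwh s sw).
set de := dw - P dw; pose dth := P dw - dwh.
have Xdth : X dth := gal_sub G (gal_X G _) Xdwh.
move=> H2 H1 H4 H3.
have thE : th t = th s + dth.
  have -> : dth = P (w t) - P (w s) - (wh t - wh s) by rewrite /dth /dw (gal_B G).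
  by rewrite /th [RHS]addrC opprB addrACA subrK [wh s - _ - _]addrAC subrr sub0r.
have nw := HCw s sw; have nwh := HCh X P h G wh Xwh whc whe Hp s sw.
have nde := HCe X P h G s sw.
have npde : np de <= Dt * (C4 * h ^+ 2 * x + eps).
  rewrite (le_trans (gal_poincare G _))//.
  apply: (@le_trans _ _ (h * (Dt * (C4 * h * x + eps)))); first by rewrite ler_wpM2l.
  have -> : h * (Dt * (C4 * h * x + eps)) = Dt * (C4 * h ^+ 2 * x + h * eps) by ring.
  by rewrite ler_pM2l// lerD2l -[leRHS]mul1r ler_wpM2r// ltW.
have ndw : N dw <= Dt * (C3 + 1).
  rewrite (le_trans H3)// ler_pM2l// lerD// -[leRHS]mulr1 ler_wpM2l//.
(* The equation of theta against V_h. It is used twice: with the increment of theta for its speed,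
   and with theta itself for the Dini derivative. *)
have main chi : X chi -> `|fA (wh s) dth chi + Dt * fBlin (th s) chi| <=
    Dt * N chi * (K1 * F + 3 * eps).
  move=> Xchi; have {}H1 := H1 chi I; have {}H2 := H2 chi Xchi.
  have HB := HC5 X P h G (w s) (wh s) chi x Xchi rs nw nwh nde.
  set m := N chi in HB H1 H2 *; have m0 : 0 <= m := N_ge0 M _.
  rewrite -/(th s) -/n -/F in HB.
  (* [S] is the effect of the different endpoint weights of [w] and [wh]; the difference of squares
     factors through the endpoint value of theta. *)
  pose S := q * (b0 * (e0 (th s) * (e0 (w s) + e0 (wh s)) * e0 dw * e0 chi)
               + b1 * (e1 (th s) * (e1 (w s) + e1 (wh s)) * e1 dw * e1 chi)).
  have HA : fA (w s) dw chi - fA (wh s) dwh chi = fA (wh s) dth chi + p de chi + S.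
    have -> : fA (w s) dw chi = fA (w s) dth chi + fA (w s) dwh chi + p de chi.
      have dwE : dw = dth + dwh + de by rewrite /dth /de subrK addrC subrK.
      have d0 : d de chi = 0 := gal_orth G dw Xchi.
      have e0d : e0 de = 0 := e0_eta G dw.
      have e1d : e1 de = 0 := e1_eta G dw.
      rewrite {1}dwE /fA /fb (semiDl pS (dth + dwh) de) (semiDl pS dth dwh).
      rewrite (semiDl dS (dth + dwh) de) (semiDl dS dth dwh) d0.
      rewrite (e0D M (dth + dwh) de) (e0D M dth dwh) e0d.
      rewrite (e1D M (dth + dwh) de) (e1D M dth dwh) e1d; ring.
    have e0t : e0 (th s) = e0 (w s) - e0 (wh s) by rewrite /th e0B (gal_e0 G).
    have e1t : e1 (th s) = e1 (w s) - e1 (wh s) by rewrite /th e1B (gal_e1 G).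
    have e0w : e0 dw = e0 dth + e0 dwh by rewrite -e0D /dth subrK (gal_e0 G).
    have e1w : e1 dw = e1 dth + e1 dwh by rewrite -e1D /dth subrK (gal_e1 G).
    rewrite /fA /S e0t e1t e0w e1w -/q -/b0 -/b1; ring.
  have HS : `|S| <= Dt * (Cs * (C3 + 1) * (x * n) * m).
    have key (e : V -> R) (b : R) : 0 < b -> (forall u, `|e u| <= N u) ->
        `|b * (e (th s) * (e (w s) + e (wh s)) * e dw * e chi)| <=
        b * (n * ((Cw + Ch) * x) * (Dt * (C3 + 1)) * m).
      move=> bp eN; rewrite normrM gtr0_norm// ler_wpM2l ?(ltW bp)//.
      do 2!(apply: normM_le; last by rewrite (le_trans (eN _))).
      apply: normM_le; first exact: eN.
      by rewrite (le_trans (ler_normD _ _))// mulrDl lerD// (le_trans (eN _)).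
    rewrite /S normrM gtr0_norm//.
    have -> : Dt * (Cs * (C3 + 1) * (x * n) * m) =
      q * (b0 * (n * ((Cw + Ch) * x) * (Dt * (C3 + 1)) * m) +
           b1 * (n * ((Cw + Ch) * x) * (Dt * (C3 + 1)) * m)) by rewrite /Cs; ring.
    rewrite ler_wpM2l ?(ltW q0')// (le_trans (ler_normD _ _))//.
    by rewrite lerD// key//; [exact: e0_le|exact: e1_le].
  have Hpe : `|p de chi| <= Dt * (C4 * h ^+ 2 * x + eps) * m.
    by rewrite (le_trans (semi_cauchy pS _ _))// ler_pM ?snorm_ge0// np_le.
  have -> : fA (wh s) dth chi + Dt * fBlin (th s) chi =
     (fA (w s) dw chi + Dt * fB (w s) chi) - (fA (wh s) dwh chi + Dt * fB (wh s) chi)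
     - p de chi - S - Dt * (fB (w s) chi - fB (wh s) chi - fBlin (th s) chi).
    have -> : fA (wh s) dth chi = fA (w s) dw chi - fA (wh s) dwh chi - p de chi - S.
      by rewrite HA; ring.
    ring.
  set r1 := fA (w s) dw chi + _ in H1 *; set r2 := fA (wh s) dwh chi + _ in H2 *.
  set r3 := p de chi in Hpe *.
  set r5 := _ - _ - fBlin _ _ in HB *.
  have HB' : `|Dt * r5| <= Dt * (C5 * F * m).
    by rewrite normrM gtr0_norm// ler_pM2l.
  have z1 := ler_normB r1 r2; have z2 := ler_normB (r1 - r2) r3.
  have z3 := ler_normB (r1 - r2 - r3) S.
  have z4 := ler_normB (r1 - r2 - r3 - S) (Dt * r5).
  have y1 : 0 <= Dt * m * (C4 * (x * n)).
    by rewrite !mulr_ge0// ltW.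
  have y2 : 0 <= Dt * m * (Cs * (C3 + 1) * (h ^+ 2 * x)).
    by rewrite (mulr_ge0 (mulr_ge0 (ltW Dt0) m0))// mulr_ge0// mulr_ge0// addr_ge0.
  move: H1 H2 HS Hpe HB' z1 z2 z3 z4 y1 y2; rewrite /K1 /F; lra.
set m := N dth; have m0 : 0 <= m := N_ge0 M _.
have hm : m <= Dt * (K2 * (n + h ^+ 2 * x) + 3 / coer * eps).
  have [->|mn0] := eqVneq m 0.
    apply: mulr_ge0 (ltW Dt0) _; apply: addr_ge0; first exact/mulr_ge0/addr_ge0.
    by apply: mulr_ge0 (ltW ep); exact/divr_ge0/ltW.
  have mp : 0 < m by rewrite lt_neqAle eq_sym mn0.
  have /ler_normlP[_ M1] := main dth Xdth.
  have M2 := fA_coercive M Q (wh s) dth.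
  have /ler_normlP[M3 _] := HCL (th s) dth.
  rewrite -/m -/n in M1 M2 M3.
  rewrite -(ler_pM2r mp) -(ler_pM2l cp).
  have -> : coer * (Dt * (K2 * (n + h ^+ 2 * x) + 3 / coer * eps) * m) =
     Dt * m * ((CL + K1) * (n + h ^+ 2 * x) + 3 * eps).
    by rewrite /K2; field; rewrite gt_eqF.
  have M4 := ler_wpM2l (ltW Dt0) M3.
  have M5 : Dt * m * (K1 * F) <= Dt * m * (K1 * (n + h ^+ 2 * x)).
    rewrite ler_wpM2l ?mulr_ge0 ?(ltW Dt0)// ler_wpM2l// /F lerD2r.
    by rewrite -[leRHS]mul1r ler_wpM2r.
  have M6 : 0 <= Dt * m * (CL * (h ^+ 2 * x)).
    by rewrite (mulr_ge0 (mulr_ge0 (ltW Dt0) m0))// mulr_ge0.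
  rewrite -expr2; lra.
have hmD : m <= Dt * D.
  rewrite (le_trans hm)// ler_pM2l// lerD2l -[leRHS]mulr1 ler_wpM2l//.
  by rewrite divr_ge0// ltW.
have m2 : m ^+ 2 <= Dt * eps * D ^+ 2.
  apply: (@le_trans _ _ ((Dt * D) ^+ 2)).
    by rewrite lerXn2r ?nnegrE// mulr_ge0// ltW.
  by rewrite exprMn ler_wpM2r ?sqr_ge0// expr2 ler_pM2l// ltW.
have -> : fb (th t) (th t) / 2 - fb (th s) (th s) / 2 = fb dth (th s) + fb dth dth / 2.
  by rewrite thE (semi_sqD (fb_semi M Q)) (semi_sym (fb_semi M Q) (th s) dth); lra.
have Q1 : fb dth dth <= Cb * (Dt * eps * D ^+ 2).
  rewrite (le_trans (ler_norm _))// (le_trans (HCb _ _))// -expr2.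
  by rewrite ler_wpM2l.
have Q1' : 0 <= Cb * (Dt * eps * D ^+ 2).
  by rewrite !mulr_ge0 ?sqr_ge0// ltW.
have /ler_normlP[_ Q2] := main (th s) Xth.
rewrite -/n in Q2.
pose W := q * (b0 * (e0 (wh s) * e0 (wh s) * e0 dth * e0 (th s))
             + b1 * (e1 (wh s) * e1 (wh s) * e1 dth * e1 (th s))).
have QA : fA (wh s) dth (th s) = fb dth (th s) + W.
  by rewrite /fA /W -/q -/b0 -/b1; ring.
have HW : `|W| <= CW * x * m * n.
  have key (e : V -> R) (b : R) : 0 < b -> (forall u, `|e u| <= N u) ->
      `|b * (e (wh s) * e (wh s) * e dth * e (th s))| <= b * (Ch ^+ 2 * x * m * n).
    move=> bp eN; rewrite normrM gtr0_norm// ler_wpM2l ?(ltW bp)//.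
    do 2!(apply: normM_le; last exact: eN).
    have ee := le_trans (eN (wh s)) nwh.
    apply: (le_trans (normM_le ee ee)).
    have -> : Ch * x * (Ch * x) = Ch ^+ 2 * x * x by ring.
    by rewrite -[leRHS]mulr1 ler_wpM2l// mulr_ge0 ?sqr_ge0.
  rewrite /W normrM gtr0_norm//.
  have -> : CW * x * m * n = q * (b0 * (Ch ^+ 2 * x * m * n) + b1 * (Ch ^+ 2 * x * m * n)).
    by rewrite /CW; ring.
  rewrite ler_wpM2l ?(ltW q0')// (le_trans (ler_normD _ _))//.
  by rewrite lerD// key//; [exact: e0_le|exact: e1_le].
have /ler_normlP[HW' _] := HW.
(* With [x] in front, [x * (n + h ^+ 2 * x) <= F] because [x <= 1]. *)
have HW2 : CW * x * m * n <= Dt * (CW * K2 * F * n + CW * x * (3 / coer) * n * eps).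
  apply: (@le_trans _ _ (CW * x * n * (Dt * (K2 * (n + h ^+ 2 * x) + 3 / coer * eps)))).
    by rewrite [CW * x * m * n]mulrAC ler_wpM2l// (mulr_ge0 (mulr_ge0 CW0 rs0)).
  have : 0 <= CW * n * Dt * K2 * (h ^+ 2 * x * (1 - x)).
    apply: mulr_ge0; last by rewrite mulr_ge0// subr_ge0.
    exact: (mulr_ge0 (mulr_ge0 (mulr_ge0 CW0 n0) (ltW Dt0)) K20).
  rewrite /F; lra.
rewrite QA in Q2; move: Q2 HW' HW2 Q1 Q1'; rewrite -/F; lra.
Qed.

(** Adding h^4 tau^2 to y makes the inequality homogeneous: z' <= (-2 alpha + K4 sg) z. The integral
    of [K4 * sg] over all times is K4 / e, so Gronwall costs the factor exp(K4 / e), uniformly in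
    t. *)
Lemma galerkin_error : exists2 K, 0 <= K & forall X P h, galerkin X P h -> forall wh,
  (forall t, 0 <= t -> X (wh t)) -> curve_continuous M wh -> evolves M Q X wh ->
  (forall chi, X chi -> d (w 0 - wh 0) chi + lam * p (w 0 - wh 0) chi = 0) ->
  forall t, 0 <= t ->
    N (w t - wh t) <= K * h * expR (- (alpha * t)) /\
    np (w t - wh t) <= K * h ^+ 2 * expR (- (alpha * t)).
Proof.
have [Ci Ci0 HCi] := theta_init.
have [K3 K30 HK3] := theta_dini.
have [Ce Ce0 HCe] := eta_decay.
have [Cb Cb0 HCb] := fb_le M Q.
have cp := coer_gt0 Q.
pose e := r - alpha; have e0' : 0 < e by rewrite subr_gt0.
(* 3/coer is the 3/2 from splitting the cross term times the 2/coer that bounds |||theta|||^2 by y;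
   the 1 is the coefficient of h^4 tau^2. *)
pose K4 := K3 * (3 / coer + 1).
have K40 : 0 <= K4 by rewrite mulr_ge0// addr_ge0// divr_ge0// ltW.
pose C0 := (Cb * Ci ^+ 2 + 1) * expR (K4 / e).
have C00 : 0 <= C0 by rewrite mulr_ge0 ?expR_ge0// addr_ge0// mulr_ge0// sqr_ge0.
pose Ct := Num.sqrt (2 / coer * C0).
have Ct0 : 0 <= Ct := sqrtr_ge0 _.
exists (Ce + Ct); first exact: addr_ge0.
move=> X P h G wh Xwh whc whe Hp t t0.
have h0 := gal_h0 G; have h1 := gal_h1 G.
pose th t := P (w t) - wh t.
pose tau t := expR (- (alpha * t)).
(* [tau] is the claimed decay and [sg] the integrable surplus: rho = sg tau. *)
pose sg t := expR (- (e * t)).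
have rhoE s : rho s = sg s * tau s by rewrite /sg /tau -expRD /e; congr expR; ring.
have tau0 s : 0 <= tau s := expR_ge0 _.
have sg0 s : 0 <= sg s := expR_ge0 _.
pose y t := fb (th t) (th t) / 2.
have yN u : coer / 2 * N (th u) ^+ 2 <= y u.
  by rewrite /y; have := fb_coercive M Q (th u); lra.
have th_c : curve_continuous M th.
  move=> s s0 eps eps0.
  have [d1 d10 H1] := w_cont s0 (ltac:(lra) : 0 < eps / 2).
  have [d2 d20 H2] := whc s s0 _ (ltac:(lra) : 0 < eps / 2).
  exists (Num.min d1 d2); first by rewrite lt_min d10.
  move=> u u0; rewrite lt_min => /andP[/(H1 u u0) h3 /(H2 u u0) h4].
  have -> : th u - th s = P (w u - w s) - (wh u - wh s).
    by rewrite (gal_B G) /th !opprB addrACA [RHS]addrACA [- wh u + _]addrC.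
  rewrite (le_trans (snormB nS _ _))//.
  have := N_P_le G (w u - w s); lra.
pose z t := y t + h ^+ 4 * expR (- (2 * alpha) * t).
have tau2 s : expR (- (2 * alpha) * s) = tau s ^+ 2.
  by rewrite -expRM_natl; congr expR; ring.
have zt : z t <= z 0 * expR ((- (2 * alpha) * t - K4 / e * expR (- e * t))
    - (- (2 * alpha) * 0 - K4 / e * expR (- e * 0))).
  apply: (@gronwall_exp _ z (fun t => - (2 * alpha) * t - K4 / e * expR (- e * t))
    (fun s => - (2 * alpha) + K4 * sg s)) => //.
  - apply: continuous_rayD.
      apply: continuous_rayM; last exact: continuous_ray_cst.
      exact: (continuous_ray_semi th_c (fb_semi M Q) Cb0).
    apply: continuous_continuous_ray => x.
    apply: (@continuousM _ _ (cst (h ^+ 4)) (fun t => expR (- (2 * alpha) * t))); first exact: cst_continuous.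
    apply: (@continuous_comp _ _ _ (fun x => - (2 * alpha) * x) expR).
      exact: mulrl_continuous.
    exact: continuous_expR.
  - move=> x; apply: (@continuousB _ _ _ (fun t => - (2 * alpha) * t)
      (fun t => K4 / e * expR (- e * t))); first exact: mulrl_continuous.
    apply: (@continuousM _ _ (cst (K4 / e)) (fun t => expR (- e * t))); first exact: cst_continuous.
    apply: (@continuous_comp _ _ _ (fun x => - e * x) expR).
      exact: mulrl_continuous.
    exact: continuous_expR.
  - move=> s s0.
    have h3 (a : R) : is_derive s 1 (fun t : R => a * t) a.
      by apply: (is_derive_eq (is_deriveZ _ (is_derive_id _ _))); exact: mulr1.
    have h4 := is_derive1_comp (is_derive_expR _) (h3 (- e)).
    have h5 := is_deriveZ (K4 / e) h4.
    apply: (is_derive_eq (is_deriveB (h3 _) h5)).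
    rewrite /GRing.scale/= /sg mulNr; field; rewrite gt_eqF//.
  - move=> s s0.
    have hd : is_derive s 1 (fun t => h ^+ 4 * expR (- (2 * alpha) * t))
        (h ^+ 4 * (- (2 * alpha) * expR (- (2 * alpha) * s))).
      apply: is_deriveZ.
      have hh : is_derive s 1 (fun t : R => - (2 * alpha) * t) (- (2 * alpha)).
        by apply: (is_derive_eq (is_deriveZ _ (is_derive_id _ _))); exact: mulr1.
      apply: (is_derive_eq (is_derive1_comp (is_derive_expR _) hh)).
      by rewrite mulrC.
    have hd2 := HK3 X P h G wh Xwh whc whe Hp s s0.
    apply: le_dini (dini_leD hd2 (dini_le_derive hd)).
    rewrite -/(th s) rhoE /z tau2; set n := N (th s).
    have n0 : 0 <= n := N_ge0 M _.
    have [ra1 ra2 ra3 ra4 _] := r_adm.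
    have := @fBlin_ge R V M Q r ra1 ra2 ra3 ra4 (th s).
    have -> : fb (th s) (th s) = 2 * y s by rewrite /y; lra.
    move=> h3.
    have hy : coer / 2 * n ^+ 2 <= y s := yN s.
    have y0 : 0 <= y s by apply: le_trans hy; rewrite mulr_ge0 ?sqr_ge0// divr_ge0// ltW.
    have h4 : 2 * alpha * y s <= fBlin (th s) (th s).
      have : 2 * alpha * y s <= 2 * r * y s.
        by rewrite ler_wpM2r// ler_pM2l// ltW.
      have := mulr_ge0 (ltW (pc0_gt0 Q)) (sqr_ge0 (e0 (th s))).
      have := mulr_ge0 (ltW (pc1_gt0 Q)) (sqr_ge0 (e1 (th s))).
      lra.
    have [sg1 tau1] : sg s <= 1 /\ tau s <= 1.
      by rewrite /sg /tau -expR0 !ler_expR !oppr_le0 !mulr_ge0// ltW.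
    have h5 : (sg s * tau s * n + h ^+ 2 * (sg s * tau s)) * n <=
        sg s * (3 / 2 * n ^+ 2 + h ^+ 4 * tau s ^+ 2).
      have := sqr_ge0 (h ^+ 2 * tau s - n).
      have : 0 <= n ^+ 2 * (1 - tau s) by rewrite mulr_ge0 ?sqr_ge0 ?subr_ge0.
      have : 0 <= h ^+ 4 * tau s ^+ 2 by rewrite mulr_ge0 ?sqr_ge0 ?exprn_even_ge0.
      move=> u1 u2 u3.
      have : 0 <= sg s * (3 / 2 * n ^+ 2 + h ^+ 4 * tau s ^+ 2 - (tau s * n + h ^+ 2 * tau s) * n).
        by rewrite mulr_ge0//; lra.
      lra.
    have h6 := ler_wpM2l K30 h5.
    have h7 : 3 / 2 * n ^+ 2 <= 3 / coer * y s.
      have c3 : 0 <= 3 / coer := divr_ge0 (ler0n R 3) (ltW cp).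
      have := ler_wpM2l c3 hy.
      by have -> : 3 / coer * (coer / 2 * n ^+ 2) = 3 / 2 * n ^+ 2 by field; rewrite gt_eqF.
    have h8 := ler_wpM2l (mulr_ge0 K30 (sg0 s)) h7.
    have h9 : 0 <= K3 * sg s * y s := mulr_ge0 (mulr_ge0 K30 (sg0 s)) y0.
    have h10 : 0 <= K3 * sg s * (3 / coer) * (h ^+ 4 * tau s ^+ 2).
      apply: mulr_ge0; last by rewrite mulr_ge0 ?sqr_ge0 ?exprn_even_ge0.
      by apply: mulr_ge0; [exact: mulr_ge0|exact: (divr_ge0 (ler0n R 3) (ltW cp))].
    rewrite /K4; move: h4 h6 h8 h9 h10; lra.
have z0 : z 0 <= (Cb * Ci ^+ 2 + 1) * h ^+ 4.
  rewrite /z mulr0 expR0 mulr1 mulrDl mul1r lerD2r.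
  have hi := HCi X P h G (wh 0) (Xwh 0 (lexx _)) Hp.
  have := HCb (th 0) (th 0); rewrite -expr2 => /(le_trans (ler_norm _)).
  have : N (th 0) ^+ 2 <= (Ci * h ^+ 2) ^+ 2.
    by rewrite lerXn2r ?nnegrE ?N_ge0// mulr_ge0 ?sqr_ge0.
  move=> /(ler_wpM2l Cb0) u1 u2.
  have : 0 <= Cb * (Ci * h ^+ 2) ^+ 2 by rewrite mulr_ge0 ?sqr_ge0.
  have -> : Cb * Ci ^+ 2 * h ^+ 4 = Cb * (Ci * h ^+ 2) ^+ 2 by ring.
  rewrite /y; lra.
have nth : N (th t) <= Ct * h ^+ 2 * tau t.
  have hh : 0 <= h ^+ 2 * tau t by rewrite mulr_ge0 ?sqr_ge0.
  rewrite -mulrA -(@ler_pXn2r _ 2)// ?nnegrE ?N_ge0 ?mulr_ge0//.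
  rewrite [leRHS]exprMn [X in _ <= X * _]sqr_sqrtr; last first.
    by rewrite mulr_ge0// divr_ge0// ltW.
  have zb : z t <= C0 * (h ^+ 4 * tau t ^+ 2).
    apply: (le_trans zt).
    have z00 : 0 <= z 0.
      apply: addr_ge0; last by rewrite mulr_ge0 ?expR_ge0 ?exprn_even_ge0.
      by apply: le_trans (yN 0); rewrite mulr_ge0 ?sqr_ge0// divr_ge0// ltW.
    apply: (@le_trans _ _ ((Cb * Ci ^+ 2 + 1) * h ^+ 4 * (tau t ^+ 2 * expR (K4 / e)))); last first.
      by rewrite /C0 le_eqVlt; apply/orP; left; apply/eqP; ring.
    apply: (ler_pM z00 (expR_ge0 _) z0).
    rewrite -tau2 -expRD ler_expR !mulr0 expR0 mulr1.
    have : 0 <= K4 / e * expR (- e * t).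
      by rewrite mulr_ge0 ?expR_ge0// divr_ge0// ltW.
    lra.
  have zy : y t <= z t by rewrite /z lerDl (mulr_ge0 (exprn_even_ge0 h _))// expR_ge0.
  have := le_trans (yN t) (le_trans zy zb).
  have c2 : 0 <= 2 / coer := divr_ge0 (ler0n R 2) (ltW cp).
  move=> /(ler_wpM2l c2).
  have -> : 2 / coer * (coer / 2 * N (th t) ^+ 2) = N (th t) ^+ 2 by field; rewrite gt_eqF.
  move=> H; apply: (le_trans H).
  by rewrite le_eqVlt; apply/orP; left; apply/eqP; ring.
have ert : rho t <= tau t.
  rewrite rhoE -[leRHS]mul1r ler_wpM2r// /sg -expR0 ler_expR oppr_le0 mulr_ge0//.
  exact: ltW.
have nde : nd (w t - P (w t)) <= Ce * h * tau t.
  by rewrite (le_trans (HCe X P h G t t0))// ler_wpM2l// mulr_ge0.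
have -> : w t - wh t = (w t - P (w t)) + th t by rewrite /th addrA subrK.
split.
  rewrite (le_trans (snormD nS _ _))// 2!mulrDl lerD ?(N_eta G)//.
  rewrite (le_trans nth)// ler_wpM2r// ler_wpM2l// expr2 -[leRHS]mulr1.
  by rewrite ler_wpM2l.
rewrite (le_trans (snormD pS _ _))// 2!mulrDl lerD//.
  rewrite (le_trans (gal_poincare G _))//.
  have -> : Ce * h ^+ 2 * expR (- (alpha * t)) = h * (Ce * h * tau t) by rewrite /tau; ring.
  by rewrite ler_wpM2l.
by rewrite (le_trans (np_le _ _)).
Qed.

End Theta.

End Galerkin.

(** * Square integrable functions and primitives *)

Section L2theory.
Context {R : realType}.
Local Notation leb := (@lebesgue_measure R).
Local Notation I01 := (`]0%R, 1%R[%classic : set R).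
Implicit Types (f g h : R -> R).

Let mI : measurable I01. Proof. exact: measurable_itv. Qed.

Lemma leb_I01 : leb I01 = 1%E.
Proof. by rewrite lebesgue_measure_itv/= lte_fin ltr01 sube0. Qed.

Lemma L2_measurable f : L2 f -> measurable_fun I01 f.
Proof.
rewrite /L2 inE => /andP[]; rewrite inE/= => H _.
exact: ((measurable_restrictT f mI).2 H).
Qed.

Lemma L2_sqr_integrable f : L2 f ->
  leb.-integrable I01 (EFin \o (fun x => f x ^+ 2)).
Proof.
move=> /Lfun2_integrable_sqr H; apply/integrable_mkcond => //.
apply: eq_integrable H => // x _ /=.
by rewrite !patchE; case: ifP => //= _; rewrite expr0n.
Qed.

Lemma L2_intro f : measurable_fun I01 f ->
  (\int[leb]_(x in I01) (f x ^+ 2)%:E < +oo)%E -> L2 f.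
Proof.
move=> mf fi; rewrite /L2 inE; apply/andP; split; rewrite inE/=.
  exact: ((measurable_restrictT f mI).1 mf).
rewrite /finite_norm unlock /Lnorm poweR_lty//.
rewrite [ltLHS](_ : _ = \int[leb]_(x in I01) (f x ^+ 2)%:E)%E//.
rewrite [RHS]integral_mkcond; congr integral; apply/funext => x /=.
rewrite /patch; case: ifP => // _; first by rewrite powR_mulrn// real_normK ?num_real.
by rewrite normr0 powR0// pnatr_eq0.
Qed.

Lemma L2_mul_integrable f g : L2 f -> L2 g ->
  leb.-integrable I01 (EFin \o (fun x => f x * g x)).
Proof.
move=> f2 g2; apply/integrable_mkcond => //.
have /Lfun1_integrable H := Lfun2_mul_Lfun1 f2 g2.
apply: eq_integrable H => // x _ /=.
by rewrite !patchE; case: ifP => //= _; rewrite mulr0.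
Qed.

Lemma L2_bounded f (M : R) : measurable_fun I01 f ->
  (forall x, 0 < x < 1 -> `|f x| <= M) -> L2 f.
Proof.
move=> mf fM; apply: L2_intro => //.
apply: (@le_lt_trans _ _ (\int[leb]_(x in I01) (cst (M ^+ 2)%:E x))%E).
  apply: ge0_le_integral => //=.
  - by move=> x _; rewrite lee_fin sqr_ge0.
  - by apply/measurable_EFinP; exact: measurable_funX.
  - move=> x; rewrite /= in_itv/= => x01; rewrite lee_fin -(real_normK (num_real (f x))).
    by rewrite lerXn2r ?nnegrE ?fM// (le_trans (normr_ge0 (f x)))// fM.
rewrite [X in (X < _)%E](_ : _ = (M ^+ 2)%:E)%E ?ltry//.
rewrite integral_cst//=; transitivity ((M ^+ 2)%:E * 1)%E; last by rewrite mule1.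
congr (_ * _)%E; exact: leb_I01.
Qed.

Lemma L2_cst (a : R) : L2 (cst a).
Proof. by apply: (@L2_bounded _ `|a|) => //; exact: measurable_cst. Qed.

Lemma L2_add f g : L2 f -> L2 g -> L2 (f \+ g).
Proof.
rewrite /L2 => f2 g2.
rewrite (_ : (f \+ g) \_ I01 = f \_ I01 + g \_ I01).
  by have [_] := @Lfun_submod_closed _ _ R leb 2%:E (lee1n 2); move=> /(_ 1 _ _ f2 g2); rewrite scale1r.
apply/funext => x; rewrite !fctE !patchE; case: ifP => //= _; rewrite addr0//.
Qed.

Lemma L2_scale a f : L2 f -> L2 (fun x => a * f x).
Proof.
rewrite /L2 => f2.
rewrite (_ : _ \_ I01 = a *: (f \_ I01)).
  have z : (0 : R -> R) \in Lfun leb 2%:E.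
    by have [] := @Lfun_submod_closed _ _ R leb 2%:E (lee1n 2).
  have [_] := @Lfun_submod_closed _ _ R leb 2%:E (lee1n 2).
  by move=> /(_ a _ _ f2 z); rewrite addr0.
apply/funext => x; rewrite !fctE !patchE; case: ifP => //= _.
by rewrite /GRing.scale/= mulr0.
Qed.

Lemma L2_opp f : L2 f -> L2 (\- f).
Proof. by move=> /(L2_scale (-1)); under eq_fun do rewrite mulN1r. Qed.

Lemma L2_sub f g : L2 f -> L2 g -> L2 (f \- g).
Proof. by move=> f2 g2; apply: (L2_add f2 (L2_opp g2)). Qed.

Lemma L2_mul_bounded f g (M : R) : L2 f -> measurable_fun I01 g ->
  (forall x, 0 < x < 1 -> `|g x| <= M) -> L2 (fun x => f x * g x).
Proof.
move=> f2 mg gM; have mf := L2_measurable f2.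
apply: L2_intro; first exact: measurable_funM.
have H := L2_sqr_integrable f2.
have : leb.-integrable I01 (fun x => (M ^+ 2)%:E * ((f x) ^+ 2)%:E)%E.
  by apply: integrableZl.
move=> /integrableP[_].
apply: le_lt_trans.
apply: ge0_le_integral => //=.
- by move=> x _; rewrite lee_fin sqr_ge0.
- by apply/measurable_EFinP; apply/measurable_funX/measurable_funM.
- by apply/measurable_EFinP/measurableT_comp/measurable_funM => //; exact: measurable_funX.
- move=> x; rewrite /= in_itv/= => x01; rewrite lee_fin.
  rewrite ger0_norm ?(mulr_ge0 (sqr_ge0 _) (sqr_ge0 _))// exprMn mulrC ler_wpM2r ?sqr_ge0//.
  rewrite -(real_normK (num_real (g x))).
  by rewrite lerXn2r ?nnegrE ?gM// (le_trans (normr_ge0 (g x)))// gM.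
Qed.

Lemma L2_integrable f : L2 f -> leb.-integrable I01 (EFin \o f).
Proof.
move=> f2; have := L2_mul_integrable f2 (L2_cst 1).
by apply: eq_integrable => // x _ /=; rewrite mulr1.
Qed.

Lemma cont01_measurable f : cont01 f -> measurable_fun I01 f.
Proof.
move=> cf; have := subspace_continuous_measurable_fun (measurable_itv _) cf.
by apply: measurable_funS => //; exact: subset_itv_oo_cc.
Qed.

Lemma cont01_bounded f : cont01 f ->
  exists2 M, 0 <= M & forall x, 0 <= x <= 1 -> `|f x| <= M.
Proof.
move=> cf.
have /compact_bounded [M [_ HM]] : compact (f @` `[0%R, 1%R]%classic).
  by apply: continuous_compact => //; exact: segment_compact.
exists (`|M| + 1); first by rewrite addr_ge0.
move=> x x01; apply: HM; first by rewrite ltr_pwDr// ler_norm.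
by exists x => //=; rewrite in_itv.
Qed.

Lemma cont01_L2 f : cont01 f -> L2 f.
Proof.
move=> cf; have [M M0 HM] := cont01_bounded cf.
apply: (@L2_bounded _ M); first exact: cont01_measurable.
by move=> x /andP[x0 x1]; rewrite HM// !ltW.
Qed.

Lemma ipC f g : ip f g = ip g f.
Proof. by rewrite /ip; apply: eq_Rintegral => x _; rewrite mulrC. Qed.

Lemma ipDl f g h : L2 f -> L2 g -> L2 h -> ip (f \+ g) h = ip f h + ip g h.
Proof.
move=> f2 g2 h2; rewrite /ip -RintegralD//; try exact: L2_mul_integrable.
by apply: eq_Rintegral => x _ /=; rewrite mulrDl.
Qed.

Lemma ipZl a f h : L2 f -> L2 h -> ip (fun x => a * f x) h = a * ip f h.
Proof.
move=> f2 h2; rewrite /ip -RintegralZl//; last exact: L2_mul_integrable.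
by apply: eq_Rintegral => x _ /=; rewrite mulrA.
Qed.

Lemma ipBl f g h : L2 f -> L2 g -> L2 h -> ip (f \- g) h = ip f h - ip g h.
Proof.
move=> f2 g2 h2; rewrite /ip -RintegralB//; try exact: L2_mul_integrable.
by apply: eq_Rintegral => x _ /=; rewrite mulrBl.
Qed.

Lemma ip_ge0 f : 0 <= ip f f.
Proof. by apply: Rintegral_ge0 => x _; rewrite -expr2 sqr_ge0. Qed.

Definition ae01 f g := ae_eq leb I01 f g.

Lemma ae01_Rintegral f g (D : set R) : measurable D -> D `<=` I01 ->
  measurable_fun I01 f -> measurable_fun I01 g -> ae01 f g ->
  \int[leb]_(x in D) f x = \int[leb]_(x in D) g x.
Proof.
move=> mD DI mf mg fg; rewrite /Rintegral; congr fine.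
apply: ae_eq_integral => //.
- by apply/measurable_EFinP; exact: measurable_funS mf.
- by apply/measurable_EFinP; exact: measurable_funS mg.
- by apply: filterS fg => x /= H /DI Ix; rewrite H.
Qed.

Lemma ae01_ip f g h : L2 f -> L2 g -> L2 h -> ae01 f g -> ip f h = ip g h.
Proof.
move=> f2 g2 h2 fg; apply: ae01_Rintegral => //.
- by apply: measurable_funM; exact: L2_measurable.
- by apply: measurable_funM; exact: L2_measurable.
- by apply: filterS fg => x /= H Ix; rewrite H.
Qed.

End L2theory.

Section Primitive.
Context {R : realType}.
Local Notation leb := (@lebesgue_measure R).
Local Notation I01 := (`]0%R, 1%R[%classic : set R).
Implicit Types (f g h u v : R -> R) (a b c x y : R).

(** Reversed endpoints give the empty interval and the value 0, so there is no antisymmetry in [a]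
    and [b]; orderings have to be tracked. *)
Definition itg a b g := \int[leb]_(x in `]a, b[) g x.

Lemma itg_ge a b g : b <= a -> itg a b g = 0.
Proof. by move=> ba; rewrite /itg set_itv_ge ?Rintegral_set0// bnd_simp -leNgt. Qed.

Lemma integrable_subT g (D : set R) : measurable D ->
  leb.-integrable setT (EFin \o g) -> leb.-integrable D (EFin \o g).
Proof. by move=> mD; apply: integrableS. Qed.

Lemma itgU a b c g : leb.-integrable setT (EFin \o g) -> a <= b -> b <= c ->
  itg a c g = itg a b g + itg b c g.
Proof.
move=> ig ab; rewrite le_eqVlt => /predU1P[<-|bc]; first by rewrite (itg_ge _ (lexx b)) addr0.
have H (D : set R) : measurable D -> leb.-integrable D (EFin \o g).
  by move=> mD; exact: integrable_subT.
rewrite /itg -(@Rintegral_itvB _ g (BRight a) (BLeft c) b).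
- rewrite [X in _ = X + _]Rintegral_itv_bndo_bndc; last exact: H.
  by rewrite addrC subrK.
- exact: H.
- by rewrite bnd_simp.
- by rewrite bnd_simp.
Qed.

Lemma itg_cc a b g : leb.-integrable setT (EFin \o g) ->
  itg a b g = \int[leb]_(x in `[a, b]) g x.
Proof.
move=> ig; rewrite /itg Rintegral_itv_bndo_bndc ?Rintegral_itv_obnd_cbnd//;
  exact: integrable_subT.
Qed.

(** Extension by zero makes an integrand on (0, 1) integrable on the line, where intervals can be
    split freely. *)
Lemma restrict_integrable g : leb.-integrable I01 (EFin \o g) ->
  leb.-integrable setT (EFin \o (g \_ I01)).
Proof.
move=> ig; rewrite -restrict_EFin.
by apply/(@integrable_mkcond _ _ _ leb I01) => //.
Qed.

Lemma itg_restrict g a b : 0 <= a -> b <= 1 -> itg a b (g \_ I01) = itg a b g.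
Proof.
move=> a0 b1; apply: eq_Rintegral => x; rewrite inE/= in_itv/= => /andP[ax xb].
by rewrite patchE mem_set//= in_itv/= (le_lt_trans a0 ax) (lt_le_trans xb b1).
Qed.

Lemma le_itg g h a b : leb.-integrable `]a, b[ (EFin \o g) ->
  leb.-integrable `]a, b[ (EFin \o h) ->
  (forall x, a < x < b -> g x <= h x) -> itg a b g <= itg a b h.
Proof.
move=> ig ih gh; by apply: le_Rintegral.
Qed.

Lemma itg_norm g a b : leb.-integrable `]a, b[ (EFin \o g) ->
  `|itg a b g| <= itg a b (fun x => `|g x|).
Proof. by move=> ig; apply: le_normr_Rintegral. Qed.

Lemma itg_cst a b c : a <= b -> itg a b (cst c) = c * (b - a).
Proof.
move=> ab; rewrite /itg Rintegral_cst//.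
have E : leb `]a, b[ = (b - a)%:E.
  rewrite lebesgue_measure_itv/= lte_fin.
  by move: ab; rewrite le_eqVlt => /predU1P[->|ab]; rewrite ?ltxx ?subrr ?ab.
congr (_ * _); exact: (congr1 fine E).
Qed.

(* [g] is an L^2 derivative of [f] in the sense of the fundamental theorem of calculus. *)
Definition prim f g := L2 g /\ forall x, 0 <= x <= 1 -> f x = f 0 + itg 0 x g.

Lemma L2_integrable_itv g a b : 0 <= a -> b <= 1 -> L2 g ->
  leb.-integrable `]a, b[ (EFin \o g).
Proof.
move=> a0 b1 g2; apply: integrableS (L2_integrable g2) => //.
move=> x /=; rewrite !in_itv/= => /andP[ax xb].
by rewrite (le_lt_trans a0 ax) (lt_le_trans xb b1).
Qed.

Lemma prim_sub f g x y : prim f g -> 0 <= x -> x <= y -> y <= 1 ->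
  f y - f x = itg x y g.
Proof.
move=> [g2 fg] x0 xy y1.
have ig := restrict_integrable (L2_integrable g2).
rewrite (fg y) ?(fg x) ?(le_trans x0 xy) ?y1 ?x0 ?(le_trans xy y1)//.
have := itgU ig x0 xy; rewrite !itg_restrict ?(le_trans xy y1)//; lra.
Qed.

Lemma itg_cont01 (a : R) g : leb.-integrable I01 (EFin \o g) -> cont01 (fun x => a + itg 0 x g).
Proof.
move=> ig0; have ig := restrict_integrable ig0.
have H : {within `[0%R, 1%R], continuous
    (fun x => parameterized_integral leb 0 x (g \_ I01))}.
  by apply: parameterized_integral_continuous => //; exact: integrable_subT.
rewrite /cont01.
have : {within `[0%R, 1%R], continuous
    (fun x => a + parameterized_integral leb 0 x (g \_ I01))}.
  apply/subspace_continuousP => x x01; apply: cvgD; first exact: cvg_cst.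
  by move/subspace_continuousP : H; exact.
apply: subspace_eq_continuous => x; rewrite inE/= in_itv/= => x01.
congr (_ + _); transitivity (itg 0 x (g \_ I01)).
  by apply/esym; exact: (itg_cc 0 x ig).
by apply: itg_restrict => //; case/andP: x01.
Qed.

Lemma prim_cont f g : prim f g -> cont01 f.
Proof.
move=> [g2 fg]; have := @itg_cont01 (f 0) _ (L2_integrable g2).
by apply: subspace_eq_continuous => x; rewrite inE/= in_itv/= => x01; exact/esym/fg.
Qed.

Lemma prim_L2 f g : prim f g -> L2 f.
Proof. by move=> /prim_cont; exact: cont01_L2. Qed.

(** The variance of [g] about its mean [m] over the interval is nonnegative. *)
Lemma itg_cauchy g a b : a <= b -> leb.-integrable `]a, b[ (EFin \o g) ->
  leb.-integrable `]a, b[ (EFin \o (fun x => g x ^+ 2)) ->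
  itg a b g ^+ 2 <= (b - a) * itg a b (fun x => g x ^+ 2).
Proof.
rewrite le_eqVlt => /predU1P[<-|ab] ig ig2; first by rewrite !itg_ge// expr0n/= mulr0.
pose m := itg a b g / (b - a).
have ba : 0 < b - a by rewrite subr_gt0.
have ic (c : R) : leb.-integrable `]a, b[ (EFin \o cst c).
  by apply: (@integrableS _ _ _ leb `[a, b]) => //;
    [exact: subset_itv_oo_cc|apply: continuous_compact_integrable;
      [exact: segment_compact|move=> x; exact: cst_continuous]].
have : 0 <= itg a b (fun x => (g x - m) ^+ 2) by apply: Rintegral_ge0 => x _; exact: sqr_ge0.
have -> : itg a b (fun x => (g x - m) ^+ 2) =
   itg a b (fun x => g x ^+ 2 + ((- 2 * m) * g x + cst (m ^+ 2) x)).
  by apply: eq_Rintegral => x _ /=; ring.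
rewrite {1}/itg RintegralD//; last first.
  apply: (@integrableD _ _ _ leb _ _ (EFin \o (fun x => (- 2 * m) * g x)) (EFin \o cst (m ^+ 2))) => //.
  exact: (@integrableZl _ _ _ leb _ _ (- 2 * m) (EFin \o g)).
rewrite RintegralD//; last exact: (@integrableZl _ _ _ leb _ _ (- 2 * m) (EFin \o g)).
rewrite RintegralZl// -!/(itg _ _ _) itg_cst ?(ltW ab)// /m => H.
have := ler_wpM2l (ltW ba) H; rewrite mulr0.
set G := itg a b g; set G2 := itg a b _.
have -> : (b - a) * (G2 + (- 2 * (G / (b - a)) * G + (G / (b - a)) ^+ 2 * (b - a))) =
  (b - a) * G2 - G ^+ 2 by field; rewrite gt_eqF.
by rewrite subr_ge0.
Qed.

Lemma prim_lin f1 g1 f2 g2 c : prim f1 g1 -> prim f2 g2 ->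
  prim (fun x => c * f1 x + f2 x) (fun x => c * g1 x + g2 x).
Proof.
move=> [G1 H1] [G2 H2]; split; first by apply: L2_add => //; exact: L2_scale.
move=> x x01; rewrite (H1 x x01) (H2 x x01).
have x1 : x <= 1 by case/andP: x01.
rewrite {3}/itg RintegralD//; [|exact: L2_integrable_itv (L2_scale _ _)|exact: L2_integrable_itv].
rewrite RintegralZl//; last exact: L2_integrable_itv.
by rewrite -!/(itg _ _ _); ring.
Qed.

Lemma prim_ext f1 f2 g : (forall x, 0 <= x <= 1 -> f1 x = f2 x) -> prim f1 g -> prim f2 g.
Proof.
move=> E [g2 H]; split=> // x x01; rewrite -!E ?lexx ?ler01//; exact: H.
Qed.

(* By Lebesgue differentiation of the primitive. *)
Lemma itg0_ae0 g : leb.-integrable I01 (EFin \o g) -> (forall x, 0 <= x <= 1 -> itg 0 x g = 0) -> ae01 g (cst 0).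
Proof.
move=> ig0 g0; have ig := restrict_integrable ig0.
set G := g \_ I01 in ig.
have locG : locally_integrable [set: R] G.
  by apply: integrable_locally.
have iG y : leb.-integrable [set` Interval -oo%O (BRight y)] (EFin \o G).
  exact: integrable_subT.
(* The primitive of the zero extension vanishes on the whole line, hence so does its derivative,
   which is almost everywhere the extension itself. *)
have F0 y : \int[leb]_(t in [set` Interval -oo%O (BRight y)]) G t = 0.
  have [y0|y0] := leP y 0.
    rewrite (_ : \int[leb]_(t in _) G t = \int[leb]_(t in [set` Interval -oo%O (BRight y)]) (cst 0 t)).
      by rewrite Rintegral_cst// mul0r.
    apply: eq_Rintegral => t; rewrite inE/= in_itv/= => ty.
    rewrite /G patchE memNset//= in_itv/= => /andP[t0 _].
    by have := lt_le_trans t0 (le_trans ty y0); rewrite ltxx.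
  have := @Rintegral_itvB _ G -oo%O (BRight y) 0 (iG y) isT.
  rewrite bnd_simp (ltW y0) => /(_ isT).
  have -> : \int[leb]_(t in [set` Interval -oo%O (BRight (0:R))]) G t = 0.
    rewrite (_ : \int[leb]_(t in _) G t = \int[leb]_(t in [set` Interval -oo%O (BRight (0:R))]) (cst 0 t)).
      by rewrite Rintegral_cst// mul0r.
    apply: eq_Rintegral => t; rewrite inE/= in_itv/= => ty.
    rewrite /G patchE memNset//= in_itv/= => /andP[t0 _].
    by have := lt_le_trans t0 ty; rewrite ltxx.
  rewrite subr0 => ->.
  rewrite -Rintegral_itv_bndo_bndc; last exact: integrable_subT.
  rewrite -/(itg 0 y G).
  have [y1|y1] := leP y 1; first by rewrite itg_restrict// g0// (ltW y0).
  rewrite (itgU ig (ler01 : 0 <= 1 :> R) (ltW y1)) itg_restrict// g0 ?ler01 ?lexx// add0r.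
  rewrite /itg (_ : \int[leb]_(t in _) G t = \int[leb]_(t in `]1%R, y[) (cst 0 t)).
    by rewrite Rintegral_cst// mul0r.
  apply: eq_Rintegral => t; rewrite inE/= in_itv/= => /andP[t1 _].
  rewrite /G patchE memNset//= in_itv/= => /andP[_ t1'].
  by have := lt_trans t1 t1'; rewrite ltxx.
have := FTC1Ny iG locG; apply: filterS.
  exact: (ae_filter_ringOfSetsType leb).
move=> x [_ H] Ix /=.
have : G x = 0.
  rewrite -H (_ : (fun y => _) = cst 0); last by apply/funext => y; exact: F0.
  by rewrite derive1_cst.
by rewrite /G patchE mem_set.
Qed.

Lemma prim_uniq f1 f2 g1 g2 : prim f1 g1 -> prim f2 g2 ->
  (forall x, 0 <= x <= 1 -> f1 x = f2 x) -> ae01 g1 g2.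
Proof.
move=> P1 P2 E; have [G1 _] := P1; have [G2 _] := P2.
have : ae01 (g1 \- g2) (cst 0).
  apply: itg0_ae0; first exact/L2_integrable/L2_sub.
  move=> x x01; have x1 : x <= 1 by case/andP: x01.
  have [_ H] := prim_lin (-1) P2 P1.
  rewrite (_ : itg _ _ _ = itg 0 x (fun y => -1 * g2 y + g1 y)); last first.
    by apply: eq_Rintegral => y _ /=; rewrite mulN1r addrC.
  by have := H x x01; rewrite /= !E ?lexx ?ler01// !mulN1r !addNr add0r => <-.
by apply: filterS => x /= H Ix; have [/eqP] := H Ix; rewrite subr_eq0 => /eqP ->.
Qed.

End Primitive.

(** * Fubini and the product rule for primitives *)

Section Product.
Context {R : realType}.
Local Notation leb := (@lebesgue_measure R).
Local Notation I01 := (`]0%R, 1%R[%classic : set R).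
Implicit Types (f g h u v : R -> R) (a b c x y : R).

Lemma Rintegral_Fubini (F : R -> R -> R) :
  measurable_fun [set: R * R] (fun p => F p.1 p.2) ->
  (\int[leb]_x \int[leb]_y `|F x y|%:E < +oo)%E ->
  \int[leb]_x (\int[leb]_y F x y) = \int[leb]_y (\int[leb]_x F x y).
Proof.
move=> mF Ffin.
have mE : measurable_fun [set: R * R] (EFin \o (fun p => F p.1 p.2)).
  exact/measurable_EFinP.
have iF : (leb \x leb)%E.-integrable setT (EFin \o (fun p => F p.1 p.2)).
  exact/(integrable12ltyP leb leb mE).
have ae1 := ae_integrable1 iF; have ae2 := ae_integrable2 iF.
have m1 := measurable_fubini_F iF; have m2 := measurable_fubini_G iF.
have := Fubini iF.
have E1 : (\int[leb]_x (fine (\int[leb]_y (F x y)%:E))%:E = \int[leb]_x \int[leb]_y (F x y)%:E)%E.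
  apply: ae_eq_integral => //.
  - by apply/measurable_EFinP; apply: measurableT_comp => //; exact: m1.
  - by apply: filterS ae1 => x /= H _; rewrite fineK//; exact: integrable_fin_num.
have E2 : (\int[leb]_y (fine (\int[leb]_x (F x y)%:E))%:E = \int[leb]_y \int[leb]_x (F x y)%:E)%E.
  apply: ae_eq_integral => //.
  - by apply/measurable_EFinP; apply: measurableT_comp => //; exact: m2.
  - by apply: filterS ae2 => x /= H _; rewrite fineK//; exact: integrable_fin_num.
by rewrite /Rintegral /= => H; congr fine; rewrite E1 E2.
Qed.

(* Fubini on a triangle, to which the product rule for primitives reduces. *)
Lemma itg_triangle u v x : leb.-integrable setT (EFin \o u) ->
  leb.-integrable setT (EFin \o v) ->
  itg 0 x (fun s => u s * itg 0 s v) = itg 0 x (fun t => v t * itg t x u).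
Proof.
move=> iu iv.
pose F s t := if (0 < s < x) && (0 < t < s) then u s * v t else 0.
have mu : measurable_fun setT u by move/integrableP : iu => [/measurable_EFinP].
have mv : measurable_fun setT v by move/integrableP : iv => [/measurable_EFinP].
have m1 : measurable_fun [set: R * R] (fun p : R * R => u p.1).
  by apply: (measurableT_comp mu); exact: measurable_fst.
have m2 : measurable_fun [set: R * R] (fun p : R * R => v p.2).
  by apply: (measurableT_comp mv); exact: measurable_snd.
have f1 : measurable_fun [set: R * R] (fst : R * R -> R) by exact: measurable_fst.
have f2 : measurable_fun [set: R * R] (snd : R * R -> R) by exact: measurable_snd.
have mF : measurable_fun [set: R * R] (fun p => F p.1 p.2).
  apply: measurable_fun_ifT => //; last by apply: measurable_funM.
  apply: measurable_and; apply: measurable_and; exact: measurable_fun_ltr.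
(* On the triangle |F| is at most |u(s)| |v(t)|, whose double integral is a product of two finite
   ones. *)
have Ffin : (\int[leb]_s \int[leb]_t `|F s t|%:E < +oo)%E.
  have /integrableP[_ Iv] := iv; have /integrableP[_ Iu] := iu.
  have Ivf : (\int[leb]_t `|v t|%:E \is a fin_num)%E.
    by rewrite ge0_fin_numE//; apply: integral_ge0 => t _; rewrite lee_fin.
  apply: (@le_lt_trans _ _ (\int[leb]_s (`|u s|%:E * \int[leb]_t `|v t|%:E))%E).
    apply: ge0_le_integral => //=.
    - by move=> s _; apply: integral_ge0 => t _; rewrite lee_fin.
    - apply: (@measurable_fun_fubini_tonelli_F _ _ _ _ _ leb (fun p : R * R => `|F p.1 p.2|%:E)) => //=.
      by apply/measurable_EFinP; exact: measurableT_comp.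
    - apply: emeasurable_funM => //; apply/measurable_EFinP; exact: measurableT_comp.
    move=> s _; rewrite -ge0_integralZl//=.
    - apply: ge0_le_integral => //=.
      + apply/measurable_EFinP; apply: measurableT_comp => //.
        exact: (measurableT_comp mF (measurable_pair1 s)).
      + apply/measurable_EFinP; apply: measurable_funM => //; exact: measurableT_comp.
      + move=> t _; rewrite lee_fin /F; case: ifP => _; first by rewrite normrM.
        by rewrite normr0 mulr_ge0.
    - by apply/measurable_EFinP; exact: measurableT_comp.
  rewrite ge0_integralZr//=.
  - rewrite lte_mul_pinfty//; first by apply: integral_ge0 => s _; rewrite lee_fin.
    by rewrite ge0_fin_numE//; apply: integral_ge0 => s _; rewrite lee_fin.
  - by apply/measurable_EFinP; exact: measurableT_comp.
  - by apply: integral_ge0 => t _; rewrite lee_fin.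
have := Rintegral_Fubini mF Ffin.
have -> : \int[leb]_s (\int[leb]_t F s t) = itg 0 x (fun s => u s * itg 0 s v).
  rewrite /itg [RHS]Rintegral_mkcond; apply: eq_Rintegral => s _.
  rewrite patchE; case: ifPn => [|/negP sx].
    rewrite inE/= in_itv/= => sx.
    rewrite -RintegralZl//; last exact: integrable_subT.
    rewrite [RHS]Rintegral_mkcond; apply: eq_Rintegral => t _.
    by rewrite patchE /F sx/= mem_setE in_itv.
  transitivity (\int[leb]_(t in setT) (cst 0 t)); last by rewrite Rintegral_cst// mul0r.
  apply: eq_Rintegral => t _; rewrite /F; case: ifP => // /andP[sx' _].
  by exfalso; apply: sx; rewrite inE/= in_itv.
have -> : \int[leb]_t (\int[leb]_s F s t) = itg 0 x (fun t => v t * itg t x u).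
  rewrite /itg [RHS]Rintegral_mkcond; apply: eq_Rintegral => t _.
  rewrite patchE; case: ifPn => [|/negP tx].
    rewrite inE/= in_itv/= => /andP[t0 tx].
    rewrite -RintegralZl//; last exact: integrable_subT.
    rewrite [RHS]Rintegral_mkcond; apply: eq_Rintegral => s _.
    rewrite patchE /F mem_setE in_itv/= t0/=.
    have [ts|st] := ltP t s; last by rewrite andbF.
    by rewrite andbT (lt_trans t0 ts)/=; case: ifP => _ //; rewrite mulrC.
  transitivity (\int[leb]_(t in setT) (cst 0 t)); last by rewrite Rintegral_cst// mul0r.
  apply: eq_Rintegral => s _; rewrite /F; case: ifP => // /andP[/andP[_ sx] /andP[t0 ts]].
  by exfalso; apply: tx; rewrite inE/= in_itv/= t0 (lt_trans ts sx).
by [].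
Qed.

(** Inserting u(s) = u(0) + int_0^s v into int_0^x g u produces a double integral over t < s; after
    the swap of [itg_triangle] the inner integral of g is f(x) - f(t). *)
Lemma primM f g u v : prim f g -> prim u v ->
  prim (fun x => f x * u x) (fun x => g x * u x + v x * f x).
Proof.
move=> P Q; have [g2 fg] := P; have [v2 uv] := Q.
have [Mf Mf0 HMf] := cont01_bounded (prim_cont P).
have [Mu Mu0 HMu] := cont01_bounded (prim_cont Q).
have gu2 : L2 (fun x => g x * u x).
  apply: (L2_mul_bounded g2 (cont01_measurable (prim_cont Q)) (M := Mu)).
  by move=> x /andP[x0 x1]; rewrite HMu// !ltW.
have vf2 : L2 (fun x => v x * f x).
  apply: (L2_mul_bounded v2 (cont01_measurable (prim_cont P)) (M := Mf)).
  by move=> x /andP[x0 x1]; rewrite HMf// !ltW.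
split; first exact: L2_add.
move=> x x01; have /andP[x0 x1] := x01.
rewrite {1}/itg RintegralD//; try exact: L2_integrable_itv.
rewrite -!/(itg _ _ _).
have ig := restrict_integrable (L2_integrable g2).
have iv := restrict_integrable (L2_integrable v2).
have ivx : leb.-integrable `]0, x[ (EFin \o v) by exact: L2_integrable_itv.
have igx : leb.-integrable `]0, x[ (EFin \o g) by exact: L2_integrable_itv.
have -> : itg 0 x (fun t => g t * u t) = u 0 * itg 0 x g +
    itg 0 x (fun s => (g \_ I01) s * itg 0 s (v \_ I01)).
  have -> : itg 0 x (fun s => (g \_ I01) s * itg 0 s (v \_ I01)) =
      itg 0 x (fun s => g s * u s - u 0 * g s).
    apply: eq_Rintegral => s; rewrite inE/= in_itv/= => /andP[s0 sx].
    have s1 : s <= 1 by rewrite (le_trans (ltW sx)).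
    rewrite patchE mem_set/= ?in_itv/= ?s0 ?(lt_le_trans sx x1)//.
    by rewrite itg_restrict// (uv s) ?(ltW s0) ?s1//; ring.
  rewrite {3}/itg RintegralB//; last first.
  - exact: L2_integrable_itv (L2_scale _ _).
  - exact: L2_integrable_itv.
  by rewrite RintegralZl// -!/(itg _ _ _); ring.
rewrite itg_triangle//.
have -> : itg 0 x (fun t => (v \_ I01) t * itg t x (g \_ I01)) =
    f x * itg 0 x v - itg 0 x (fun t => v t * f t).
  have -> : itg 0 x (fun t => (v \_ I01) t * itg t x (g \_ I01)) =
      itg 0 x (fun t => f x * v t - v t * f t).
    apply: eq_Rintegral => s; rewrite inE/= in_itv/= => /andP[s0 sx].
    rewrite patchE mem_set/= ?in_itv/= ?s0 ?(lt_le_trans sx x1)//.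
    by rewrite itg_restrict ?(ltW s0)// -(prim_sub P) ?(ltW s0) ?(ltW sx)//; ring.
  rewrite {1}/itg RintegralB//; last first.
  - exact: L2_integrable_itv.
  - exact: L2_integrable_itv (L2_scale _ _).
  by rewrite RintegralZl// -!/(itg _ _ _).
rewrite (fg x x01) (uv x x01); ring.
Qed.

End Product.

(** * Weak derivatives *)

Section WeakDerivative.
Context {R : realType}.
Local Notation leb := (@lebesgue_measure R).
Implicit Types (f g h u v : R -> R) (a b c x y e : R).

Lemma C1_itg u x y : (forall x : R, derivable u x 1) -> continuous u^`()%classic ->
  x <= y -> itg x y u^`()%classic = u y - u x.
Proof.
move=> du cu; rewrite le_eqVlt => /predU1P[<-|xy]; first by rewrite itg_ge// subrr.
have cu' : {within `[x, y], continuous u^`()%classic} by exact: continuous_subspaceT.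
have cuu z : {for z, continuous u}.
  by apply: differentiable_continuous; apply/derivable1_diffP.
have iu : leb.-integrable `[x, y] (EFin \o u^`()%classic).
  by apply: continuous_compact_integrable => //; exact: segment_compact.
have := continuous_FTC2 xy cu' _ (fun z _ => erefl).
move=> H; rewrite /itg Rintegral_itv_bndo_bndc; last first.
  by apply: integrableS iu => //; apply: subset_itv; rewrite bnd_simp.
rewrite Rintegral_itv_obnd_cbnd; last first.
  by apply: integrableS iu => //; apply: subset_itv; rewrite bnd_simp.
rewrite /Rintegral H//; split.
- by move=> z _; exact: du.
- by apply: cvg_at_right_filter; exact: cuu.
- by apply: cvg_at_left_filter; exact: cuu.
Qed.

Lemma C1_prim u : (forall x : R, derivable u x 1) -> continuous u^`()%classic ->
  prim u u^`()%classic.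
Proof.
move=> du cu; split.
  by apply: cont01_L2; exact: continuous_subspaceT.
by move=> x /andP[x0 _]; rewrite C1_itg// addrC subrK.
Qed.

(** The product rule on [0, 1] with a test function, whose endpoint values are zero. *)
Lemma prim_weak_deriv f g : prim f g -> weak_deriv `]0, 1[ f g.
Proof.
move=> P phi [dphi cphi [a [b [+ + phi0]]]].
rewrite !in_itv/= => /andP[a0 a1] /andP[b0 b1].
have Q := C1_prim dphi cphi.
have [_ H] := primM P Q.
have p0 : phi 0 = 0 by apply: phi0; rewrite in_itv/= leNgt a0.
have p1 : phi 1 = 0 by apply: phi0; rewrite in_itv/= [1 <= b]leNgt b1 andbF.
have [g2 _] := P; have [d2 _] := Q.
have := H 1; rewrite lexx ler01 p0 p1 !mulr0 add0r => /(_ isT).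
have [Mf Mf0 HMf] := cont01_bounded (prim_cont P).
have [Mu Mu0 HMu] := cont01_bounded (prim_cont Q).
rewrite {1}/itg RintegralD//; last first.
- apply: L2_mul_integrable => //; exact: prim_L2 P.
- apply: L2_mul_integrable => //; exact: prim_L2 Q.
move=> /eqP; rewrite eq_sym addr_eq0 => /eqP ->; rewrite opprK.
by apply: eq_Rintegral => x _; rewrite mulrC.
Qed.

(** The squared positive part is C^1, and half its second difference is a C^1 step with values from
    0 to 1. *)
Let pos2 x := Num.max x 0 ^+ 2.

Let is_derive_pos2 x : is_derive x 1 pos2 (2 * Num.max x 0).
Proof.
(* The first-order Taylor remainder is at most y^2, on whichever side of 0 the two points lie. *)
have key y : `|pos2 (x + y) - pos2 x - 2 * y * Num.max x 0| <= y ^+ 2.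
  rewrite /pos2; apply/ler_normlP.
  by case: (leP x 0); case: (leP (x + y) 0) => ? ?; split; rewrite ?expr0n/= ?expr2; nra.
have L : h^-1 *: ((pos2 \o shift x) (h *: 1) - pos2 x) @[h --> 0^'] --> 2 * Num.max x 0.
  apply/cvgrPdist_le => e e0; rewrite /dnbhs near_withinE.
  apply/nbhs_ballP; exists e => //= y; rewrite /ball/= sub0r normrN => ye y0.
  rewrite (_ : y%:A + x = x + y); last by rewrite /GRing.scale/= mulr1 addrC.
  have := key y; set D := pos2 (x + y) - pos2 x => H.
  have -> : 2 * Num.max x 0 - y^-1 *: D = - (y^-1 * (D - 2 * y * Num.max x 0)).
    by rewrite /GRing.scale/=; field.
  rewrite normrN normrM normfV ler_pdivrMl ?normr_gt0//.
  apply: (le_trans H); rewrite -(real_normK (num_real y)) expr2.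
  by rewrite ler_wpM2l// ltW.
split.
- exact: cvgP L.
- exact: cvg_lim L.
Qed.

(* A C^1 step at [a] of width [2 e], with a tent as derivative; the difference of two
   such steps is the test function that turns a weak derivative into an increment. *)
Definition ramp a e x :=
  (pos2 ((x - a) / e + 1) - 2 * pos2 ((x - a) / e) + pos2 ((x - a) / e - 1)) / 2.

Definition dramp a e x := (Num.max ((x - a) / e + 1) 0
  - 2 * Num.max ((x - a) / e) 0 + Num.max ((x - a) / e - 1) 0) / e.

Lemma is_derive_ramp a e x : e != 0 -> is_derive x 1 (ramp a e) (dramp a e x).
Proof.
move=> e0.
have aff k : is_derive x 1 (fun x => (x - a) / e + k) e^-1.
  have -> : (fun x => (x - a) / e + k) = (e^-1 \*: id) + cst (k - a / e).
    apply/funext => y; transitivity (e^-1 * y + (k - a / e)); last by [].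
    by ring.
  apply: (is_derive_eq (is_deriveD (is_deriveZ _ (is_derive_id _ _)) (is_derive_cst _ _ _))).
  by rewrite addr0; exact: mulr1.
have D k := @is_derive1_comp R pos2 (fun x => (x - a) / e + k) x _ _
  (is_derive_pos2 ((x - a) / e + k)) (aff k).
have := is_deriveZ (2^-1) (is_deriveD (is_deriveD (D 1) (is_deriveZ (- 2) (D 0))) (D (-1))).
rewrite (_ : _ \*: _ = ramp a e); last first.
  apply/funext => y; transitivity (2^-1 * (pos2 ((y - a) / e + 1)
     + - 2 * pos2 ((y - a) / e + 0) + pos2 ((y - a) / e + -1))); first by [].
  by rewrite /ramp addr0; ring.
move=> H; apply: (is_derive_eq H).
transitivity (2^-1 * (2 * Num.max ((x - a) / e + 1) 0 * e^-1
     + - 2 * (2 * Num.max ((x - a) / e + 0) 0 * e^-1)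
     + 2 * Num.max ((x - a) / e + -1) 0 * e^-1)); first by [].
by rewrite /dramp addr0; field; rewrite e0.
Qed.

Lemma derive1_ramp a e : e != 0 -> (ramp a e)^`()%classic = dramp a e.
Proof.
by move=> e0; apply/funext => x; rewrite derive1E; have [_ ->] := is_derive_ramp a x e0.
Qed.

Let contD f g : continuous f -> continuous g -> continuous (fun x => f x + g x).
Proof. by move=> cf cg x; apply: (@continuousD _ _ _ f g x (cf x) (cg x)). Qed.

Let contM f g : continuous f -> continuous g -> continuous (fun x => f x * g x).
Proof. by move=> cf cg x; apply: (@continuousM _ _ f g x (cf x) (cg x)). Qed.

Let contc c : continuous (fun _ : R => c).
Proof. by move=> x; exact: cst_continuous. Qed.

Lemma dramp_continuous a e : continuous (dramp a e).
Proof.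
have M k : continuous (fun x : R => Num.max ((x - a) / e + k) 0).
  move=> x; apply: (@continuous_max _ _ (fun x : R => (x - a) / e + k) (cst 0)).
    have idc : continuous (fun x : R => x) by move=> y; exact: cvg_id.
    have h1 : continuous (fun x : R => x - a) := contD idc (@contc (- a)).
    have h2 : continuous (fun x : R => (x - a) / e) := contM h1 (@contc e^-1).
    exact: (contD h2 (@contc k)).
  exact: cst_continuous.
rewrite (_ : dramp a e = fun x => (Num.max ((x - a) / e + 1) 0
  + - 2 * Num.max ((x - a) / e + 0) 0 + Num.max ((x - a) / e + -1) 0) / e).
  by apply: contM => //; apply: contD => //; apply: contD => //; exact: contM.
by apply/funext => x; rewrite /dramp addr0 mulNr.
Qed.

Lemma ramp_le a e x : 0 < e -> x <= a - e -> ramp a e x = 0 /\ dramp a e x = 0.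
Proof.
move=> e0 xa; have H : (x - a) / e <= -1 by rewrite ler_pdivrMr//; lra.
rewrite /ramp /dramp /pos2; set z := (x - a) / e in H *.
rewrite !(max_idPr _) ?(expr0n, mulr0, subr0, addr0, mul0r)//; lra.
Qed.

Lemma ramp_ge a e x : 0 < e -> a + e <= x -> ramp a e x = 1 /\ dramp a e x = 0.
Proof.
move=> e0 xa; have H : 1 <= (x - a) / e by rewrite ler_pdivlMr//; lra.
rewrite /ramp /dramp /pos2; set z := (x - a) / e in H *.
rewrite !(max_idPl _) ?subr_ge0//; [|lra|lra].
by split; [field|ring].
Qed.

Lemma ramp_bound a e x : 0 <= ramp a e x <= 1.
Proof.
rewrite /ramp /pos2; set z := (x - a) / e.
by case: (leP (z + 1) 0); case: (leP z 0); case: (leP (z - 1) 0) => ? ? ?;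
  rewrite ?expr0n/= ?expr2; nra.
Qed.

Lemma dramp_bound a e x : 0 < e -> 0 <= dramp a e x <= e^-1.
Proof.
move=> e0; rewrite /dramp; set z := (x - a) / e.
have : 0 <= Num.max (z + 1) 0 - 2 * Num.max z 0 + Num.max (z - 1) 0 <= 1.
  by case: (leP (z + 1) 0); case: (leP z 0); case: (leP (z - 1) 0) => ? ? ?; lra.
move=> /andP[h1 h2]; rewrite divr_ge0 ?(ltW e0)//= ler_pdivrMr// mulVf//.
by rewrite gt_eqF.
Qed.

End WeakDerivative.

(** * From weak derivatives to increments at Lebesgue points *)

Section DuBoisReymond.
Context {R : realType}.
Local Notation leb := (@lebesgue_measure R).
Implicit Types (f g h u v : R -> R) (a b c x y e : R).

Lemma bounded_mul_integrable (D : set R) f h (K : R) : measurable D ->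
  leb.-integrable D (EFin \o f) -> measurable_fun D h ->
  (forall x, D x -> `|h x| <= K) -> leb.-integrable D (EFin \o (fun x => f x * h x)).
Proof.
move=> mD iF mh hK.
have H : leb.-integrable D (fun x => K%:E * (f x)%:E)%E by apply: integrableZl.
apply: le_integrable H => //.
  apply/measurable_EFinP; apply: measurable_funM => //.
  by move/integrableP : iF => [/measurable_EFinP].
move=> x Dx /=; rewrite lee_fin !normrM mulrC ler_wpM2r//.
by rewrite (le_trans (hK x Dx))// ler_norm.
Qed.

Lemma sub_integrable (D : set R) f h : measurable D -> leb.-integrable D (EFin \o f) ->
  leb.-integrable D (EFin \o h) -> leb.-integrable D (EFin \o (fun x => f x - h x)).
Proof.
move=> mD iF ih.
have H : leb.-integrable D (fun x => (f x)%:E - (h x)%:E)%E by apply: integrableB.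
by apply: eq_integrable H.
Qed.

Lemma Rintegral_support (D : set R) f : (forall x, ~ D x -> f x = 0) ->
  \int[leb]_x f x = \int[leb]_(x in D) f x.
Proof.
move=> H; rewrite [RHS]Rintegral_mkcond; apply: eq_Rintegral => x _.
rewrite patchE; case: ifPn => // /negP xD; apply: H => Dx; apply: xD.
exact: mem_set.
Qed.

Lemma leb_itv_ball a e : 0 < e -> leb `]a - e, a + e[ = (2 * e)%:E.
Proof.
move=> e0; rewrite lebesgue_measure_itv/= lte_fin ifT; last by lra.
by rewrite -EFinB; congr EFin; ring.
Qed.

Let step a x : R := (a < x)%R%:R.

(** [dramp a e] has integral 1 and is at most 1/e on an interval of length 2e, so the error is at
    most twice the mean of |f - f a| there, which tends to 0 at a Lebesgue point. *)
Lemma ramp_average f a : leb.-integrable setT (EFin \o f) -> lebesgue_pt f a ->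
  forall eps, 0 < eps -> exists2 del, 0 < del & forall e, 0 < e < del ->
    `|\int[leb]_x (f x * dramp a e x) - f a| <= eps.
Proof.
move=> iF /fine_cvgP[fin /cvgrPdist_lt L] eps eps0.
have e20 : 0 < eps / 2 by rewrite divr_gt0.
have := L _ e20; have := fin.
move=> /nbhs_right0P[d1/= d10 H1] /nbhs_right0P[d2/= d20 H2].
exists (Num.min d1 d2); first by rewrite lt_min d10.
move=> e /andP[e0]; rewrite lt_min => /andP[e1 e2].
have ball0 (d : R) : e < d -> ball_ [eta Num.Def.normr] 0 d e.
  by move=> ed; rewrite /ball_/= sub0r normrN gtr0_norm.
have {H1} H1 := H1 e (ball0 _ e1) e0; have {H2} := H2 e (ball0 _ e2) e0.
rewrite !add0r.
pose I := itg (a - e) (a + e) (fun y => `|f y - f a|).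
have iF' : leb.-integrable `]a - e, a + e[ (EFin \o f) by exact: integrable_subT.
have ic k : leb.-integrable `]a - e, a + e[ (EFin \o (fun _ : R => k)).
  apply: (@integrableS _ _ _ leb `[a - e, a + e]) => //; first exact: subset_itv_oo_cc.
  apply: continuous_compact_integrable; first exact: segment_compact.
  by move=> x; exact: cst_continuous.
have ifa : leb.-integrable `]a - e, a + e[ (EFin \o (fun y => f y - f a)).
  exact: sub_integrable.
have -> : davg f a e = ((2 * e)^-1 * I)%:E.
  have E1 : ((leb (ball a e))^-1 = ((2 * e)^-1)%:E)%E.
    rewrite lebesgue_measure_ball ?(ltW e0)// inver mulrn_eq0/= gt_eqF// mulr_natl.
    by [].
  have E2 : (\int[leb]_(y in ball a e) `|(f y - f a)%:E| = I%:E)%E.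
    rewrite /I /itg /Rintegral ball_itv fineK//.
    by apply: integrable_fin_num => //; exact: integrable_abse ifa.
  rewrite EFinM -E1 -E2; congr (_ * _)%E.
rewrite /= normrN => /(le_lt_trans (ler_norm _)) HI.
have md : measurable_fun `]a - e, a + e[ (dramp a e).
  apply: (@measurable_funS _ _ _ _ setT) => //.
  by apply: continuous_measurable_fun; exact: dramp_continuous.
have db x : `|dramp a e x| <= e^-1.
  by have /andP[h0 h1] := dramp_bound a x e0; rewrite ger0_norm.
rewrite (@Rintegral_support `]a - e, a + e[); last first.
  move=> x /=; rewrite in_itv/= => /negP; rewrite negb_and -!leNgt => /orP[xa|xa].
    by have [_ ->] := ramp_le e0 xa; rewrite mulr0.
  by have [_ ->] := ramp_ge e0 xa; rewrite mulr0.
have en0 := lt0r_neq0 e0.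
have d1E : itg (a - e) (a + e) (dramp a e) = 1.
  rewrite -derive1_ramp// C1_itg//; first last.
  - by lra.
  - by rewrite derive1_ramp//; exact: dramp_continuous.
  - by move=> x; have [] := is_derive_ramp a x en0.
  have [-> _] := @ramp_le _ a e (a - e) e0 (lexx _).
  by have [-> _] := @ramp_ge _ a e (a + e) e0 (lexx _); rewrite subr0.
have i1 : leb.-integrable `]a - e, a + e[ (EFin \o (fun x => f x * dramp a e x)).
  by apply: (@bounded_mul_integrable _ f _ e^-1).
have i2 : leb.-integrable `]a - e, a + e[ (EFin \o (fun x => f a * dramp a e x)).
  by apply: (@bounded_mul_integrable _ (fun=> f a) _ e^-1).
have id1 : leb.-integrable `]a - e, a + e[ (EFin \o dramp a e).
  have := @bounded_mul_integrable `]a - e, a + e[ (fun=> 1) (dramp a e) e^-1 (measurable_itv _) (ic 1) md (fun x _ => db x).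
  by apply: eq_integrable => // x _ /=; rewrite mul1r.
have -> : f a = itg (a - e) (a + e) (fun x => f a * dramp a e x).
  by rewrite /itg RintegralZl// -/(itg _ _ _) d1E mulr1.
rewrite -RintegralB//.
have i3 := sub_integrable (measurable_itv _) i1 i2.
apply: (le_trans (le_normr_Rintegral _ i3)) => //.
apply: (@le_trans _ _ (itg (a - e) (a + e) (fun y => e^-1 * `|f y - f a|))).
  apply: le_Rintegral => //.
  - exact: integrable_abse i3.
  - have H : leb.-integrable `]a - e, a + e[ (fun y => e^-1%:E * `|(f y - f a)%:E|)%E.
      by apply: integrableZl => //; exact: integrable_abse ifa.
    by apply: eq_integrable H.
  by move=> x _; rewrite -mulrBl normrM mulrC ler_wpM2r.
rewrite /itg RintegralZl//; last exact: integrable_abse ifa.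
rewrite -/(itg _ _ _) -/I.
have -> : e^-1 * I = 2 * ((2 * e)^-1 * I) by field.
lra.
Qed.

(** The ramp and the step differ by at most 1, and only on an interval of length 2e; absolute
    continuity of the integral does the rest. *)
Lemma ramp_step g a : leb.-integrable setT (EFin \o g) ->
  forall eps, 0 < eps -> exists2 del, 0 < del & forall e, 0 < e < del ->
    `|\int[leb]_x (g x * ramp a e x) - \int[leb]_x (g x * step a x)| <= eps.
Proof.
move=> ig eps eps0.
have [del [d0 H]] := integral_normr_continuous ig eps0.
exists (del / 2); first by rewrite divr_gt0.
move=> e /andP[e0 ed].
have mr : measurable_fun [set: R] (ramp a e).
  apply: continuous_measurable_fun => x.
  have [/derivable1_diffP/differentiable_continuous] := is_derive_ramp a x (lt0r_neq0 e0).
  by [].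
have mc : measurable_fun [set: R] (step a).
  rewrite (_ : step a = (fun x => if a < x then 1 else 0)).
    by apply: measurable_fun_ifT => //; exact: measurable_fun_ltr.
  by apply/funext => x; rewrite /step; case: ifP.
have i1 : leb.-integrable setT (EFin \o (fun x => g x * ramp a e x)).
  apply: (@bounded_mul_integrable _ g _ 1) => // x _.
  by have /andP[h0 h1] := ramp_bound a e x; rewrite ger0_norm.
have i2 : leb.-integrable setT (EFin \o (fun x => g x * step a x)).
  apply: (@bounded_mul_integrable _ g _ 1) => // x _.
  by rewrite /step; case: ltP => _; rewrite ?normr1 ?normr0.
rewrite -RintegralB//.
rewrite (@Rintegral_support `]a - e, a + e[); last first.
  move=> x /=; rewrite in_itv/= => /negP; rewrite negb_and -!leNgt => /orP[xa|xa].
    have [-> _] := ramp_le e0 xa; rewrite /step ltNge (le_trans xa)//= ?mulr0 ?subrr//.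
    by rewrite lerBlDr lerDl ltW.
  have [-> _] := ramp_ge e0 xa; rewrite /step (lt_le_trans _ xa) ?subrr//.
  by rewrite ltrDl.
have I1 : leb.-integrable `]a - e, a + e[ (EFin \o (fun x => g x * ramp a e x - g x * step a x)).
  by apply: sub_integrable => //; exact: integrable_subT.
apply: (le_trans (le_normr_Rintegral _ I1)) => //.
apply: (@le_trans _ _ (\int[leb]_(x in `]a - e, a + e[) `|g x|)).
  apply: le_Rintegral => //.
  - exact: (integrable_abse I1).
  - exact: (integrable_abse (integrable_subT (measurable_itv _) ig)).
  move=> x _; rewrite -mulrBr normrM -[leRHS]mulr1 ler_wpM2l//.
  have /andP[h0 h1] := ramp_bound a e x.
  by rewrite /step; case: ltP => _ /=; apply/ler_normlP; split; lra.
apply/ltW/H => //.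
apply: (@le_lt_trans _ _ (2 * e)%:E); last by rewrite lte_fin; lra.
by have E := leb_itv_ball a e0; move: (lexx (2 * e)%:E); rewrite -{1}E.
Qed.

(** The test function is the ramp at [a] minus the ramp at [b]: its derivative averages f around [a]
    and, with the opposite sign, around [b], while the function itself tends to the indicator of the
    interval between them. [I] is general because the lemma serves (0, 1) in space and (0, +oo) in
    time; [c] and [d] leave room for the supports. *)
Lemma du_bois_reymond (I : interval R) f g c a b d : weak_deriv I f g ->
  c \in I -> d \in I -> c < a -> a < b -> b < d ->
  leb.-integrable `]c, d[ (EFin \o f) -> leb.-integrable `]c, d[ (EFin \o g) ->
  lebesgue_pt (f \_ `]c, d[) a -> lebesgue_pt (f \_ `]c, d[) b ->
  f b - f a = itg a b g.
Proof.
move=> W cI dI ca ab bd iff' ig La Lb.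
set F := f \_ _ in La Lb; set G := g \_ `]c, d[.
have iF : leb.-integrable setT (EFin \o F).
  by rewrite -restrict_EFin; apply/(@integrable_mkcond _ _ _ leb `]c, d[) => //.
have iG : leb.-integrable setT (EFin \o G).
  by rewrite -restrict_EFin; apply/(@integrable_mkcond _ _ _ leb `]c, d[) => //.
have Fa : F a = f a by rewrite /F patchE mem_set//= in_itv/= ca (lt_trans ab bd).
have Fb : F b = f b by rewrite /F patchE mem_set//= in_itv/= bd (lt_trans ca ab).
have -> : itg a b g = itg a b G.
  apply: eq_Rintegral => x; rewrite inE/= in_itv/= => /andP[ax xb].
  by rewrite /G patchE mem_set//= in_itv/= (lt_trans ca ax) (lt_trans xb bd).
rewrite -Fa -Fb.
apply/eqP; rewrite -subr_eq0 -normr_le0; apply/ler_addgt0Pl => eps eps0; rewrite addr0.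
have e40 : 0 < eps / 4 by rewrite divr_gt0.
have [d1 d10 H1] := ramp_average iF La e40.
have [d2 d20 H2] := ramp_average iF Lb e40.
have [d3 d30 H3] := ramp_step a iG e40.
have [d4 d40 H4] := ramp_step b iG e40.
pose m := Num.min (Num.min (Num.min d1 d2) (Num.min d3 d4)) (Num.min (a - c) (d - b)).
have m0 : 0 < m by rewrite !lt_min d10 d20 d30 d40/=; lra.
pose e := m / 2; have e0 : 0 < e by rewrite divr_gt0.
have em : e < m by rewrite /e; lra.
move: (em); rewrite !lt_min => /andP[/andP[/andP[e1 e2] /andP[e3 e4]] /andP[e5 e6]].
have {H1} := H1 e ltac:(rewrite e0//); have {H2} := H2 e ltac:(rewrite e0//).
have {H3} := H3 e ltac:(rewrite e0//); have {H4} := H4 e ltac:(rewrite e0//).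
pose phi x := ramp a e x - ramp b e x.
have en0 := lt0r_neq0 e0.
have dphi x : is_derive x 1 phi (dramp a e x - dramp b e x).
  exact: is_deriveB (is_derive_ramp a x en0) (is_derive_ramp b x en0).
have dphiE : phi^`()%classic = fun x => dramp a e x - dramp b e x.
  by apply/funext => x; rewrite derive1E; have [_ ->] := dphi x.
have out x : ~ `]c, d[%classic x -> phi x = 0 /\ dramp a e x - dramp b e x = 0.
  rewrite /= in_itv/= => /negP; rewrite negb_and -!leNgt => /orP[xc|dx].
    have [r1 r2] := @ramp_le _ a e x e0 ltac:(lra).
    have [r3 r4] := @ramp_le _ b e x e0 ltac:(lra).
    by rewrite /phi r1 r2 r3 r4 subrr.
  have [r1 r2] := @ramp_ge _ a e x e0 ltac:(lra).
  have [r3 r4] := @ramp_ge _ b e x e0 ltac:(lra).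
  by rewrite /phi r1 r2 r3 r4 !subrr.
have inI x : c <= x <= d -> x \in I.
  by move=> xcd; exact: (@interval_is_interval _ I c d cI dI x xcd).
have tphi : test_function I phi.
  split.
  - by move=> x; have [] := dphi x.
  - rewrite dphiE => x; apply: (@continuousB _ _ _ (dramp a e) (dramp b e) x);
      exact: dramp_continuous.
  - exists (a - e), (b + e); split; [by apply: inI; lra|by apply: inI; lra|].
    move=> x; rewrite in_itv/= negb_and -!ltNge => /orP[xa|xb].
      have [r1 _] := @ramp_le _ a e x e0 ltac:(lra).
      have [r3 _] := @ramp_le _ b e x e0 ltac:(lra).
      by rewrite /phi r1 r3 subrr.
    have [r1 _] := @ramp_ge _ a e x e0 ltac:(lra).
    have [r3 _] := @ramp_ge _ b e x e0 ltac:(lra).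
    by rewrite /phi r1 r3 subrr.
have toT (u psi : R -> R) : (forall x, ~ `]c, d[%classic x -> psi x = 0) ->
    \int[leb]_(x in [set` I]) (u x * psi x) = \int[leb]_x ((u \_ `]c, d[) x * psi x).
  move=> psi0; rewrite Rintegral_mkcond; apply: eq_Rintegral => x _.
  rewrite !patchE; have [xcd|xcd] := pselect (`]c, d[%classic x); last first.
    by rewrite psi0// !mulr0; case: ifP.
  rewrite (mem_set xcd) mem_set//=.
  move: xcd; rewrite /= in_itv/= => /andP[h1 h2]; apply: inI; lra.
have := W phi tphi.
rewrite dphiE (toT f (fun x => dramp a e x - dramp b e x)); last by move=> x /out[].
rewrite (toT g phi); last by move=> x /out[].
rewrite -/F -/G.
have mr k : measurable_fun [set: R] (ramp k e).
  apply: continuous_measurable_fun => x.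
  have [/derivable1_diffP/differentiable_continuous] := is_derive_ramp k x en0.
  by [].
have md k : measurable_fun [set: R] (dramp k e).
  by apply: continuous_measurable_fun; exact: dramp_continuous.
have mc k : measurable_fun [set: R] (step k).
  rewrite (_ : step k = (fun x => if k < x then 1 else 0)).
    by apply: measurable_fun_ifT => //; exact: measurable_fun_ltr.
  by apply/funext => x; rewrite /step; case: ifP.
have i1 k : leb.-integrable setT (EFin \o (fun x => G x * ramp k e x)).
  apply: (@bounded_mul_integrable _ G _ 1) => // x _.
  by have /andP[h0 h1] := ramp_bound k e x; rewrite ger0_norm.
have i2 k : leb.-integrable setT (EFin \o (fun x => G x * step k x)).
  apply: (@bounded_mul_integrable _ G _ 1) => // x _.
  by rewrite /step; case: ltP => _; rewrite ?normr1 ?normr0.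
have i3 k : leb.-integrable setT (EFin \o (fun x => F x * dramp k e x)).
  apply: (@bounded_mul_integrable _ F _ e^-1) => // x _.
  by have /andP[h0 h1] := dramp_bound k x e0; rewrite ger0_norm.
have -> : \int[leb]_x (F x * (dramp a e x - dramp b e x)) =
   \int[leb]_x (F x * dramp a e x) - \int[leb]_x (F x * dramp b e x).
  by rewrite -RintegralB//; apply: eq_Rintegral => x _; rewrite mulrBr.
have -> : \int[leb]_x (G x * phi x) =
   \int[leb]_x (G x * ramp a e x) - \int[leb]_x (G x * ramp b e x).
  by rewrite -RintegralB//; apply: eq_Rintegral => x _; rewrite mulrBr.
have -> : itg a b G = \int[leb]_x (G x * step a x) - \int[leb]_x (G x * step b x).
  rewrite -RintegralB// /itg Rintegral_itv_bndo_bndc; last exact: integrable_subT.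
  rewrite [LHS]Rintegral_mkcond; apply: eq_Rintegral => x _.
  rewrite patchE mem_setE in_itv/= /step.
  case: (ltP a x) => ax /=; case: (leP x b) => xb /=; rewrite ?mulr0 ?mulr1 ?subr0 ?subrr//.
  by move: (lt_le_trans xb ax); rewrite ltNge (ltW ab).
set A1 := \int[leb]_x _; set A2 := \int[leb]_x _; set A3 := \int[leb]_x _.
set A4 := \int[leb]_x _; set A5 := \int[leb]_x _; set A6 := \int[leb]_x _.
move=> E /ler_normlP[p1 p2] /ler_normlP[p3 p4] /ler_normlP[p5 p6] /ler_normlP[p7 p8].
apply/ler_normlP; split; lra.
Qed.

End DuBoisReymond.

(** * Functions in H^1(0, 1) as primitives *)

Section SobolevOne.
Context {R : realType}.
Local Notation leb := (@lebesgue_measure R).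
Local Notation I01 := (`]0%R, 1%R[%classic : set R).
Implicit Types (f g h u v : R -> R) (a b c x y e r : R).

Lemma lebesgue_pt_local f h a r : 0 < r -> (forall x, `|x - a| < r -> f x = h x) ->
  lebesgue_pt f a -> lebesgue_pt h a.
Proof.
move=> r0 E; apply: cvg_trans; apply: near_eq_cvg; near=> e.
have er : e < r by near: e; exact: nbhs_right_lt.
have fa : f a = h a by apply: E; rewrite subrr normr0.
rewrite /davg /iavg; congr (_ * _)%E; apply: eq_integral => x.
rewrite inE /ball/= => xe; congr (`| _%:E |)%E.
by rewrite fa E// distrC (lt_trans xe).
Unshelve. all: by end_near. Qed.

Lemma du_bois_reymond_pt (I : interval R) f g c a b d : weak_deriv I f g ->
  c \in I -> d \in I -> c < a -> a < b -> b < d ->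
  leb.-integrable `]c, d[ (EFin \o f) -> leb.-integrable `]c, d[ (EFin \o g) ->
  lebesgue_pt f a -> lebesgue_pt f b -> f b - f a = itg a b g.
Proof.
move=> W cI dI ca ab bd iff' ig La Lb.
have loc x : c < x -> x < d -> lebesgue_pt f x -> lebesgue_pt (f \_ `]c, d[) x.
  move=> cx xd; apply: (@lebesgue_pt_local _ _ _ (Num.min (x - c) (d - x))).
    by rewrite lt_min !subr_gt0 cx.
  move=> y; rewrite lt_min ltr_norml => /andP[/andP[h1 h2]]; rewrite ltr_norml => /andP[h3 h4].
  by rewrite patchE mem_set//= in_itv/=; apply/andP; split; lra.
by apply: (du_bois_reymond W cI dI ca ab bd) => //; apply: loc => //; lra.
Qed.

Lemma continuous_at_lebesgue_pt f c d a : c < a -> a < d ->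
  measurable_fun `]c, d[ f -> {for a, continuous f} -> lebesgue_pt f a.
Proof.
move=> ca ad mf; apply: (@continuous_lebesgue_pt _ f a `]c, d[) => //.
by split; [exact: itv_open|rewrite /= in_itv/= ca].
Qed.

Lemma cont01_at f x : cont01 f -> 0 < x < 1 -> {for x, continuous f}.
Proof.
by move=> /(continuous_within_itvP _ (@ltr01 R))[H _ _] x01; apply: H; rewrite in_itv.
Qed.

Lemma itg_prim g : L2 g -> prim (fun x => itg 0 x g) g.
Proof. by move=> g2; split => // x _; rewrite (itg_ge _ (lexx 0)) add0r. Qed.

Lemma cont01_constant f : cont01 f -> (forall x y, 0 < x -> x < y -> y < 1 -> f x = f y) ->
  forall x, 0 <= x <= 1 -> f x = f 0.
Proof.
move=> /(continuous_within_itvP _ (@ltr01 R))[_ H0 H1] E.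
have h2 : (0:R) < 2^-1 by lra.
have h21 : (2^-1 : R) < 1 by lra.
have E2 x : 0 < x < 1 -> f x = f 2^-1.
  move=> /andP[x0 x1]; have [->//|xn] := eqVneq x 2^-1.
  by move: xn; rewrite neq_lt => /orP[xl|xl]; [exact: E|apply/esym/E].
have F0 : f 0 = f 2^-1.
  have L : f x @[x --> 0^'+] --> f 2^-1.
    apply: cvg_near_cst; near=> x; apply: E2.
    by apply/andP; split; [near: x; exact: nbhs_right_gt|near: x; exact: nbhs_right_lt].
  by rewrite -(cvg_lim (@Rhausdorff R) L); apply/esym/cvg_lim => //; exact: Rhausdorff.
have F1 : f 1 = f 2^-1.
  have L : f x @[x --> 1^'-] --> f 2^-1.
    apply: cvg_near_cst; near=> x; apply: E2.
    by apply/andP; split; [near: x; exact: nbhs_left_gt|near: x; exact: nbhs_left_lt].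
  by rewrite -(cvg_lim (@Rhausdorff R) L); apply/esym/cvg_lim => //; exact: Rhausdorff.
move=> x /andP[]; rewrite le_eqVlt => /predU1P[<-//|x0].
rewrite le_eqVlt => /predU1P[->|x1]; first by rewrite F1 F0.
by rewrite F0 E2// x0.
Unshelve. all: by end_near. Qed.

(** [f] minus the primitive of [g] has zero increments between interior points, all of which are
    Lebesgue points by continuity; the endpoints follow by continuity too. *)
Lemma weak_deriv_prim f g : cont01 f -> L2 g -> weak_deriv `]0, 1[ f g -> prim f g.
Proof.
move=> cf g2 W; split => // x x01.
have f2 := cont01_L2 cf.
have Pg := itg_prim g2.
have ck : cont01 (f \- (fun x => itg 0 x g)).
  apply/subspace_continuousP => y y01; apply: cvgB.
    by move/subspace_continuousP : cf; exact.
  by move/subspace_continuousP : (prim_cont Pg); exact.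
have := cont01_constant ck _ x01; rewrite /= (itg_ge _ (lexx 0)) subr0 => H.
suff : f x - itg 0 x g = f 0 by lra.
apply: H => a b a0 ab b1.
have mf := L2_measurable f2.
have : f b - f a = itg a b g.
  have ic0 : a / 2 \in `]0%R, 1%R[ by rewrite in_itv/=; lra.
  have id1 : (b + 1) / 2 \in `]0%R, 1%R[ by rewrite in_itv/=; lra.
  apply: (du_bois_reymond_pt W ic0 id1); try lra.
  - by apply: L2_integrable_itv => //; lra.
  - by apply: L2_integrable_itv => //; lra.
  - by apply: (continuous_at_lebesgue_pt a0 _ mf); [lra|apply: cont01_at => //; lra].
  - by apply: (continuous_at_lebesgue_pt _ b1 mf); [lra|apply: cont01_at => //; lra].
have := prim_sub Pg (ltW a0) (ltW ab) (ltW b1); lra.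
Qed.

(** Without continuity the increment formula is available between Lebesgue points. These have full
    measure, so one of them, [x0], exists and fixes the additive constant. *)
Lemma weak_deriv_prim_ae f g : L2 f -> L2 g -> weak_deriv `]0, 1[ f g ->
  exists2 q, prim q g & ae01 f q.
Proof.
move=> f2 g2 W; have Pg := itg_prim g2.
have mf := L2_measurable f2.
have locF : locally_integrable [set: R] (f \_ I01).
  by apply: integrable_locally => //; exact: L2_integrable.
have LP := lebesgue_differentiation locF.
have pt x : 0 < x < 1 -> lebesgue_pt (f \_ I01) x -> lebesgue_pt f x.
  move=> /andP[x0 x1]; apply: (@lebesgue_pt_local _ _ _ (Num.min x (1 - x))).
    by rewrite lt_min subr_gt0 x0.
  move=> y; rewrite lt_min ltr_norml => /andP[/andP[h1 h2]]; rewrite ltr_norml => /andP[h3 h4].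
  by rewrite patchE mem_set//= in_itv/=; apply/andP; split; lra.
have key a b : 0 < a -> a < b -> b < 1 -> lebesgue_pt (f \_ I01) a ->
    lebesgue_pt (f \_ I01) b -> f a - itg 0 a g = f b - itg 0 b g.
  move=> a0 ab b1 La Lb.
  have : f b - f a = itg a b g.
    have ic0 : a / 2 \in `]0%R, 1%R[ by rewrite in_itv/=; lra.
    have id1 : (b + 1) / 2 \in `]0%R, 1%R[ by rewrite in_itv/=; lra.
    apply: (du_bois_reymond_pt W ic0 id1); try lra.
    - by apply: L2_integrable_itv => //; lra.
    - by apply: L2_integrable_itv => //; lra.
    - by apply: pt => //; lra.
    - by apply: pt => //; lra.
  have := prim_sub Pg (ltW a0) (ltW ab) (ltW b1); lra.
have [x0 [x01 L0]] : exists x, 0 < x < 1 /\ lebesgue_pt (f \_ I01) x.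
  apply: contrapT => /forallNP H.
  have [N [mN N0 HN]] := LP.
  have : (leb I01 <= 0)%E.
    rewrite -N0; apply: le_measure; rewrite ?inE//.
    move=> x /=; rewrite in_itv/= => x01; apply: HN => /= L; exact: (H x).
  have -> : leb I01 = 1%E by exact: leb_I01.
  by rewrite lee_fin; lra.
exists (fun x => f x0 - itg 0 x0 g + itg 0 x g).
  by split => // x _; rewrite (itg_ge _ (lexx 0)) addr0.
apply: filterS LP; first exact: (ae_filter_ringOfSetsType leb).
move=> x Lx; rewrite /= in_itv/= => xI.
have /andP[a0 a1] := x01; have /andP[b0 b1] := xI.
have [->|xn] := eqVneq x x0; first by rewrite subrK.
move: xn; rewrite neq_lt => /orP[xl|xl].
  have := key x x0 b0 xl a1 Lx L0; lra.
have := key x0 x a0 xl b1 L0 Lx; lra.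
Qed.

Lemma weak_deriv_ae f1 f2 g : measurable_fun I01 f1 -> measurable_fun I01 f2 ->
  ae01 f1 f2 -> weak_deriv `]0, 1[ f1 g -> weak_deriv `]0, 1[ f2 g.
Proof.
move=> m1 m2 E W phi tphi; rewrite -W//.
have [_ cphi _] := tphi.
have mp : measurable_fun I01 phi^`()%classic.
  by apply: (@measurable_funS _ _ _ _ setT) => //; exact: continuous_measurable_fun.
apply: ae01_Rintegral => //; [exact: measurable_funM|exact: measurable_funM|].
by apply: filterS E => x /= H Ix; rewrite (H Ix).
Qed.

Lemma wDP v : Hm 1 v -> L2 (wD v) /\ weak_deriv `]0, 1[ v (wD v).
Proof.
move=> [v2 [g W g2]].
by have := @xgetPex _ (cst 0) [set g | L2 g /\ weak_deriv `]0, 1[ v g] (ex_intro _ g (conj g2 W)).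
Qed.

Lemma H1_prim v : Hm 1 v -> cont01 v -> prim v (wD v).
Proof. by move=> /wDP[d2 W] cv; exact: weak_deriv_prim. Qed.

Lemma prim_Hm1 v g : prim v g -> Hm 1 v.
Proof.
by move=> P; split; [exact: prim_L2 P|exists g; [exact: prim_weak_deriv|case: P]].
Qed.

Lemma prim_wD v g : prim v g -> prim v (wD v).
Proof. by move=> P; apply: H1_prim; [exact: prim_Hm1 P|exact: prim_cont P]. Qed.

Lemma prim_wD_ae v g : prim v g -> ae01 (wD v) g.
Proof. by move=> P; exact: prim_uniq (prim_wD P) P _. Qed.

End SobolevOne.

(** * The space H^1(0,1) *)

Section H1space.
Context {R : realType}.

Definition h1_pred : {pred R -> R} := fun v => `[< Hm 1 v /\ cont01 v >].

Lemma h1_predP v : reflect (Hm 1 v /\ cont01 v) (v \in h1_pred).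
Proof. exact: asboolP. Qed.

Lemma prim_h1 (v g : R -> R) : prim v g -> v \in h1_pred.
Proof. by move=> P; apply/h1_predP; split; [exact: prim_Hm1 P|exact: prim_cont P]. Qed.

Lemma h1_prim_wD v : v \in h1_pred -> prim v (wD v).
Proof. by move=> /h1_predP[]; exact: H1_prim. Qed.

Lemma h1_submod_closed : submod_closed h1_pred.
Proof.
split.
  apply: (@prim_h1 _ (cst 0)); split; first exact: L2_cst.
  by move=> x /andP[x0 _]; rewrite itg_cst// mul0r addr0.
move=> a u v /h1_prim_wD Pu /h1_prim_wD Pv.
exact: prim_h1 (prim_lin a Pu Pv).
Qed.

HB.instance Definition _ := GRing.isSubmodClosed.Build R (R -> R) h1_pred h1_submod_closed.

(** A subtype of genuine continuous functions on [0, 1] rather than a quotient by almost everywhere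
    equality, so that endpoint values are evaluations. *)
Record h1 := H1fun { h1_val :> R -> R; h1_valP : h1_val \in h1_pred }.

HB.instance Definition _ := [isSub for h1_val].
HB.instance Definition _ := [Choice of h1 by <:].
HB.instance Definition _ := [SubChoice_isSubLmodule of h1 by <:].

End H1space.

(** * Verification of the model axioms in H^1(0, 1) *)

Section H1model.
Context {R : realType}.
Local Notation leb := (@lebesgue_measure R).
Local Notation I01 := (`]0%R, 1%R[%classic : set R).
Implicit Types (u v z : h1 (R := R)) (f g h : R -> R).

Lemma h1_linE (a : R) u v : h1_val (a *: u + v) = (fun x => a * u x + v x).
Proof. exact: (linearP (\val : h1 -> (R -> R)) a u v). Qed.

Lemma h1_lin (a : R) u v x : h1_val (a *: u + v) x = a * u x + v x.
Proof. by rewrite h1_linE. Qed.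

Lemma h1_prim u : prim u (wD u).
Proof. exact/h1_prim_wD/h1_valP. Qed.

Lemma h1_L2 u : L2 u. Proof. exact: prim_L2 (h1_prim u). Qed.

Lemma h1_wD_L2 u : L2 (wD u). Proof. by case: (h1_prim u). Qed.

Lemma h1_measurable u : measurable_fun I01 u.
Proof. exact: (L2_measurable (h1_L2 u)). Qed.

(** [wD] picks a representative by choice, so linearity is an almost everywhere statement. *)
Lemma wD_lin (a : R) u v : ae01 (wD (h1_val (a *: u + v))) (fun x => a * wD u x + wD v x).
Proof. by rewrite h1_linE; exact: (prim_wD_ae (prim_lin a (h1_prim u) (h1_prim v))). Qed.

Lemma ip_lin (a : R) f g h : L2 f -> L2 g -> L2 h ->
  ip (fun x => a * f x + g x) h = a * ip f h + ip g h.
Proof.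
move=> f2 g2 h2; rewrite -ipZl// -ipDl//.
exact: L2_scale.
Qed.

Lemma ip_wD_lin (a : R) u v f : L2 f ->
  ip (wD (h1_val (a *: u + v))) f = a * ip (wD u) f + ip (wD v) f.
Proof.
move=> f2; rewrite -(ip_lin a (h1_wD_L2 u) (h1_wD_L2 v) f2).
apply: (ae01_ip _ _ f2).
- exact: h1_wD_L2.
- by apply: L2_add; [apply: L2_scale|]; exact: h1_wD_L2.
- exact: wD_lin.
Qed.

Lemma ip_cauchy f g : L2 f -> L2 g -> `|ip f g| <= L2norm f * L2norm g.
Proof.
move=> f2 g2; apply: quadratic_cauchy; rewrite ?ip_ge0//.
move=> a; have := ip_ge0 (fun x => - a * g x + f x).
have h2 : L2 (fun x => - a * g x + f x) by apply: L2_add => //; exact: L2_scale.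
by rewrite ip_lin// !(ipC _ (fun x => _ + _)) !ip_lin// (ipC g f); nra.
Qed.

Lemma ip_parts u v : ip (wD u) v + ip (wD v) u = u 1 * v 1 - u 0 * v 0.
Proof.
have [_ /(_ 1)] := primM (h1_prim u) (h1_prim v).
rewrite lexx ler01 => /(_ isT) ->.
rewrite /itg RintegralD//; first by rewrite [RHS]addrAC subrr add0r.
- exact: L2_mul_integrable (h1_wD_L2 u) (h1_L2 v).
- exact: L2_mul_integrable (h1_wD_L2 v) (h1_L2 u).
Qed.

Lemma itg_wD_le u : itg 0 1 (fun x => `|wD u x|) ^+ 2 <= ip (wD u) (wD u).
Proof.
have i1 : leb.-integrable `]0, 1[ (EFin \o (fun x => `|wD u x|)).
  exact: integrable_abse (L2_integrable (h1_wD_L2 u)).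
have i2 : leb.-integrable `]0, 1[ (EFin \o (fun x => `|wD u x| ^+ 2)).
  have := L2_sqr_integrable (h1_wD_L2 u).
  by apply: eq_integrable => // x _ /=; rewrite real_normK ?num_real.
rewrite (le_trans (itg_cauchy ler01 i1 i2))// subr0 mul1r.
rewrite le_eqVlt; apply/orP; left; apply/eqP; apply: eq_Rintegral => x _.
by rewrite real_normK ?num_real.
Qed.

(** With m the mean of the endpoint values and k = u(x) - m, adding the increments from both ends
    gives 2|k| <= int |u_x|. Then (m + k)^2 <= (3/2) m^2 + 3 k^2 yields the same constant 3/4 for
    the endpoint values and for the derivative. *)
Lemma h1_sqr_le u x : 0 <= x <= 1 ->
  u x ^+ 2 <= 3 / 4 * (u 0 ^+ 2 + u 1 ^+ 2 + ip (wD u) (wD u)).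
Proof.
move=> /andP[x0 x1]; have P := h1_prim u; have [g2 _] := P.
have h0 := prim_sub P (lexx 0) x0 x1; have h1 := prim_sub P x0 x1 (lexx 1).
have i0 : leb.-integrable `]0, x[ (EFin \o wD u) by exact: L2_integrable_itv.
have i1 : leb.-integrable `]x, 1[ (EFin \o wD u) by exact: L2_integrable_itv.
have n0 := itg_norm i0; have n1 := itg_norm i1.
rewrite -h0 in n0; rewrite -h1 in n1.
have U : itg 0 1 (fun x => `|wD u x|) = itg 0 x (fun x => `|wD u x|) + itg x 1 (fun x => `|wD u x|).
  have ig : leb.-integrable I01 (EFin \o (fun x => `|wD u x|)).
    exact: integrable_abse (L2_integrable g2).
  by have := itgU (restrict_integrable ig) x0 x1; rewrite !itg_restrict.
have S := itg_wD_le u; rewrite U in S.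
move: n0 n1 S; set A := itg 0 x _; set B := itg x 1 _; set D := ip _ _.
move=> /ler_normlP[a1 a2] /ler_normlP[a3 a4] S.
pose m := (u 0 + u 1) / 2; pose k := u x - m.
have k2 : (2 * k) ^+ 2 <= (A + B) ^+ 2.
  rewrite -(real_normK (num_real (2 * k))) lerXn2r ?nnegrE//; first lra.
  by apply/ler_normlP; rewrite /k /m; split; lra.
have q1 := sqr_ge0 (m - 2 * k); have q2 := sqr_ge0 (u 0 - u 1).
have -> : u x = m + k by rewrite /k addrC subrK.
have m2 : m ^+ 2 <= (u 0 ^+ 2 + u 1 ^+ 2) / 2 by rewrite /m; move: q2; rewrite !expr2; lra.
move: q1 k2 m2; rewrite !expr2 in S *; lra.
Qed.

Lemma Rintegral_le_cst f (K : R) : L2 f -> (forall x, 0 < x < 1 -> f x <= K) ->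
  \int[leb]_(x in I01) f x <= K.
Proof.
move=> f2 fK; rewrite -[K]mulr1 -[in leRHS](subr0 1) -(itg_cst K ler01).
apply: le_itg; [exact: L2_integrable|exact: L2_integrable (L2_cst K)|].
exact: fK.
Qed.

Lemma L2_sqr_h1 u : L2 (fun x => u x ^+ 2).
Proof.
have [M M0 HM] := cont01_bounded (prim_cont (h1_prim u)).
under eq_fun do rewrite expr2.
apply: (L2_mul_bounded (h1_L2 u) (h1_measurable u) (M := M)).
by move=> x /andP[x0 x1]; rewrite HM// !ltW.
Qed.

Lemma ip_le_trip u : ip u u <= 3 / 4 * (u 0 ^+ 2 + u 1 ^+ 2 + ip (wD u) (wD u)).
Proof.
rewrite /ip -/(ip (wD u) (wD u)) (_ : \int[leb]_(x in _) (u x * u x) = \int[leb]_(x in I01) (u x ^+ 2)).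
  apply: Rintegral_le_cst; first exact: L2_sqr_h1.
  by move=> x /andP[x0 x1]; apply: h1_sqr_le; rewrite !ltW.
by apply: eq_Rintegral => x _; rewrite expr2.
Qed.

Lemma le_Rintegral_cst f (K : R) : L2 f -> (forall x, 0 < x < 1 -> K <= f x) ->
  K <= \int[leb]_(x in I01) f x.
Proof.
move=> f2 fK; rewrite -[K]mulr1 -[in leLHS](subr0 1) -(itg_cst K ler01).
apply: le_itg; [exact: L2_integrable (L2_cst K)|exact: L2_integrable|].
exact: fK.
Qed.

(** |u(k) - u(x)| is at most int |u_x|. The bound holds for every x, so integrating it in [trace_le]
    replaces u(x)^2 by the squared L^2 norm. *)
Let trace u (k x : R) : 0 <= x <= 1 -> (k = 0 \/ k = 1) ->
  u k ^+ 2 <= 2 * u x ^+ 2 + 2 * ip (wD u) (wD u).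
Proof.
move=> /andP[x0 x1] kE; have P := h1_prim u; have [g2 _] := P.
have S := itg_wD_le u.
have ig : leb.-integrable I01 (EFin \o (fun x => `|wD u x|)).
  exact: integrable_abse (L2_integrable g2).
have U := itgU (restrict_integrable ig) x0 x1; rewrite !itg_restrict// in U.
have p0 : 0 <= itg 0 x (fun x => `|wD u x|) by apply: Rintegral_ge0.
have p1 : 0 <= itg x 1 (fun x => `|wD u x|) by apply: Rintegral_ge0.
have i0 : leb.-integrable `]0, x[ (EFin \o wD u) by exact: L2_integrable_itv.
have i1 : leb.-integrable `]x, 1[ (EFin \o wD u) by exact: L2_integrable_itv.
have n0 := itg_norm i0; have n1 := itg_norm i1.
rewrite -(prim_sub P (lexx 0) x0 x1) in n0; rewrite -(prim_sub P x0 x1 (lexx 1)) in n1.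
have H : (u k - u x) ^+ 2 <= itg 0 1 (fun x => `|wD u x|) ^+ 2.
  rewrite -(real_normK (num_real (u k - u x))) lerXn2r ?nnegrE//; first by rewrite U addr_ge0.
  by case: kE => ->; rewrite U; [rewrite distrC|]; lra.
have q := sqr_ge0 (2 * u x - u k).
move: H S q; rewrite !expr2; lra.
Qed.

Let trace_le u (k : R) : (k = 0 \/ k = 1) -> u k ^+ 2 <= 2 * (ip u u + ip (wD u) (wD u)).
Proof.
move=> kE.
have : (u k ^+ 2) / 2 - ip (wD u) (wD u) <= \int[leb]_(x in I01) (u x ^+ 2).
  apply: le_Rintegral_cst; first exact: L2_sqr_h1.
  move=> x /andP[x0 x1]; have x01 : 0 <= x <= 1 by rewrite !ltW.
  have := trace u x01 kE; lra.
have -> : \int[leb]_(x in I01) (u x ^+ 2) = ip u u.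
  by apply: eq_Rintegral => x _; rewrite expr2.
lra.
Qed.

Definition h1_trilinear u v z := ip (fun x => u x * wD v x) z.

Lemma h1_mul_L2 u f : L2 f -> L2 (fun x => u x * f x).
Proof.
move=> f2; have [M M0 HM] := cont01_bounded (prim_cont (h1_prim u)).
under eq_fun do rewrite mulrC.
apply: (L2_mul_bounded f2 (h1_measurable u) (M := M)).
by move=> x /andP[x0 x1]; rewrite HM// !ltW.
Qed.

Lemma h1_trilinearE u v z : h1_trilinear u v z = ip (wD v) (fun x => u x * z x).
Proof. by apply: eq_Rintegral => x _ /=; ring. Qed.

Lemma h1_trilinear_parts u v z :
  h1_trilinear u v z + h1_trilinear v u z + h1_trilinear u z v =
    u 1 * v 1 * z 1 - u 0 * v 0 * z 0.
Proof.
rewrite !h1_trilinearE.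
have [_ /(_ 1)] := primM (primM (h1_prim u) (h1_prim v)) (h1_prim z).
rewrite lexx ler01 => /(_ isT) ->.
have L3 (a b c : h1) : leb.-integrable I01 (EFin \o (fun x => wD a x * b x * c x)).
  have := L2_mul_integrable (h1_wD_L2 a) (h1_mul_L2 b (h1_L2 c)).
  by apply: eq_integrable => // x _ /=; rewrite mulrA.
have E : itg 0 1 (fun x => (wD u x * v x + wD v x * u x) * z x + wD z x * (u x * v x)) =
   \int[leb]_(x in I01) (wD v x * u x * z x) + \int[leb]_(x in I01) (wD u x * v x * z x)
   + \int[leb]_(x in I01) (wD z x * u x * v x).
  rewrite -!RintegralD//; last exact: (integrableD _ (L3 v u z) (L3 u v z)).
  by apply: eq_Rintegral => x _ /=; ring.
rewrite E [RHS]addrAC subrr add0r.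
by congr (_ + _ + _); apply: eq_Rintegral => x _; rewrite mulrA.
Qed.

(** By [h1_sqr_le] the supremum of |u| is at most |||u|||, which can be pulled out of the L^2 norm
    of u z. *)
Lemma h1_trilinear_le u v z : `|h1_trilinear u v z| <=
  Num.sqrt (u 0 ^+ 2 + u 1 ^+ 2 + ip (wD u) (wD u)) * L2norm (wD v) * L2norm z.
Proof.
rewrite h1_trilinearE.
have uz2 := h1_mul_L2 u (h1_L2 z).
rewrite (le_trans (ip_cauchy (h1_wD_L2 v) uz2))//.
rewrite [leRHS]mulrAC mulrC ler_wpM2r ?sqrtr_ge0//.
set n := _ + _ + _; have n0 : 0 <= n by rewrite !addr_ge0 ?sqr_ge0 ?ip_ge0.
rewrite /L2norm -sqrtrM// ler_wsqrtr//.
have i2 : leb.-integrable I01 (EFin \o (fun x => z x * z x)).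
  exact: L2_mul_integrable (h1_L2 z) (h1_L2 z).
rewrite {2}/ip -RintegralZl//; apply: le_Rintegral => //.
- exact: L2_mul_integrable.
- have H : leb.-integrable I01 (fun x => n%:E * (z x * z x)%:E)%E by apply: integrableZl.
  by apply: eq_integrable H.
move=> x /=; rewrite in_itv/= => /andP[x0 x1].
have x01 : 0 <= x <= 1 by rewrite !ltW.
have H := h1_sqr_le u x01.
have {}H : u x ^+ 2 <= n by rewrite -/n in H; lra.
have := ler_wpM2r (sqr_ge0 (z x)) H; rewrite !expr2; lra.
Qed.

Definition h1_model_of : h1_model (h1 (R := R)).
Proof.
refine (@Build_h1_model R h1 (fun u => u 0) (fun u => u 1) (fun u v => ip u v)
  (fun u v => ip (wD u) (wD v)) (fun u v => ip (wD u) v) h1_trilinear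
  _ _ _ _ _ _ _ _ _ _ _ _ _ _ _).
- by move=> a u v; exact: h1_lin.
- by move=> a u v; exact: h1_lin.
- split; [|by move=> u v; exact: ipC|by move=> u; exact: ip_ge0].
  by move=> a u v z; rewrite h1_linE -ip_lin; [|exact: h1_L2..].
- split; [|by move=> u v; exact: ipC|by move=> u; exact: ip_ge0].
  by move=> a u v z; apply: ip_wD_lin; exact: h1_wD_L2.
- by move=> a u v z; apply: ip_wD_lin; exact: h1_L2.
- exact: ip_parts.
- by move=> u v; apply: ip_cauchy; [exact: h1_wD_L2|exact: h1_L2].
- move=> a u v y z; rewrite /h1_trilinear h1_linE -ip_lin;
    [|exact: h1_mul_L2 (h1_wD_L2 y)|exact: h1_mul_L2 (h1_wD_L2 y)|exact: h1_L2].
  by apply: eq_Rintegral => x _ /=; ring.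
- move=> a u v y z; rewrite !h1_trilinearE; apply: ip_wD_lin.
  exact: h1_mul_L2 (h1_L2 z).
- by move=> u y z; rewrite !h1_trilinearE; congr ip; apply/funext => x; rewrite mulrC.
- exact: h1_trilinear_parts.
- exact: h1_trilinear_le.
- by move=> u; apply: trace_le; left.
- by move=> u; apply: trace_le; right.
- exact: ip_le_trip.
Defined.

End H1model.

(** * Finite elements *)

Section Interpolation.
Context {R : realType}.
Local Notation leb := (@lebesgue_measure R).
Implicit Types (f g u v chi : R -> R) (a b c x y h : R) (s : seq R).

Lemma bounded_integrable_itv g a b (K : R) : measurable_fun `]a, b[ g ->
  (forall x, `|g x| <= K) -> leb.-integrable `]a, b[ (EFin \o g).
Proof.
move=> mg gK.
have ic : leb.-integrable `]a, b[ (EFin \o (fun _ : R => 1)).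
  apply: (@integrableS _ _ _ leb `[a, b]) => //; first exact: subset_itv_oo_cc.
  apply: continuous_compact_integrable; first exact: segment_compact.
  by move=> x; exact: cst_continuous.
have := @bounded_mul_integrable R _ (fun=> 1) g K (measurable_itv _) ic mg (fun x _ => gK x).
by apply: eq_integrable => // x _ /=; rewrite mul1r.
Qed.

Lemma itgU_on g a b c : leb.-integrable `]a, c[ (EFin \o g) -> a <= b -> b <= c ->
  itg a c g = itg a b g + itg b c g.
Proof.
move=> ig ab bc.
have iG : leb.-integrable setT (EFin \o (g \_ `]a, c[)).
  by rewrite -restrict_EFin; apply/(@integrable_mkcond _ _ _ leb `]a, c[) => //.
have E x y : a <= x -> y <= c -> itg x y (g \_ `]a, c[) = itg x y g.
  move=> ax yc; apply: eq_Rintegral => z; rewrite inE/= in_itv/= => /andP[xz zy].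
  by rewrite patchE mem_set//= in_itv/= (le_lt_trans ax xz) (lt_le_trans zy yc).
by have := itgU iG ab bc; rewrite !E.
Qed.

(** Points left of [a] continue the first cell affinely and points right of the last node get a
    constant; for a partition of [0, 1] both lie outside [0, 1]. *)
Fixpoint interp a s v x : R :=
  if s is b :: s' then
    if x <= b then v a + (v b - v a) / (b - a) * (x - a) else interp b s' v x
  else v a.

Fixpoint dinterp a s v x : R :=
  if s is b :: s' then
    if x <= b then (v b - v a) / (b - a) else dinterp b s' v x
  else 0.

Lemma dinterp_measurable a s v : measurable_fun [set: R] (dinterp a s v).
Proof.
elim: s a => [|b s IH] a /=; first exact: measurable_cst.
by apply: measurable_fun_ifT => //; exact: measurable_fun_ler.
Qed.

(** The constant depends on the partition but not on [v]: equivalence of norms on V_h. *)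
Lemma dinterp_bound a s : exists2 C, 0 <= C & forall v (K : R),
  (forall x, x \in a :: s -> `|v x| <= K) -> forall x, `|dinterp a s v x| <= C * K.
Proof.
elim: s a => [|b s IH] a /=.
  by exists 0 => // v K _ x; rewrite normr0 mul0r.
have [C C0 HC] := IH b.
exists (2 / `|b - a| + C); first by rewrite addr_ge0// divr_ge0.
move=> v K vK x.
have K0 : 0 <= K by rewrite (le_trans _ (vK a _))// inE eqxx.
rewrite (mulrDl (2 / _)); case: ifP => _.
  apply: (@le_trans _ _ (2 / `|b - a| * K)); last by rewrite lerDl mulr_ge0.
  rewrite normrM normfV mulrAC ler_wpM2r ?invr_ge0//.
  rewrite (le_trans (ler_normB _ _))// mulr_natl mulr2n lerD// vK// !inE eqxx ?orbT//.
rewrite (le_trans (HC v K _ x))//; last by rewrite lerDr mulr_ge0 ?divr_ge0.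
by move=> y ys; apply: vK; rewrite inE ys orbT.
Qed.

Lemma dinterp_bounded a s v : exists2 K, 0 <= K & forall x, `|dinterp a s v x| <= K.
Proof.
elim: s a => [|b s IH] a /=; first by exists 0 => // x; rewrite normr0.
have [K K0 HK] := IH b.
exists (`|(v b - v a) / (b - a)| + K); first by rewrite addr_ge0.
by move=> x; case: ifP => _; [rewrite lerDl|rewrite (le_trans (HK x))// lerDr].
Qed.

Lemma dinterp_integrable a s v c b : leb.-integrable `]c, b[ (EFin \o dinterp a s v).
Proof.
have [K K0 HK] := dinterp_bounded a s v.
apply: (bounded_integrable_itv _ HK).
by apply: (@measurable_funS _ _ _ _ setT) => //; exact: dinterp_measurable.
Qed.

Lemma path_last_ge a s : path <%R a s -> a <= last a s.
Proof.
elim: s a => [|b s IH] a //= /andP[ab /IH]; apply: le_trans; exact: ltW.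
Qed.

Lemma interp_itg a s v x : path <%R a s -> a <= x -> x <= last a s ->
  interp a s v x = v a + itg a x (dinterp a s v).
Proof.
elim: s a => [|b s IH] a /=.
  by move=> _ ax xa; rewrite itg_ge ?addr0.
move=> /andP[ab ps] ax xl.
have E1 y : y <= b -> a <= y -> itg a y (dinterp a (b :: s) v) = (v b - v a) / (b - a) * (y - a).
  move=> yb ay; rewrite -itg_cst//; apply: eq_Rintegral => z; rewrite inE/= in_itv/= => /andP[_ zy].
  by rewrite ifT// (le_trans (ltW zy)).
have [xb|bx] := leP x b; first by rewrite E1.
rewrite (itgU_on _ (ltW ab) (ltW bx)); last exact: (dinterp_integrable a (b :: s)).
rewrite E1 ?lexx ?(ltW ab)// divfK ?subr_eq0 ?gt_eqF// addrA [v a + _]addrC subrK.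
rewrite IH ?(ltW bx)//; congr (_ + _); apply: eq_Rintegral => z.
by rewrite inE/= in_itv/= => /andP[bz _]; rewrite ifF// leNgt bz.
Qed.

Lemma interp_node a s v x : path <%R a s -> x \in a :: s -> interp a s v x = v x.
Proof.
elim: s a => [|b s IH] a /=; first by rewrite inE => _ /eqP ->.
move=> /andP[ab ps]; rewrite inE => /predU1P[->|xs].
  by rewrite (ltW ab) subrr mulr0 addr0.
have [xb|bx] := leP x b; last exact: IH.
have -> : x = b.
  move: xs; rewrite inE => /predU1P[//|xs].
  have := order_path_min lt_trans ps => /allP/(_ x xs).
  by rewrite ltNge xb.
by rewrite divfK ?subr_eq0 ?gt_eqF// addrC subrK.
Qed.

Lemma interp_lin a s (k : R) u v x :
  interp a s (fun x => k * u x + v x) x = k * interp a s u x + interp a s v x.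
Proof.
elim: s a => [|b s IH] a //=; case: ifP => _ //; ring.
Qed.

Lemma interp_prim s v : itv_partition 0 1 s -> prim (interp 0 s v) (dinterp 0 s v).
Proof.
move=> [ps /eqP ls]; split.
  have [K K0 HK] := dinterp_bounded 0 s v.
  apply: (@L2_bounded _ _ K); last by move=> x _; exact: HK.
  by apply: (@measurable_funS _ _ _ _ setT) => //; exact: dinterp_measurable.
move=> x /andP[x0 x1]; by rewrite interp_itg ?ls// [in RHS]interp_node ?inE ?eqxx.
Qed.

(** On each cell [dinterp] is constant, and the integral of g is the difference of two zero nodal
    values of u. *)
Lemma interp_orth a s u g v : prim u g -> 0 <= a -> last a s <= 1 -> path <%R a s ->
  (forall x, x \in a :: s -> u x = 0) -> itg a (last a s) (fun x => g x * dinterp a s v x) = 0.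
Proof.
move=> P; have [g2 _] := P; elim: s a => [|b s IH] a /=; first by rewrite itg_ge.
move=> a0 l1 /andP[ab ps] u0.
have bl := path_last_ge ps.
have iF c d : 0 <= c -> d <= 1 -> leb.-integrable `]c, d[
    (EFin \o (fun x => g x * dinterp a (b :: s) v x)).
  move=> c0 d1; have [K K0 HK] := dinterp_bounded a (b :: s) v.
  apply: (@bounded_mul_integrable _ _ g _ K) => //; first exact: L2_integrable_itv.
  by apply: (@measurable_funS _ _ _ _ setT) => //; exact: dinterp_measurable.
rewrite (itgU_on (iF _ _ a0 l1) (ltW ab) bl).
have -> : itg a b (fun x => g x * dinterp a (b :: s) v x) = 0.
  transitivity (itg a b (fun x => (v b - v a) / (b - a) * g x)).
    apply: eq_Rintegral => z; rewrite inE/= in_itv/= => /andP[_ zb].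
    by rewrite ifT ?(ltW zb)// mulrC.
  rewrite /itg RintegralZl//; last by apply: L2_integrable_itv => //; rewrite (le_trans bl).
  rewrite -/(itg _ _ _) -(prim_sub P a0 (ltW ab) (le_trans bl l1)).
  by rewrite !u0 ?inE ?eqxx ?orbT// subrr mulr0.
rewrite add0r -(IH b) ?(le_trans a0 (ltW ab))//; last by move=> x xs; rewrite u0// inE xs orbT.
apply: eq_Rintegral => z; rewrite inE/= in_itv/= => /andP[bz _].
by rewrite ifF// leNgt bz.
Qed.

(** On each cell u starts from 0, so Cauchy-Schwarz gives u(x)^2 <= h int g^2, and integrating over
    a cell of length at most h supplies the second factor h. *)
Lemma interp_poincare a s u g h : prim u g -> 0 <= a -> last a s <= 1 -> path <%R a s ->
  (forall x, x \in a :: s -> u x = 0) ->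
  (forall j, (j < size s)%N -> nth 0 (a :: s) j.+1 - nth 0 (a :: s) j <= h) ->
  itg a (last a s) (fun x => u x ^+ 2) <= h ^+ 2 * itg a (last a s) (fun x => g x ^+ 2).
Proof.
move=> P; have [g2 _] := P; have u2 := prim_L2 P.
have sqi f c d : L2 f -> 0 <= c -> d <= 1 -> leb.-integrable `]c, d[ (EFin \o (fun x => f x ^+ 2)).
  move=> f2 c0 d1; apply: integrableS (L2_sqr_integrable f2) => //.
  by apply: subset_itv; rewrite bnd_simp.
elim: s a => [|b s IH] a /=; first by rewrite !itg_ge// mulr0.
move=> a0 l1 /andP[ab ps] u0 hh.
have bl := path_last_ge ps; have b1 := le_trans bl l1; have b0 := le_trans a0 (ltW ab).
rewrite !(itgU_on _ (ltW ab) bl); [|exact: sqi|exact: sqi].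
rewrite mulrDr; apply: lerD; last first.
  apply: IH => //; first by move=> x xs; rewrite u0// inE xs orbT.
  by move=> j js; exact: (hh j.+1).
have bah : b - a <= h by have := hh 0%N isT.
have ba0 : 0 < b - a by rewrite subr_gt0.
pose D := itg a b (fun x => g x ^+ 2).
have D0 : 0 <= D by apply: Rintegral_ge0 => x _; exact: sqr_ge0.
apply: (@le_trans _ _ (itg a b (cst (h * D)))); last first.
  rewrite itg_cst ?(ltW ab)// expr2 -!mulrA ler_wpM2l ?(le_trans (ltW ba0))//.
  by rewrite mulrC ler_wpM2r.
apply: le_itg; first exact: sqi.
  apply: (@bounded_integrable_itv _ _ _ `|h * D|) => //.
move=> x /andP[ax xb].
have := prim_sub P a0 (ltW ax) (le_trans (ltW xb) b1).
rewrite (u0 a) ?inE ?eqxx// subr0 => ->.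
have := itg_cauchy (ltW ax) (L2_integrable_itv a0 (le_trans (ltW xb) b1) g2)
   (sqi _ _ _ g2 a0 (le_trans (ltW xb) b1)).
move=> /le_trans; apply; apply: ler_pM.
- by rewrite subr_ge0 ltW.
- by apply: Rintegral_ge0 => y _; exact: sqr_ge0.
- by apply: le_trans bah; lra.
rewrite /D (itgU_on (sqi _ _ _ g2 a0 b1) (ltW ax) (ltW xb)) lerDl.
by apply: Rintegral_ge0 => y _; exact: sqr_ge0.
Qed.

End Interpolation.

Section FiniteElements.
Context {R : realType}.
Local Notation leb := (@lebesgue_measure R).
Local Notation I01 := (`]0%R, 1%R[%classic : set R).
Implicit Types (f g u v chi : R -> R) (a b c x y h : R) (s : seq R).
Local Notation M := (@h1_model_of R).
Local Notation N := (snorm (trip M)).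

(** [fe_space] prescribes the affine form on open cells only; continuity carries it to the nodes, so
    that nodal values determine an element of V_h. *)
Lemma cont01_affine_closed chi a b al be : cont01 chi -> 0 <= a -> a < b -> b <= 1 ->
  (forall x, a < x < b -> chi x = al * x + be) ->
  forall x, a <= x <= b -> chi x = al * x + be.
Proof.
move=> cc a0 ab b1 E.
have : {within `[a, b], continuous chi}.
  by apply: continuous_subspaceW cc => x /=; rewrite !in_itv/= => /andP[? ?]; apply/andP; split; lra.
move=> /(continuous_within_itvP _ ab)[_ La Lb].
have aff (y : R) : {for y, continuous (fun x : R => al * x + be)}.
  by apply: (@continuousD _ _ _ (fun x => al * x) (cst be) y);
    [exact: mulrl_continuous|exact: cst_continuous].
have Ea : chi a = al * a + be.
  apply: (cvg_unique (@Rhausdorff R) La).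
  apply: cvg_trans (cvg_at_right_filter (aff a)); apply: near_eq_cvg.
  near=> x; rewrite E//; apply/andP; split; near: x; [exact: nbhs_right_gt|exact: nbhs_right_lt].
have Eb : chi b = al * b + be.
  apply: (cvg_unique (@Rhausdorff R) Lb).
  apply: cvg_trans (cvg_at_left_filter (aff b)); apply: near_eq_cvg.
  near=> x; rewrite E//; apply/andP; split; near: x; [exact: nbhs_left_gt|exact: nbhs_left_lt].
move=> x /andP[]; rewrite le_eqVlt => /predU1P[<-//|ax].
rewrite le_eqVlt => /predU1P[->//|xb].
by rewrite E// ax.
Unshelve. all: by end_near. Qed.

Lemma affine_interp a s chi x : cont01 chi -> 0 <= a -> last a s <= 1 -> path <%R a s ->
  (forall j : nat, (j < size s)%N -> exists al be : R,
     forall x, nth 0 (a :: s) j < x < nth 0 (a :: s) j.+1 -> chi x = al * x + be) ->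
  a <= x <= last a s -> chi x = interp a s chi x.
Proof.
move=> cc; elim: s a => [|b s IH] a /=; first by move=> _ _ _ _ /le_anti <-.
move=> a0 l1 /andP[ab ps] aff /andP[ax xl].
have bl := path_last_ge ps.
case: leP => [xb|bx].
  have [al [be E]] := aff 0%N isT.
  have {}E := cont01_affine_closed cc a0 ab (le_trans bl l1) E.
  rewrite !E ?ax ?xb ?lexx ?(ltW ab)//.
  by field; rewrite subr_eq0 gt_eqF.
apply: IH; rewrite ?(le_trans a0 (ltW ab)) ?(ltW bx)//.
by move=> j js; exact: (aff j.+1).
Qed.

Lemma interp_affine a s v (j : nat) : path <%R a s -> (j < size s)%N -> exists al be : R,
  forall x, nth 0 (a :: s) j < x < nth 0 (a :: s) j.+1 -> interp a s v x = al * x + be.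
Proof.
elim: s a j => [|b s IH] a j //= /andP[ab ps].
case: j => [|j] js /=.
  exists ((v b - v a) / (b - a)), (v a - (v b - v a) / (b - a) * a) => x /andP[ax xb].
  by rewrite (ltW xb); ring.
have [al [be E]] := IH b j ps js; exists al, be => x H.
rewrite ifF; first exact: E.
apply/negbTE; rewrite -ltNge; case/andP: H => H _; apply: le_lt_trans H.
have : nth 0 (b :: s) j \in b :: s by rewrite mem_nth//= ltnW.
rewrite inE => /predU1P[->//|js'].
by have := order_path_min lt_trans ps => /allP/(_ _ js')/ltW.
Qed.

Section Partition.
Variable s : seq R.
Hypothesis sP : itv_partition 0 1 s.

Let ps : path <%R 0 s. Proof. by case: sP. Qed.
Let ls : last 0 s = 1. Proof. by case: sP => _ /eqP. Qed.

Lemma fe_space_interpE chi x : fe_space s chi -> 0 <= x <= 1 -> chi x = interp 0 s chi x.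
Proof.
move=> [cc aff] x01; by apply: affine_interp; rewrite ?ls//.
Qed.

Lemma interp_fe_space v : fe_space s (interp 0 s v).
Proof.
split; first exact: prim_cont (interp_prim v sP).
move=> j js; have [al [be E]] := interp_affine v ps js.
by exists al, be => x; rewrite in_itv; exact: E.
Qed.

Lemma node01 (i : nat) : (i <= size s)%N -> 0 <= node s i <= 1.
Proof.
move=> is'; have : node s i \in 0 :: s by rewrite mem_nth.
rewrite inE => /predU1P[->|iss]; first by rewrite lexx ler01.
have := order_path_min lt_trans ps => /allP/(_ _ iss)/ltW -> /=.
rewrite -ls; move: iss; move: (node s i) => z.
have := ps; elim: (s) (0 : R) => [|b t IH] a //= /andP[ab pt].
by rewrite inE => /predU1P[->|zt]; [exact: path_last_ge|exact: IH].
Qed.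

Lemma eq_fe_space u v : (forall x, 0 <= x <= 1 -> u x = v x) -> fe_space s u -> fe_space s v.
Proof.
move=> E [cu au]; split.
  by apply: subspace_eq_continuous cu => x; rewrite inE/= in_itv/=; exact: E.
move=> j js; have [al [be H]] := au j js; exists al, be => x xj.
rewrite -E ?H//.
have [nx xn] : node s j < x /\ x < node s j.+1 by move: xj; rewrite in_itv/= => /andP.
have /andP[h1 _] := node01 (ltnW js); have /andP[_ h2] := node01 js.
by rewrite (le_trans h1 (ltW nx)) (le_trans (ltW xn) h2).
Qed.

Lemma mesh_size_ge (j : nat) : (j < size s)%N -> nth 0 (0 :: s) j.+1 - nth 0 (0 :: s) j <= mesh_size s.
Proof.
move=> js; exact: (le_bigmax 0 (fun j : 'I_(size s) => node s j.+1 - node s j) (Ordinal js)).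
Qed.

Lemma mesh_size01 : 0 <= mesh_size s <= 1.
Proof.
apply/andP; split; first by rewrite /mesh_size; exact: bigmax_ge_id.
apply: bigmax_le => // j _.
have /andP[_ h1] := node01 (ltn_ord j); have /andP[h2 _] := node01 (ltnW (ltn_ord j)).
lra.
Qed.

Lemma fe_space_prim chi : fe_space s chi -> prim chi (dinterp 0 s chi).
Proof.
move=> H; apply: (prim_ext _ (interp_prim chi sP)) => x x01.
by rewrite -(fe_space_interpE H).
Qed.

(** The default 0 of [insubd] is never taken, because every interpolant lies in H^1, see
    [fe_projE]. *)
Definition fe_proj (u : h1 (R := R)) : h1 (R := R) := insubd 0 (interp 0 s u).

Lemma fe_projE (u : h1 (R := R)) : h1_val (fe_proj u) = interp 0 s u.
Proof.
rewrite /fe_proj; apply: insubdK; exact: prim_h1 (interp_prim _ sP).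
Qed.

Lemma node_in01 x : x \in 0 :: s -> 0 <= x <= 1.
Proof.
move=> xs; have := nth_index 0 xs => <-; apply: node01.
by rewrite -ltnS -[(size s).+1]/(size (0 :: s)) index_mem.
Qed.

Lemma last_in : 1 \in 0 :: s. Proof. by rewrite -ls mem_last. Qed.

Lemma fe_proj_node (u : h1 (R := R)) x : x \in 0 :: s -> h1_val (fe_proj u) x = u x.
Proof. by move=> xs; rewrite fe_projE interp_node. Qed.

Lemma h1_subE (u v : h1 (R := R)) : h1_val (u - v) = (fun x => u x - v x).
Proof.
have -> : u - v = (-1) *: v + u by rewrite scaleN1r addrC.
by apply/funext => x; rewrite h1_lin; ring.
Qed.

Lemma fe_sub_closed : @sub_closed R (h1 (R := R)) (fun v : h1 (R := R) => fe_space s v).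
Proof.
move=> u v Hu Hv; have [cu au] := Hu; have [cv av] := Hv; split.
  rewrite h1_subE; apply/subspace_continuousP => x x01; apply: cvgB.
    by move/subspace_continuousP : cu; exact.
  by move/subspace_continuousP : cv; exact.
move=> j js; have [a [b E]] := au j js; have [a' [b' E']] := av j js.
exists (a - a'), (b - b') => x xj; rewrite h1_subE E// E'//; ring.
Qed.

Lemma fe_galerkin : galerkin M (fun v : h1 (R := R) => fe_space s v) fe_proj (mesh_size s).
Proof.
have P0 (u : h1 (R := R)) x : x \in 0 :: s -> h1_val (u - fe_proj u) x = 0.
  by move=> xs; rewrite h1_subE fe_proj_node// subrr.
split.
- exact: fe_sub_closed.
- by move=> u; rewrite fe_projE; exact: interp_fe_space.
- move=> u v; apply: val_inj; apply/funext => x.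
  change (h1_val (fe_proj (u - v)) x = h1_val (fe_proj u - fe_proj v) x).
  rewrite h1_subE !fe_projE h1_subE.
  rewrite -[in RHS]mulN1r addrC -interp_lin; congr interp; apply/funext => y; ring.
- by move=> u; exact: (fe_proj_node u (mem_head _ _)).
- by move=> u; exact: (fe_proj_node u last_in).
- move=> u chi Hchi.
  have H := fe_space_prim Hchi.
  have -> : d M (u - fe_proj u) chi = ip (wD (h1_val (u - fe_proj u))) (dinterp 0 s chi).
    have := ae01_ip (h1_wD_L2 chi) (proj1 H) (h1_wD_L2 (u - fe_proj u)) (prim_wD_ae H).
    by rewrite ipC [RHS]ipC.
  have := @interp_orth R 0 s _ _ chi (h1_prim (u - fe_proj u)) (lexx 0).
  by rewrite ls; apply => //; exact: P0.
- move=> u; have /andP[h0 _] := mesh_size01.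
  rewrite /snorm -[mesh_size s](ger0_norm h0) -sqrtr_sqr -sqrtrM ?sqr_ge0//.
  rewrite ler_wsqrtr//.
  have := @interp_poincare R 0 s _ _ (mesh_size s) (h1_prim (u - fe_proj u)) (lexx 0).
  rewrite ls => /(_ (lexx 1) ps (P0 u) mesh_size_ge).
  have sqE (f : R -> R) : ip f f = itg 0 1 (fun x => f x ^+ 2).
    by apply: eq_Rintegral => x _; rewrite expr2.
  by rewrite -!sqE.
- exact: mesh_size01.
Qed.

(** The constant depends on the mesh; it serves the continuity and differentiability of [wh] in
    time, not the error bounds. *)
Lemma fe_norm_le : exists2 C, 0 <= C & forall v : h1 (R := R), fe_space s v ->
  forall K, 0 <= K -> (forall x, x \in 0 :: s -> `|v x| <= K) -> N v <= C * K.
Proof.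
have [C C0 HC] := dinterp_bound 0 s.
exists (Num.sqrt (2 + C ^+ 2)); first exact: sqrtr_ge0.
move=> v Hv K K0 vK; have P := fe_space_prim Hv; have [d2 _] := P.
rewrite -(@ler_pXn2r _ 2)// ?nnegrE ?N_ge0 ?mulr_ge0 ?sqrtr_ge0//.
rewrite [leRHS]exprMn [X in _ <= X * _]sqr_sqrtr ?addr_ge0 ?sqr_ge0// sqr_N.
have h0 : v 0 ^+ 2 <= K ^+ 2.
  by rewrite -(real_normK (num_real (v 0))) lerXn2r ?nnegrE// vK// mem_head.
have h1 : v 1 ^+ 2 <= K ^+ 2.
  by rewrite -(real_normK (num_real (v 1))) lerXn2r ?nnegrE// vK// last_in.
have hd : ip (wD v) (wD v) <= (C * K) ^+ 2.
  have E : ip (wD v) (wD v) = ip (dinterp 0 s v) (dinterp 0 s v).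
    have ae := prim_wD_ae P.
    rewrite (ae01_ip (h1_wD_L2 v) d2 (h1_wD_L2 v) ae) ipC.
    exact: (ae01_ip (h1_wD_L2 v) d2 d2 ae).
  rewrite E /ip.
  have -> : \int[leb]_(x in I01) (dinterp 0 s v x * dinterp 0 s v x) =
     \int[leb]_(x in I01) (dinterp 0 s v x ^+ 2) by apply: eq_Rintegral => x _; rewrite expr2.
  have mI2 : measurable_fun I01 (fun x => dinterp 0 s v x ^+ 2).
    apply: measurable_funX; apply: (@measurable_funS _ _ _ _ setT) => //.
    exact: dinterp_measurable.
  have b2 x : `|dinterp 0 s v x ^+ 2| <= (C * K) ^+ 2.
    by rewrite normrX lerXn2r ?nnegrE ?mulr_ge0// HC.
  apply: Rintegral_le_cst; first by apply: (@L2_bounded _ _ ((C * K) ^+ 2)).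
  by move=> x _; rewrite (le_trans (ler_norm _)).
rewrite /=; move: hd; rewrite exprMn; lra.
Qed.

End Partition.

End FiniteElements.

Section Forms.
Context {R : realType} {V : lmodType R} (M : h1_model V) (Q : bbm_params R).

Lemma fA_lin u a z y v : fA M Q u (a *: z + y) v = a * fA M Q u z v + fA M Q u y v.
Proof.
rewrite /fA /fb e0_lin e1_lin (semi_lin (d_semi M)) (semi_lin (p_semi M)); ring.
Qed.

Lemma fA_le u : exists2 C, 0 <= C & forall z v,
  `|fA M Q u z v| <= C * (snorm (trip M) z * snorm (trip M) v).
Proof.
have [C C0 HC] := fb_le M Q.
set a := pmu Q / pnu Q * (2 / (3 * pc0 Q) * e0 M u ^+ 2).
set b := pmu Q / pnu Q * (2 / (3 * pc1 Q) * e1 M u ^+ 2).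
exists (C + `|a| + `|b|); first by rewrite !addr_ge0.
move=> z v.
have -> : fA M Q u z v = fb M Q z v + a * (e0 M z * e0 M v) + b * (e1 M z * e1 M v).
  by rewrite /fA /a /b; ring.
rewrite !(mulrDl _ _ (_ * _)) (le_trans (ler_normD _ _))// lerD//.
  rewrite (le_trans (ler_normD _ _))// lerD//.
  by rewrite !normrM ler_wpM2l// ler_pM// e0_le.
by rewrite !normrM ler_wpM2l// ler_pM// e1_le.
Qed.

End Forms.

Section MinDelta.
Context {R : realType}.

(** Merges the choices of delta at finitely many nodes into one. The monotone predicate [B] stands
    for the two kinds of time neighbourhoods used below, two-sided and right-sided. *)
Lemma uniform_delta (l : seq R) (B P : R -> R -> Prop) :
  (forall t a b, a <= b -> B a t -> B b t) ->
  (forall x, x \in l -> exists2 del, 0 < del & forall t, B del t -> P x t) ->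
  exists2 del, 0 < del & forall t, B del t -> forall x, x \in l -> P x t.
Proof.
move=> mB; elim: l => [|y l IH] H; first by exists 1.
have [a a0 Ha] := H y (mem_head _ _).
have [|b b0 Hb] := IH; first by move=> x xl; apply: H; rewrite inE xl orbT.
exists (Num.min a b); first by rewrite lt_min a0.
move=> t Bt x; rewrite inE => /predU1P[->|xl].
  by apply: Ha; apply: mB Bt; rewrite ge_min lexx.
by apply: Hb => //; apply: mB Bt; rewrite ge_min lexx orbT.
Qed.

End MinDelta.

(** * The semidiscrete solution as an evolution in V_h *)

Section Semidiscrete.
Context {R : realType}.
Local Notation M := (@h1_model_of R).
Local Notation N := (snorm (trip M)).
Local Notation h1 := (h1 (R := R)).
Variables (mu nu wd : R) (c : 'I_2 -> R).
Hypotheses (hmu : 0 < mu) (hnu : 0 < nu) (hwd : 0 <= wd) (hc : forall i, 0 < c i).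

Definition params := Build_bbm_params hmu hnu hwd (hc 0) (hc 1).
Local Notation Q := params.

Lemma weak_formE (u ut v : h1) : weak_form mu nu wd c u ut v = fA M Q u ut v + fB M Q u v.
Proof.
rewrite /weak_form !big_ord_recl !big_ord0 /=.
have -> : lift ord0 ord0 = 1 :> 'I_2 by apply: val_inj.
have -> : ord0 = 0 :> 'I_2 by apply: val_inj.
(* The rearrangement is proved for real variables, so that [ring] does not meet the inner
   products. *)
have alg (A B D G T x0 x1 y0 y1 v0 v1 c0 c1 : R) :
  A + mu * B + nu * D + (1 + wd) * G + T
  + (((1 + c0 + wd) * x0 + 2 / (9 * c0) * x0 ^+ 3) * v0
     + (((1 + c1 + wd) * x1 + 2 / (9 * c1) * x1 ^+ 3) * v1 + 0))
  + mu / nu * (((c0 + 1 + wd) * y0 + 2 / (3 * c0) * x0 ^+ 2 * y0) * v0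
     + (((c1 + 1 + wd) * y1 + 2 / (3 * c1) * x1 ^+ 2 * y1) * v1 + 0)) =
  A + mu * B + mu / nu * ((c0 + 1 + wd) * y0 * v0 + (c1 + 1 + wd) * y1 * v1)
  + mu / nu * (2 / (3 * c0) * x0 ^+ 2 * y0 * v0 + 2 / (3 * c1) * x1 ^+ 2 * y1 * v1)
  + (nu * D + (1 + wd) * G + T + (((c0 + 1 + wd) * x0 + 2 / (9 * c0) * x0 ^+ 3) * v0
     + ((c1 + 1 + wd) * x1 + 2 / (9 * c1) * x1 ^+ 3) * v1)) by ring.
exact: alg.
Qed.

Variables (lam : R) (s : seq R) (w0 : R -> R) (wh : R -> R -> R).
Hypothesis sP : itv_partition 0 1 s.
Hypothesis Hwh : semidiscrete_solution mu nu wd c lam s w0 wh.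

Definition to_h1 (v : R -> R) : h1 := insubd 0 v.

Lemma fe_space_lin (a : R) (u v : h1) : fe_space s u -> fe_space s v -> fe_space s (a *: u + v).
Proof.
move=> Hu Hv; have [cu au] := Hu; have [cv av] := Hv; split.
  exact: prim_cont (h1_prim _).
move=> j js; have [k [b E]] := au j js; have [k' [b' E']] := av j js.
exists (a * k + k'), (a * b + b') => x xj; rewrite h1_lin E// E'//; ring.
Qed.

Lemma to_h1E v : fe_space s v -> h1_val (to_h1 v) = v.
Proof. by move=> Hv; apply: insubdK; exact: prim_h1 (fe_space_prim sP Hv). Qed.

Lemma wh_derivable (t x : R) : 0 < t -> 0 <= x <= 1 ->
  is_derive t 1 (fun tau => wh tau x) (dt wh t x).
Proof.
move=> t0 x01; apply: DeriveDef; last by rewrite /dt derive1E.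
by apply: (semidiscrete_derivable Hwh t0); rewrite in_itv.
Qed.

Lemma interp_derivable a l (t x : R) : (forall y, y \in a :: l ->
    is_derive t 1 (fun tau => wh tau y) (dt wh t y)) ->
  is_derive t 1 (fun tau => interp a l (wh tau) x) (interp a l (dt wh t) x).
Proof.
elim: l a => [|b l IH] a H /=; first exact: H (mem_head _ _).
have Ha := H a (mem_head _ _).
have Hb : is_derive t 1 (fun tau => wh tau b) (dt wh t b) by apply: H; rewrite !inE eqxx orbT.
case: ifP => _; last by apply: IH => y yl; apply: H; rewrite inE yl orbT.
have E := is_deriveD Ha (is_deriveZ ((x - a) / (b - a)) (is_deriveB Hb Ha)).
have -> : (fun tau => wh tau a + (wh tau b - wh tau a) / (b - a) * (x - a)) =
    (fun tau => wh tau a) + ((x - a) / (b - a)) *: ((fun tau => wh tau b) - (fun tau => wh tau a)).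
  by apply/funext => tau; rewrite !fctE; rewrite /GRing.scale/=; ring.
apply: (is_derive_eq E); rewrite /GRing.scale/=; ring.
Qed.

(** An element of V_h depends linearly on its nodal values, so the time derivative at each point is
    the interpolant of the nodal time derivatives. *)
Lemma dt_fe (t : R) : 0 < t -> fe_space s (dt wh t).
Proof.
move=> t0; apply: (eq_fe_space sP _ (interp_fe_space sP (dt wh t))) => x x01.
have D1 := wh_derivable t0 x01.
have D2 : is_derive t 1 (fun tau => interp 0 s (wh tau) x) (interp 0 s (dt wh t) x).
  by apply: interp_derivable => y ys; apply: wh_derivable => //; exact: (node_in01 sP).
have D3 : is_derive t 1 (fun tau => wh tau x) (interp 0 s (dt wh t) x).
  apply: near_eq_is_derive D2; near=> tau.
  apply/esym/(fe_space_interpE sP) => //; apply: (semidiscrete_fe Hwh).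
  by apply/ltW; near: tau; exact: lt_nbhsr.
by have [_ <-] := D1; have [_ <-] := D3.
Unshelve. all: by end_near. Qed.

Let whV (t : R) := to_h1 (wh t).

Let whE (t : R) : 0 <= t -> h1_val (whV t) = wh t.
Proof. by move=> t0; apply: to_h1E; exact: (semidiscrete_fe Hwh). Qed.

Lemma wh_curve_continuous : curve_continuous M (fun t => to_h1 (wh t)).
Proof.
have [C C0 HC] := fe_norm_le sP.
move=> t0 t00 eps e0.
pose e' := eps / (C + 1).
have e'0 : 0 < e' by rewrite divr_gt0// ltr_wpDl.
have mB : forall t a b : R, a <= b -> (fun del t => 0 <= t /\ `|t - t0| < del) a t -> (fun del t => 0 <= t /\ `|t - t0| < del) b t.
  by move=> t a b ab [? H]; split=> //; exact: lt_le_trans H ab.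
have [x xs|del d0 Hd] := @uniform_delta R (0 :: s) _ (fun x t => `|wh t x - wh t0 x| <= e') mB.
  have x01 := node_in01 sP xs.
  (* At time 0 continuity from the right is given; at positive times continuity follows from
     differentiability. *)
  move: t00; rewrite le_eqVlt => /predU1P[<-|t00].
    have := semidiscrete_continuous0 Hwh (x := x); rewrite in_itv/= => /(_ x01).
    move=> /cvgrPdist_le /(_ _ e'0); rewrite near_withinE => /nbhs_ballP[del /= d0 H].
    exists del => // t [tp]; rewrite subr0 => td.
    move: tp; rewrite le_eqVlt => /predU1P[<-|tp]; first by rewrite subrr normr0 ltW.
    by rewrite distrC; apply: H => //; rewrite /ball/= sub0r normrN.
  have D := wh_derivable t00 x01.
  have cD : {for t0, continuous (fun tau => wh tau x)}.
    by apply: differentiable_continuous; apply/derivable1_diffP; case: D.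
  have /cvgrPdist_le /(_ _ e'0) /nbhs_ballP[del /= d0 H] := cD.
  exists del => // t [_ td]; rewrite distrC; apply: H.
  by rewrite /ball/= distrC.
exists del => // t tp td.
have Hv : fe_space s (whV t - whV t0).
  by apply: (fe_sub_closed (s := s)); rewrite whE//; exact: (semidiscrete_fe Hwh).
apply: (le_trans (HC _ Hv e' (ltW e'0) _)).
  by move=> x xs; rewrite h1_subE !whE//; exact: Hd.
rewrite /e' mulrA ler_pdivrMr ?ltr_wpDl//; nra.
Qed.

(** The increment is (t - s) times the time derivative plus an element [y] of V_h with nodal values
    o(t - s). The first part satisfies the equation exactly, and [fe_norm_le] makes the second
    negligible. *)
Lemma wh_evolves : evolves M Q (fun v : h1 => fe_space s v) (fun t => to_h1 (wh t)).
Proof.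
have [C C0 HC] := fe_norm_le sP.
move=> t0 t00 eps e0.
have [K K0 HK] := fA_le M Q (whV t0).
pose e' := eps / (C * K + 1).
have CK0 : 0 <= C * K by exact: mulr_ge0.
have e'0 : 0 < e' by rewrite divr_gt0// ltr_wpDl.
have mB : forall t a b : R, a <= b -> (fun del t => t0 < t < t0 + del) a t -> (fun del t => t0 < t < t0 + del) b t.
  by move=> t a b ab /andP[-> /= H]; apply: lt_le_trans H _; rewrite lerD2l.
have [x xs|del d0 Hd] := @uniform_delta R (0 :: s) _ (fun x t => `|wh t x - wh t0 x - (t - t0) * dt wh t0 x| <= (t - t0) * e') mB.
  exact: derive_increment (wh_derivable t00 (node_in01 sP xs)) e'0.
exists del => // t td chi Hchi.
have tp : 0 <= t by move: td => /andP[h _]; exact/ltW/(lt_trans t00).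
have Dfe := dt_fe t00.
pose D := to_h1 (dt wh t0); have DE : h1_val D = dt wh t0 by exact: to_h1E.
pose y := - (t - t0) *: D + (whV t - whV t0).
have Hy : fe_space s y.
  apply: fe_space_lin; first by rewrite DE.
  by apply: (fe_sub_closed (s := s)); rewrite whE ?(ltW t00)//; apply: (semidiscrete_fe Hwh); rewrite ?(ltW t00).
have Ny : N y <= C * ((t - t0) * e').
  apply: HC => //; first by rewrite mulr_ge0 ?(ltW e'0)// subr_ge0; case/andP: td => /ltW.
  move=> x xs; rewrite h1_lin h1_subE DE !whE ?(ltW t00)//.
  by rewrite addrC mulNr; exact: Hd.
have Eq : fA M Q (whV t0) D chi + fB M Q (whV t0) chi = 0.
  by rewrite -weak_formE DE whE ?(ltW t00)//; exact: (semidiscrete_eq Hwh).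
have -> : whV t - whV t0 = (t - t0) *: D + y.
  by rewrite /y addrA -scalerDl subrr scale0r add0r.
rewrite fA_lin addrAC -mulrDr Eq mulr0 add0r.
rewrite (le_trans (HK _ _))// mulrA ler_wpM2r ?N_ge0//.
rewrite (le_trans (ler_wpM2l K0 Ny))//.
have -> : K * (C * ((t - t0) * e')) = C * K * eps / (C * K + 1) * (t - t0) by rewrite /e'; ring.
rewrite ler_wpM2r//; first by rewrite subr_ge0; case/andP: td => /ltW.
rewrite ler_pdivrMr ?ltr_wpDl//; nra.
Qed.

End Semidiscrete.

(** * Regularity in time *)

Section JointlyIntegrable.
Context {R : realType}.
Local Notation leb := (@lebesgue_measure R).
Local Notation I01 := (`]0%R, 1%R[%classic : set R).
Implicit Types (f g v : R -> R) (u : R -> R -> R) (s t T x tau : R).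

Lemma Rintegral_section_integrable (F : R -> R -> R) :
  measurable_fun [set: R * R] (fun p => F p.1 p.2) ->
  (\int[leb]_x \int[leb]_y `|F x y|%:E < +oo)%E ->
  leb.-integrable setT (EFin \o (fun x => \int[leb]_y F x y)) /\
  leb.-integrable setT (EFin \o (fun y => \int[leb]_x F x y)).
Proof.
move=> mF Ffin.
have mE : measurable_fun [set: R * R] (EFin \o (fun p => F p.1 p.2)).
  exact/measurable_EFinP.
have iF : (leb \x leb)%E.-integrable setT (EFin \o (fun p => F p.1 p.2)).
  exact/(integrable12ltyP leb leb mE).
have fine_le (z : \bar R) : (`|(fine z)%:E| <= `|z|)%E by case: z => //=; rewrite normr0 leey.
have mE' : measurable_fun [set: R * R] (EFin \o (fun p => F p.2 p.1)).
  exact: (measurableT_comp mE (@measurable_swap _ _ _ _)).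
have iF' : (leb \x leb)%E.-integrable setT (EFin \o (fun p => F p.2 p.1)).
  by apply/(integrable12ltyP leb leb mE'); exact: (integrable21ltyP leb leb mE).1.
split.
- have H : leb.-integrable setT (fun x => \int[leb]_y (F x y)%:E)%E by exact: (integrable_fubini_F iF).
  apply: (@le_integrable _ _ _ leb setT measurableT (EFin \o (fun x => \int[leb]_y F x y)) _ _ _ H).
    by apply/measurable_EFinP; apply: measurableT_comp => //; exact: measurable_fubini_F iF.
  by move=> x _; exact: fine_le.
- have H : leb.-integrable setT (fun y => \int[leb]_x (F x y)%:E)%E by exact: (integrable_fubini_F iF').
  apply: (@le_integrable _ _ _ leb setT measurableT (EFin \o (fun y => \int[leb]_x F x y)) _ _ _ H).
    by apply/measurable_EFinP; apply: measurableT_comp => //; exact: measurable_fubini_F iF'.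
  by move=> y _; exact: fine_le.
Qed.

(** Extension by zero from (0, T) x (0, 1) to the plane, where Fubini is applied. *)
Definition strip T u tau x := if (0 < tau < T) && (0 < x < 1) then u tau x else 0.

Lemma strip_measurable T u : L2L2 T u ->
  measurable_fun [set: R * R] (fun p => strip T u p.1 p.2).
Proof.
move=> [mu _].
have mD : measurable ((`]0, T[%classic : set R) `*` I01) by apply: measurableX.
have := (measurable_restrictT _ mD).1 mu.
apply: eq_measurable_fun => -[tau x] _; rewrite patchE /strip/=.
case: ifPn => [|/negP H].
  by rewrite inE/= => -[]; rewrite /= !in_itv/= => -> ->.
rewrite ifF//; apply/negbTE/negP => /andP[H1 H2]; apply: H.
by rewrite inE/=; split; rewrite /= in_itv.
Qed.

Lemma strip_L2 T u : L2L2 T u ->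
  {ae leb, forall tau, 0 < tau < T -> L2 (u tau)} /\
  (\int[leb]_tau \int[leb]_x (strip T u tau x ^+ 2)%:E < +oo)%E.
Proof.
move=> uL; have mS := strip_measurable uL; have [_ fin] := uL.
have m2 : measurable_fun [set: R * R] (fun p => ((strip T u p.1 p.2) ^+ 2)%:E).
  by apply/measurable_EFinP; exact: measurable_funX.
have mh : measurable_fun setT (fun tau => \int[leb]_x (strip T u tau x ^+ 2)%:E)%E.
  by apply: (@measurable_fun_fubini_tonelli_F _ _ _ _ _ leb (fun p : R * R => (strip T u p.1 p.2 ^+ 2)%:E)) => //= p; rewrite lee_fin sqr_ge0.
have E tau : 0 < tau < T -> (\int[leb]_x (strip T u tau x ^+ 2)%:E = \int[leb]_(x in I01) (u tau x ^+ 2)%:E)%E.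
  move=> tT; rewrite [RHS]integral_mkcond; apply: eq_integral => x _.
  rewrite patchE /strip tT/=; case: ifPn => [x01|/negP x01].
    by rewrite mem_set//= in_itv.
  by rewrite memNset ?expr0n// /= in_itv.
have E0 tau : ~ (0 < tau < T) -> (\int[leb]_x (strip T u tau x ^+ 2)%:E = 0)%E.
  move=> /negP/negbTE tT; rewrite -[RHS](@integral0 _ _ _ leb setT).
  by apply: eq_integral => x _; rewrite /strip tT expr0n.
have fin' : (\int[leb]_tau \int[leb]_x (strip T u tau x ^+ 2)%:E < +oo)%E.
  apply: le_lt_trans fin; rewrite [leRHS]integral_mkcond.
  rewrite (@eq_integral _ _ _ leb setT ((fun tau => \int[leb]_(x in I01) (u tau x ^+ 2)%:E) \_ `]0%R, T[)%E)//.
  move=> tau _; rewrite patchE; case: ifPn => [|/negP H].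
    by rewrite inE/= in_itv/= => /E.
  by rewrite E0// => H'; apply: H; rewrite inE/= in_itv.
split => //.
have : leb.-integrable setT (fun tau => \int[leb]_x (strip T u tau x ^+ 2)%:E)%E.
  apply/integrableP; split => //.
  rewrite (@eq_integral _ _ _ leb setT (fun tau => \int[leb]_x (strip T u tau x ^+ 2)%:E)%E)//.
  move=> tau _; rewrite gee0_abs//; apply: integral_ge0 => x _.
  by rewrite lee_fin sqr_ge0.
move=> /integrable_ae => /(_ measurableT); apply: filterS => tau H tT.
have {}H := H I; apply: L2_intro.
  have mt : measurable_fun setT (strip T u tau).
    exact: (measurableT_comp mS (measurable_pair1 tau)).
  have : measurable_fun I01 (strip T u tau) by exact: measurable_funTS.
  apply: eq_measurable_fun => x; rewrite inE/= in_itv/= => x01.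
  by rewrite /strip tT x01.
by rewrite -E// -ge0_fin_numE//; apply: integral_ge0 => x _; rewrite lee_fin sqr_ge0.
Qed.

(** Joint integrability comes from |u f| <= u^2 + f^2 on the strip; the second summand has a finite
    double integral because [T] is finite. *)
Lemma L2L2_Fubini_raw T u f s t : L2L2 T u -> L2 f -> 0 <= s -> t <= T ->
  [/\ leb.-integrable `]s, t[ (EFin \o (fun tau => ip (u tau) f)),
      leb.-integrable I01 (EFin \o (fun x => itg s t (fun tau => u tau x * f x))),
      itg s t (fun tau => ip (u tau) f) =
        \int[leb]_(x in I01) itg s t (fun tau => u tau x * f x) &
      {ae leb, forall x, 0 < x < 1 ->
        leb.-integrable `]s, t[ (EFin \o (fun tau => u tau x * f x))}].
Proof.
move=> uL f2 s0 tT; have mS := strip_measurable uL.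
have [aeL fin] := strip_L2 uL.
pose fr := f \_ I01.
pose G tau x := if s < tau < t then strip T u tau x * fr x else 0.
have mfr : measurable_fun setT fr.
  exact: ((measurable_restrictT _ (measurable_itv _)).1 (L2_measurable f2)).
have mfr2 : measurable_fun [set: R * R] (fun p => fr p.2).
  by apply: (measurableT_comp mfr); exact: measurable_snd.
have m1 : measurable_fun [set: R * R] (fst : R * R -> R) by exact: measurable_fst.
have mG : measurable_fun [set: R * R] (fun p => G p.1 p.2).
  apply: measurable_fun_ifT => //; last by apply: measurable_funM.
  by apply: measurable_and; exact: measurable_fun_ltr.
pose k : R -> R := \1_(`]0%R, T[%classic : set R).
have kE tau : 0 < tau < T -> k tau = 1.
  by move=> H; rewrite /k indicE mem_set//= in_itv.
have k0 tau : 0 <= k tau by rewrite /k indicE.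
have kfin : (\int[leb]_tau (k tau)%:E < +oo)%E.
  have := @integral_indic _ _ _ leb setT measurableT `]0%R, T[%classic (measurable_itv _).
  rewrite setIT => ->.
  have H : (leb `]0%R, T[ < +oo)%E.
    by rewrite lebesgue_measure_itv/=; case: ifP => _; rewrite ?ltry.
  exact: H.
have mk : measurable_fun setT k by exact: measurable_indic.
pose c := (\int[leb]_x (fr x ^+ 2)%:E)%E.
have c0 : (0 <= c)%E by apply: integral_ge0 => x _; rewrite lee_fin sqr_ge0.
have cfin : (c < +oo)%E.
  have /integrableP[_] := L2_sqr_integrable f2; apply: le_lt_trans.
  rewrite [leRHS]integral_mkcond le_eqVlt; apply/orP; left; apply/eqP.
  apply: eq_integral => x _; rewrite /fr !patchE; case: ifPn => _; last by rewrite expr0n.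
  by rewrite /= ger0_norm ?sqr_ge0.
have mA : measurable_fun setT (fun tau => \int[leb]_x (strip T u tau x ^+ 2)%:E)%E.
  apply: (@measurable_fun_fubini_tonelli_F _ _ _ _ _ leb (fun p : R * R => (strip T u p.1 p.2 ^+ 2)%:E)) => //=.
    by apply/measurable_EFinP; exact: measurable_funX.
  by move=> p; rewrite lee_fin sqr_ge0.
have Gfin : (\int[leb]_tau \int[leb]_x `|G tau x|%:E < +oo)%E.
  apply: (@le_lt_trans _ _ (\int[leb]_tau (\int[leb]_x (strip T u tau x ^+ 2)%:E + (k tau)%:E * c))%E).
    apply: ge0_le_integral => //=.
    - by move=> tau _; apply: integral_ge0 => x _; rewrite lee_fin.
    - apply: (@measurable_fun_fubini_tonelli_F _ _ _ _ _ leb (fun p : R * R => `|G p.1 p.2|%:E)) => //=.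
      by apply/measurable_EFinP; exact: measurableT_comp.
    - by apply: emeasurable_funD => //; apply: emeasurable_funM => //; apply/measurable_EFinP.
    move=> tau _.
    have mtau : measurable_fun setT (strip T u tau).
      exact: (measurableT_comp mS (measurable_pair1 tau)).
    have mf2 : measurable_fun setT (fun x => (fr x ^+ 2)%:E).
      by apply/measurable_EFinP; exact: measurable_funX.
    rewrite /c -ge0_integralZl//=; last 2 first.
    - by move=> x _; rewrite lee_fin sqr_ge0.
    - by rewrite lee_fin.
    rewrite -ge0_integralD//=; last 4 first.
    - by move=> x _; rewrite lee_fin sqr_ge0.
    - by apply/measurable_EFinP; exact: measurable_funX.
    - by move=> x _; rewrite -EFinM lee_fin mulr_ge0 ?sqr_ge0.
    - exact: measurable_funeM.
    apply: ge0_le_integral => //=.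
    - apply/measurable_EFinP; apply: measurableT_comp => //.
      exact: (measurableT_comp mG (measurable_pair1 tau)).
    - apply: emeasurable_funD; last exact: measurable_funeM.
      by apply/measurable_EFinP; exact: measurable_funX.
    move=> x _; rewrite -EFinM -EFinD lee_fin /G; case: ifPn => [/andP[st1 st2]|_]; last first.
      by rewrite normr0; exact: (addr_ge0 (sqr_ge0 _) (mulr_ge0 (k0 tau) (sqr_ge0 _))).
    rewrite kE ?(le_lt_trans s0 st1) ?(lt_le_trans st2 tT)// mul1r ler_norml.
    by have := sqr_ge0 (strip T u tau x - fr x); have := sqr_ge0 (strip T u tau x + fr x);
      have := sqr_ge0 (strip T u tau x); have := sqr_ge0 (fr x);
      move=> *; apply/andP; split; nra.
  rewrite ge0_integralD//=; last 3 first.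
  - by move=> tau _; apply: integral_ge0 => x _; rewrite lee_fin sqr_ge0.
  - by move=> tau _; rewrite mule_ge0// lee_fin.
  - by apply: emeasurable_funM => //; apply/measurable_EFinP.
  rewrite lte_add_pinfty// ge0_integralZr//=; last 2 first.
  - by apply/measurable_EFinP.
  - by move=> tau _; rewrite lee_fin.
  rewrite lte_mul_pinfty//.
  - by apply: integral_ge0 => tau _; rewrite lee_fin.
  - by rewrite ge0_fin_numE//; apply: integral_ge0 => tau _; rewrite lee_fin.
have [i1 i2] := Rintegral_section_integrable mG Gfin.
have GE tau x : s < tau < t -> 0 < x < 1 -> G tau x = u tau x * f x.
  move=> st x01; have /andP[st1 st2] := st.
  by rewrite /G st /strip (le_lt_trans s0 st1) (lt_le_trans st2 tT) x01/= /fr patchE mem_set.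
have G0 tau x : ~ (s < tau < t) \/ ~ (0 < x < 1) -> G tau x = 0.
  rewrite /G => -[/negP/negbTE ->//|/negP/negbTE H]; case: ifP => // _.
  by rewrite /strip H andbF mul0r.
have Ex tau : s < tau < t -> \int[leb]_x G tau x = ip (u tau) f.
  move=> st; rewrite (@Rintegral_support _ I01); last first.
    by move=> x /= H; apply: G0; right; rewrite in_itv in H.
  apply: eq_Rintegral => x; rewrite inE/= in_itv/= => x01; exact: GE.
have Et x : 0 < x < 1 -> \int[leb]_tau G tau x = itg s t (fun tau => u tau x * f x).
  move=> x01; rewrite (@Rintegral_support _ `]s, t[%classic); last first.
    by move=> tau /= H; apply: G0; left; rewrite in_itv in H.
  by apply: eq_Rintegral => tau; rewrite inE/= in_itv/= => st; exact: GE.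
have E0 tau : ~ (s < tau < t) -> \int[leb]_x G tau x = 0.
  move=> H; rewrite (@Rintegral_support _ set0) ?Rintegral_set0// => x _; apply: G0; by left.
have E0' x : ~ (0 < x < 1) -> \int[leb]_tau G tau x = 0.
  move=> H; rewrite (@Rintegral_support _ set0) ?Rintegral_set0// => tau _; apply: G0; by right.
have E1 : \int[leb]_tau (\int[leb]_x G tau x) = itg s t (fun tau => ip (u tau) f).
  rewrite (@Rintegral_support _ `]s, t[%classic); last first.
    by move=> tau /= H; apply: E0; rewrite in_itv in H.
  by apply: eq_Rintegral => tau; rewrite inE/= in_itv/=; exact: Ex.
have E2 : \int[leb]_x (\int[leb]_tau G tau x) =
    \int[leb]_(x in I01) itg s t (fun tau => u tau x * f x).
  rewrite (@Rintegral_support _ I01); last first.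
    by move=> x /= H; apply: E0'; rewrite in_itv in H.
  by apply: eq_Rintegral => x; rewrite inE/= in_itv/=; exact: Et.
split.
- have : leb.-integrable `]s, t[ (EFin \o (fun tau => \int[leb]_x G tau x)) by exact: integrable_subT.
  by apply: eq_integrable => // tau; rewrite inE/= in_itv/= => st; rewrite Ex.
- have : leb.-integrable I01 (EFin \o (fun x => \int[leb]_tau G tau x)) by exact: integrable_subT.
  by apply: eq_integrable => // x; rewrite inE/= in_itv/= => x01; rewrite Et.
- by rewrite -E1 -E2; exact: Rintegral_Fubini.
- have mE : measurable_fun [set: R * R] (EFin \o (fun p => G p.1 p.2)) by exact/measurable_EFinP.
  have iF : (leb \x leb)%E.-integrable setT (EFin \o (fun p => G p.1 p.2)).
    exact/(integrable12ltyP leb leb mE).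
  apply: filterS (ae_integrable2 iF) => x /= ix x01.
  have : leb.-integrable `]s, t[ (EFin \o (G^~ x)) by exact: integrable_subT.
  by apply: eq_integrable => // tau; rewrite inE/= in_itv/= => st; rewrite GE.
Qed.

(** [f x] leaves the time integral at those x where u(., x) is integrable in time; they have full
    measure by the raw version with f = 1. *)
Lemma L2L2_Fubini T u s t : L2L2 T u -> 0 <= s -> t <= T ->
  leb.-integrable I01 (EFin \o (fun x => itg s t (u^~ x))) /\
  forall f, L2 f ->
  [/\ leb.-integrable `]s, t[ (EFin \o (fun tau => ip (u tau) f)),
      leb.-integrable I01 (EFin \o (fun x => itg s t (u^~ x) * f x)) &
      itg s t (fun tau => ip (u tau) f) = ip (fun x => itg s t (u^~ x)) f].
Proof.
move=> uL s0 tT.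
have E1 x : itg s t (fun tau => u tau x * (cst 1 : R -> R) x) = itg s t (u^~ x).
  by apply: eq_Rintegral => tau _; rewrite mulr1.
have [_ i1 _ ae1] := L2L2_Fubini_raw uL (L2_cst 1) s0 tT.
have iU : leb.-integrable I01 (EFin \o (fun x => itg s t (u^~ x))).
  by apply: eq_integrable i1 => // x _ /=; rewrite E1.
split => // f f2; have [j1 j2 j3 _] := L2L2_Fubini_raw uL f2 s0 tT.
have aeE : ae_eq leb I01 (fun x => itg s t (fun tau => u tau x * f x)) (fun x => itg s t (u^~ x) * f x).
  apply: filterS ae1; first exact: (ae_filter_ringOfSetsType leb).
  move=> x H; rewrite /= in_itv/= => x01.
  rewrite /itg RintegralZr//; apply: eq_integrable (H x01) => // tau _ /=.
  by rewrite mulr1.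
have mU : measurable_fun I01 (fun x => itg s t (u^~ x)) by move/integrableP : iU => [/measurable_EFinP].
have mUf : measurable_fun I01 (fun x => itg s t (u^~ x) * f x).
  by apply: measurable_funM => //; exact: L2_measurable.
have mj : measurable_fun I01 (fun x => itg s t (fun tau => u tau x * f x)).
  by move/integrableP : j2 => [/measurable_EFinP].
split => //.
- apply/integrableP; split; first exact/measurable_EFinP.
  have /integrableP[_] := j2; apply: le_lt_trans.
  rewrite le_eqVlt; apply/orP; left; apply/eqP; apply: ae_eq_integral => //.
  + by apply: measurableT_comp => //; exact/measurable_EFinP.
  + by apply: measurableT_comp => //; exact/measurable_EFinP.
  + by apply: filterS aeE => x H Ix /=; rewrite H.
- by rewrite j3; apply: ae01_Rintegral.
Qed.

End JointlyIntegrable.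

Local Instance ae_leb_filter (R : realType) :
  Filter (nbhs (almost_everywhere (@lebesgue_measure R))) :=
  ae_filter_ringOfSetsType _.

(** * Increments of w in time, paired with L^2 functions *)

Section TimeIncrements.
Context {R : realType}.
Local Notation leb := (@lebesgue_measure R).
Local Notation h1 := (h1 (R := R)).
Implicit Types (phi f g : R -> R) (s t T x tau : R).

(** [g] is replaced by its truncation to [m - K, m + K], which equals it almost everywhere and is
    bounded everywhere, so that pointwise comparison applies. *)
Lemma ae_itg_le g a b (m K : R) : leb.-integrable `]a, b[ (EFin \o g) -> a <= b -> 0 <= K ->
  {ae leb, forall tau, a < tau < b -> `|g tau - m| <= K} ->
  `|itg a b g - m * (b - a)| <= K * (b - a).
Proof.
move=> ig ab K0 ae.
have mg : measurable_fun `]a, b[ g by move/integrableP : ig => [/measurable_EFinP].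
pose g' tau := Num.max (m - K) (Num.min (g tau) (m + K)).
have mg' : measurable_fun `]a, b[ g'.
  by apply: measurable_maxr => //; apply: measurable_minr.
have gl tau : m - K <= g' tau by rewrite le_max lexx.
have gr tau : g' tau <= m + K by rewrite ge_max ge_min lexx orbT andbT; lra.
have ig' : leb.-integrable `]a, b[ (EFin \o g').
  apply: (bounded_integrable_itv (K := `|m| + K)) => // tau; rewrite ler_norml.
  have := gl tau; have := gr tau; have := ler_norm m; have := ler_norm (- m); rewrite normrN.
  by move=> *; apply/andP; split; lra.
have -> : itg a b g = itg a b g'.
  rewrite /itg /Rintegral; congr fine; apply: ae_eq_integral => //.
  - exact/measurable_EFinP.
  - exact/measurable_EFinP.
  apply: filterS ae.
  move=> tau H; rewrite /= in_itv/= => /H; rewrite ler_norml => /andP[h1 h2].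
  rewrite /g' (min_idPl _); last by lra.
  by rewrite (max_idPr _)//; lra.
have ic c : leb.-integrable `]a, b[ (EFin \o (cst c : R -> R)).
  by apply: (bounded_integrable_itv (K := `|c|)) => //.
have h1 := le_itg (ic (m - K)) ig' (fun tau _ => gl tau).
have h2 := le_itg ig' (ic (m + K)) (fun tau _ => gr tau).
by move: h1 h2; rewrite !itg_cst// ler_norml => h1 h2; apply/andP; split; lra.
Qed.

Variables (mu nu wd : R) (c : 'I_2 -> R).
Hypotheses (hmu : 0 < mu).
Variables (w0 : R -> R) (w wt : R -> R -> R).
Hypothesis ws : weak_solution mu nu wd c w0 w wt.
Hypothesis wr : regular_solution mu w wt.

Lemma w_h1 t : 0 <= t -> w t \in h1_pred.
Proof. by move=> t0; apply/h1_predP; exact: (weak_solution_H1 ws). Qed.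

Lemma w_h1E t : 0 <= t -> h1_val (to_h1 (w t)) = w t.
Proof. by move=> t0; apply: insubdK; exact: w_h1. Qed.

Lemma w_L2 t : 0 <= t -> L2 (w t).
Proof. by move=> t0; rewrite -w_h1E//; exact: h1_L2. Qed.

(** [wD (wt tau)] is chosen separately at each time, with no information on measurability in tau;
    [ux] is a jointly measurable substitute that can enter Fubini. *)
Lemma wt_ae T : 0 < T -> exists ux, L2L2 T ux /\
  {ae leb, forall tau, 0 < tau < T -> prim (wt tau) (ux tau)}.
Proof.
move=> T0; have [_ [ux W uxL]] := weak_solution_L2H1 ws T0; exists ux; split => //.
have [aeL _] := strip_L2 uxL.
apply: filterS3 W aeL (weak_solution_wt_cont ws) => tau W L C /andP[t0 tT].
by apply: weak_deriv_prim; [exact: C|apply: L; rewrite t0|apply: W; rewrite in_itv/= t0].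
Qed.

Lemma wt_bound : exists2 K, 0 <= K & {ae leb, forall tau, 0 < tau ->
  ip (wt tau) (wt tau) <= K /\ ip (wD (wt tau)) (wD (wt tau)) <= K}.
Proof.
have [C H] := regular_bound wr.
exists (`|C| * (1 + mu^-1)); first by rewrite mulr_ge0// addr_ge0// invr_ge0 ltW.
apply: filterS H => tau H t0; have {H} := H t0.
have I0 : (0 <= \int[leb]_(s in `]0%R, tau[)
        (Hnorm 1 (wt s) ^+ 2 + mu * L2norm (wD (wD (wt s))) ^+ 2)%:E)%E.
  apply: integral_ge0 => s _; rewrite lee_fin addr_ge0 ?sqr_ge0//.
  by rewrite mulr_ge0 ?sqr_ge0// ltW.
move=> H; have := le_trans (leeDl _ I0) H.
rewrite lee_fin; have := sqr_ge0 (Hnorm 2 (w tau)); set y := _ ^+ 2; move: y => y.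
rewrite /L2norm !sqr_sqrtr ?ip_ge0//; have := ip_ge0 (wt tau).
have := ip_ge0 (wD (wt tau)); have Cn := ler_norm C; have C0 := normr_ge0 C.
set a := ip (wt tau) _; set b := ip (wD _) _; move=> b0 a0 y0 Hs.
have i0 : 0 <= mu^-1 by rewrite invr_ge0 ltW.
have p0 := mulr_ge0 C0 i0; rewrite mulrDr mulr1.
have mb := mulr_ge0 (ltW hmu) b0.
split; first by lra.
suff : b <= `|C| * mu^-1 by lra.
rewrite ler_pdivlMr// mulrC; lra.
Qed.

Lemma w_L2_continuous t : 0 <= t -> forall eps, 0 < eps -> exists2 del, 0 < del &
  forall s, 0 <= s -> `|s - t| < del -> L2norm (w s \- w t) <= eps.
Proof.
move=> t0 eps e0; have /cvgrPdist_le /(_ _ e0) := weak_solution_continuous ws t0.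
rewrite near_withinE => /nbhs_ballP[del /= d0 H]; exists del => // s s0 st.
have := H s; rewrite /ball/= distrC => /(_ st); rewrite in_itv/= s0 => /(_ isT).
by rewrite sub0r normrN; apply: le_trans; exact: ler_norm.
Qed.

Lemma ip_w_continuous phi t : L2 phi -> 0 <= t -> forall eps, 0 < eps -> exists2 del, 0 < del &
  forall s, 0 <= s -> `|s - t| < del -> `|ip (w s) phi - ip (w t) phi| <= eps.
Proof.
move=> p2 t0 eps e0.
have k0 : 0 < L2norm phi + 1 by rewrite ltr_wpDl// sqrtr_ge0.
have [del d0 H] := w_L2_continuous t0 (divr_gt0 e0 k0).
exists del => // s s0 st; rewrite -ipBl; try by [exact: w_L2|].
rewrite (le_trans (ip_cauchy _ p2))//; first by apply: L2_sub; exact: w_L2.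
have := H s s0 st; rewrite ler_pdivlMr// => {}H.
apply: le_trans H; rewrite ler_wpM2l ?sqrtr_ge0//; lra.
Qed.

Lemma ip_wt_integrable phi s t : L2 phi -> 0 <= s -> leb.-integrable `]s, t[ (EFin \o (fun tau => ip (wt tau) phi)).
Proof.
move=> p2 s0; have T0 : 0 < Num.max t 1 by rewrite lt_max ltr01 orbT.
have [wtL _] := weak_solution_L2H1 ws T0.
have tT : t <= Num.max t 1 by rewrite le_max lexx.
by have [_ /(_ _ p2)[]] := L2L2_Fubini wtL s0 tT.
Qed.

(** The distributional time derivative paired with [phi] is integrated by [du_bois_reymond_pt];
    every positive time is a Lebesgue point because w is continuous into L^2. *)
Lemma ip_w_increment_gt0 phi s t : L2 phi -> 0 < s -> s < t ->
  ip (w t) phi - ip (w s) phi = itg s t (fun tau => ip (wt tau) phi).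
Proof.
move=> p2 s0 st.
pose f tau := ip (w tau) phi.
have fc tau : 0 < tau -> {for tau, continuous f}.
  move=> t0; apply/cvgrPdist_le => eps e0.
  have [del d0 H] := ip_w_continuous p2 (ltW t0) e0.
  near=> x; rewrite distrC; apply: H.
    by near: x; apply: filterS (lt_nbhsr t0) => x /ltW.
  by rewrite distrC; near: x; exact: (nbhsx_ballx tau _ d0).
have h1 : 0 < s / 2 by rewrite divr_gt0.
have h2 : s / 2 < s by rewrite ltr_pdivrMr//; lra.
have h3 : t < t + 1 by lra.
have if' : leb.-integrable `](s / 2), (t + 1)[ (EFin \o f).
  apply: (@integrableS _ _ _ leb `[(s / 2), (t + 1)]) => //; first exact: subset_itv_oo_cc.
  apply: continuous_compact_integrable; first exact: segment_compact.
  apply: continuous_in_subspaceT => x; rewrite inE/= in_itv/= => /andP[sx _].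
  by apply: fc; exact: lt_le_trans sx.
have mf : measurable_fun `](s / 2), (t + 1)[ f by move/integrableP : if' => [/measurable_EFinP].
apply: (du_bois_reymond_pt (weak_solution_deriv ws p2) _ _ h2 st h3) => //.
- by rewrite in_itv/= h1.
- by rewrite in_itv/= andbT; lra.
- by apply: ip_wt_integrable => //; lra.
- apply: (continuous_at_lebesgue_pt h2 _ mf); [lra|exact: fc].
- apply: (continuous_at_lebesgue_pt _ h3 mf); [lra|by apply: fc; lra].
Unshelve. all: by end_near. Qed.

Lemma wt_h1 : {ae leb, forall tau, 0 < tau -> wt tau \in h1_pred}.
Proof.
have H (n : nat) : {ae leb, forall tau, 0 < tau < n%:R + 1 -> wt tau \in h1_pred}.
  have T0 : 0 < n%:R + 1 :> R by rewrite ltr_wpDl.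
  have [ux [_ P]] := wt_ae T0.
  by apply: filterS P => tau P tT; exact: prim_h1 (P tT).
have := @ae_foralln _ _ _ leb _ H; apply: filterS => tau Ht t0.
by apply: (Ht (Num.truncn tau)); rewrite t0/= natr1 truncnS_gt.
Qed.

Lemma ip_wt_bound : exists2 K, 0 <= K & forall phi, L2 phi ->
  {ae leb, forall tau, 0 < tau -> `|ip (wt tau) phi| <= K * L2norm phi}.
Proof.
have [K K0 ae] := wt_bound; exists (Num.sqrt K); first exact: sqrtr_ge0.
move=> phi p2; apply: filterS2 wt_h1 ae => tau P B t0.
have {}P := h1_prim_wD (P t0); have [B0 _] := B t0.
rewrite (le_trans (ip_cauchy (prim_L2 P) p2))// ler_wpM2r ?sqrtr_ge0//.
exact: ler_wsqrtr.
Qed.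

(** Time 0 lies outside the interval of the distributional derivative. It is reached through the L^2
    continuity of [w] and the boundedness of [wt]: both errors over a short interval [0, r] are
    small. *)
Lemma ip_w_increment phi s t : L2 phi -> 0 <= s -> s <= t ->
  ip (w t) phi - ip (w s) phi = itg s t (fun tau => ip (wt tau) phi).
Proof.
move=> p2; rewrite le_eqVlt => /predU1P[<-|s0]; last first.
  rewrite le_eqVlt => /predU1P[<-|st]; first by rewrite subrr itg_ge.
  exact: ip_w_increment_gt0.
rewrite le_eqVlt => /predU1P[<-|t0]; first by rewrite subrr itg_ge.
apply/eqP; rewrite -subr_eq0 -normr_le0; apply/ler_addgt0Pl => eps e0; rewrite addr0.
have [K K0 Kb] := ip_wt_bound; have {}Kb := Kb phi p2.
have e20 : 0 < eps / 2 by rewrite divr_gt0.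
have KL0 : 0 <= K * L2norm phi by rewrite mulr_ge0 ?sqrtr_ge0.
have k1 : 0 < K * L2norm phi + 1 by rewrite ltr_wpDl.
have [del d0 H] := ip_w_continuous p2 (lexx 0) e20.
have [r [r0 [rt [rd re]]]] : exists r, 0 < r /\ r < t /\ r < del /\ r * (K * L2norm phi + 1) <= eps / 2.
  exists (Num.min (t / 2) (Num.min (del / 2) (eps / 2 / (K * L2norm phi + 1)))).
  rewrite !lt_min !divr_gt0//; split => //; split; [|split].
  - by rewrite gt_min; apply/orP; left; lra.
  - by rewrite gt_min; apply/orP; right; rewrite gt_min; apply/orP; left; lra.
  - by rewrite -ler_pdivlMr// !ge_min lexx !orbT.
have E := ip_w_increment_gt0 p2 r0 rt.
have U := itgU_on (ip_wt_integrable t p2 (lexx 0)) (ltW r0) (ltW rt).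
have B : `|itg 0 r (fun tau => ip (wt tau) phi) - 0 * (r - 0)| <= K * L2norm phi * (r - 0).
  apply: ae_itg_le => //; [exact: ip_wt_integrable|exact: ltW|].
  by apply: filterS Kb => tau H' /andP[h _]; rewrite subr0; exact: H'.
have Hs : `|ip (w r) phi - ip (w 0) phi| <= eps / 2.
  by apply: H; [exact: ltW|rewrite subr0 gtr0_norm].
rewrite mul0r !subr0 in B.
have -> : ip (w t) phi - ip (w 0) phi - itg 0 t (fun tau => ip (wt tau) phi) =
    (ip (w r) phi - ip (w 0) phi) - itg 0 r (fun tau => ip (wt tau) phi).
  rewrite U -E; ring.
rewrite (le_trans (ler_normB _ _))//; lra.
Qed.

End TimeIncrements.

(** * Lipschitz dependence of the forms on the state *)

Section LipschitzForms.
Context {R : realType} {V : lmodType R} (M : h1_model V) (Q : bbm_params R).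
Local Notation N := (snorm (trip M)).

Let cube_sub (a b n z : R) : `|a| <= n -> `|b| <= n -> `|a - b| <= z ->
  `|a ^+ 3 - b ^+ 3| <= 3 * n ^+ 2 * z.
Proof.
move=> an bn abz; have n0 : 0 <= n := le_trans (normr_ge0 _) an.
have -> : a ^+ 3 - b ^+ 3 = (a ^+ 2 + a * b + b ^+ 2) * (a - b) by ring.
rewrite normrM ler_pM//.
rewrite (le_trans (ler_normD _ _))// (le_trans (lerD (ler_normD _ _) (lexx _)))//.
rewrite !normrX normrM.
have := ler_pM (normr_ge0 _) (normr_ge0 _) an an; have := ler_pM (normr_ge0 _) (normr_ge0 _) bn bn.
by have := ler_pM (normr_ge0 _) (normr_ge0 _) an bn; rewrite -!expr2; lra.
Qed.

(** Together with [fA_lipschitz] this measures the cost of freezing the state over a short time; the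
    nonlinear terms make it a bound on balls. *)
Lemma fB_lipschitz D : exists2 C, 0 <= C & forall u u' v, N u <= D -> N u' <= D ->
  `|fB M Q u v - fB M Q u' v| <= C * N (u - u') * N v.
Proof.
have [C C0 HC] := fBlin_le M Q.
pose b0 := 2 / (9 * pc0 Q); pose b1 := 2 / (9 * pc1 Q).
have b00 : 0 <= b0 by rewrite divr_ge0 ?mulr_ge0 ?(ltW (pc0_gt0 Q)).
have b10 : 0 <= b1 by rewrite divr_ge0 ?mulr_ge0 ?(ltW (pc1_gt0 Q)).
exists (C + 2 * `|D| + 3 * D ^+ 2 * b0 + 3 * D ^+ 2 * b1).
  have c2 : 0 <= 3 * D ^+ 2 by rewrite pmulr_rge0// sqr_ge0.
  by rewrite !addr_ge0 ?(mulr_ge0 c2)// mulr_ge0.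
move=> u u' v uD u'D; set z := u - u'.
have D0 : 0 <= D := le_trans (N_ge0 M u) uD; rewrite (ger0_norm D0).
have -> : fB M Q u v - fB M Q u' v = fBlin M Q z v + (T M z u v + T M u' z v)
  + b0 * ((e0 M u ^+ 3 - e0 M u' ^+ 3) * e0 M v) + b1 * ((e1 M u ^+ 3 - e1 M u' ^+ 3) * e1 M v).
  rewrite /fB /fBlin -/b0 -/b1 /z TBl TBm gBl (semiBl (d_semi M)) e0B e1B; ring.
have z0 := N_ge0 M z; have v0 := N_ge0 M v.
have h1 : `|fBlin M Q z v| <= C * N z * N v by rewrite -mulrA; exact: HC.
have TN a b c : `|T M a b c| <= N a * N b * N c.
  rewrite (le_trans (T_leN M _ _ _))//.
  by rewrite ler_pM ?ler_pM ?mulr_ge0 ?snorm_ge0 ?nd_le ?np_le.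
have h2 : `|T M z u v + T M u' z v| <= 2 * D * N z * N v.
  rewrite (le_trans (ler_normD _ _))//.
  have := TN z u v; have := TN u' z v.
  have := ler_wpM2l (mulr_ge0 z0 v0) uD; have := ler_wpM2l (mulr_ge0 z0 v0) u'D; lra.
have h3 : `|(e0 M u ^+ 3 - e0 M u' ^+ 3) * e0 M v| <= 3 * D ^+ 2 * N z * N v.
  rewrite normrM ler_pM ?e0_le// cube_sub ?(le_trans (e0_le M _))//.
  by rewrite -e0B e0_le.
have h4 : `|(e1 M u ^+ 3 - e1 M u' ^+ 3) * e1 M v| <= 3 * D ^+ 2 * N z * N v.
  rewrite normrM ler_pM ?e1_le// cube_sub ?(le_trans (e1_le M _))//.
  by rewrite -e1B e1_le.
have absM (a x y : R) : 0 <= a -> `|x| <= y -> `|a * x| <= a * y.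
  by move=> a0 xy; rewrite normrM ger0_norm// ler_wpM2l.
have {}h3 := absM _ _ _ b00 h3; have {}h4 := absM _ _ _ b10 h4.
rewrite (le_trans (ler_normD _ _))// (le_trans (lerD (ler_normD _ _) (lexx _)))//.
rewrite (le_trans (lerD (lerD (ler_normD _ _) (lexx _)) (lexx _)))//.
lra.
Qed.

Lemma fA_lipschitz D : exists2 C, 0 <= C & forall u u' z v, N u <= D -> N u' <= D ->
  `|fA M Q u z v - fA M Q u' z v| <= C * N (u - u') * N z * N v.
Proof.
pose b0 := pmu Q / pnu Q * (2 / (3 * pc0 Q)); pose b1 := pmu Q / pnu Q * (2 / (3 * pc1 Q)).
have mn0 : 0 <= pmu Q / pnu Q by rewrite divr_ge0 ?(ltW (pmu_gt0 Q)) ?(ltW (pnu_gt0 Q)).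
have b00 : 0 <= b0 by apply: (mulr_ge0 mn0); rewrite divr_ge0 ?mulr_ge0 ?(ltW (pc0_gt0 Q)).
have b10 : 0 <= b1 by apply: (mulr_ge0 mn0); rewrite divr_ge0 ?mulr_ge0 ?(ltW (pc1_gt0 Q)).
have nn : 0 <= 2 * `|D| by exact: mulr_ge0.
exists (2 * `|D| * b0 + 2 * `|D| * b1).
  exact: (addr_ge0 (mulr_ge0 nn b00) (mulr_ge0 nn b10)).
move=> u u' z v uD u'D; set y := u - u'.
have D0 : 0 <= D := le_trans (N_ge0 M u) uD; rewrite (ger0_norm D0).
have -> : fA M Q u z v - fA M Q u' z v =
    b0 * ((e0 M u + e0 M u') * e0 M y * e0 M z * e0 M v) + b1 * ((e1 M u + e1 M u') * e1 M y * e1 M z * e1 M v).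
  by rewrite /fA /y e0B e1B /b0 /b1; ring.
have key (a a' x x' x'' : R) : `|a| <= D -> `|a'| <= D -> `|x| <= N y -> `|x'| <= N z -> `|x''| <= N v ->
    `|(a + a') * x * x' * x''| <= 2 * D * N y * N z * N v.
  move=> h1 h2 h3 h4 h5; rewrite !normrM !ler_pM ?mulr_ge0//.
  by rewrite (le_trans (ler_normD _ _))//; lra.
have h0 := key _ _ _ _ _ (le_trans (e0_le M u) uD) (le_trans (e0_le M u') u'D) (e0_le M y) (e0_le M z) (e0_le M v).
have h1 := key _ _ _ _ _ (le_trans (e1_le M u) uD) (le_trans (e1_le M u') u'D) (e1_le M y) (e1_le M z) (e1_le M v).
have absM (a x x' : R) : 0 <= a -> `|x| <= x' -> `|a * x| <= a * x'.
  by move=> a0 xy; rewrite normrM ger0_norm// ler_wpM2l.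
have {}h0 := absM _ _ _ b00 h0; have {}h1 := absM _ _ _ b10 h1.
rewrite (le_trans (ler_normD _ _))//; lra.
Qed.

End LipschitzForms.

Section EndpointValues.
Context {R : realType}.
Local Notation h1 := (h1 (R := R)).

Let prim_one : prim (cst 1 : R -> R) (cst 0).
Proof. by split; [exact: L2_cst|move=> x /andP[x0 _]; rewrite itg_cst// mul0r addr0]. Qed.

Let prim_id : prim (fun x : R => x) (cst 1).
Proof.
by split; [exact: L2_cst|move=> x /andP[x0 _]; rewrite itg_cst// mul1r add0r subr0].
Qed.

(* Turns endpoint values, which are not L^2 continuous, into L^2 products, for which
   increments in time are integrals. *)
Lemma endpoint_values (z : h1) :
  z 1 = ip (wD z) (fun x => x) + ip z (cst 1) /\ z 0 = z 1 - ip (wD z) (cst 1).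
Proof.
pose o := H1fun (prim_h1 prim_one); pose i := H1fun (prim_h1 prim_id).
have io : ip (wD o) z = 0.
  rewrite (ae01_ip (h1_wD_L2 o) (L2_cst 0) (h1_L2 z) (prim_wD_ae prim_one)).
  rewrite -[RHS](mul0r (ip (cst 0) z)) -(ipZl 0 (L2_cst 0) (h1_L2 z)).
  by apply: eq_Rintegral => x _ /=; rewrite !mul0r.
have ii : ip (wD i) z = ip z (cst 1).
  by rewrite (ae01_ip (h1_wD_L2 i) (L2_cst 1) (h1_L2 z) (prim_wD_ae prim_id)) ipC.
have := ip_parts z o; have := ip_parts z i; rewrite io ii /=.
rewrite !mulr1 mulr0 subr0 addr0 => E1 E0; split; first by rewrite E1.
by rewrite E0; ring.
Qed.

End EndpointValues.

(** * The weak solution as a Lipschitz evolution in H^1 *)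

Section TimeEvolution.
Context {R : realType}.
Local Notation leb := (@lebesgue_measure R).
Local Notation I01 := (`]0%R, 1%R[%classic : set R).
Local Notation h1 := (h1 (R := R)).
Local Notation M := (@h1_model_of R).
Local Notation N := (snorm (trip M)).
Implicit Types (phi f g : R -> R) (s t T x tau : R).

Lemma test_function_L2 (psi : R -> R) : test_function `]0%R, 1%R[ psi -> L2 psi /\ L2 (psi^`()%classic).
Proof.
move=> [dpsi cpsi _]; split; apply: cont01_L2; apply: continuous_subspaceT => //.
by move=> x; apply: differentiable_continuous; apply/derivable1_diffP; exact: dpsi.
Qed.

Variables (mu nu wd : R) (c : 'I_2 -> R).
Hypotheses (hmu : 0 < mu) (hnu : 0 < nu) (hwd : 0 <= wd) (hc : forall i, 0 < c i).
Variables (w0 : R -> R) (w wt : R -> R -> R).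
Hypothesis ws : weak_solution mu nu wd c w0 w wt.
Hypothesis wr : regular_solution mu w wt.
Local Notation Q := (params hmu hnu hwd hc).

Let wH t : h1 := to_h1 (w t).
Let wHE t : 0 <= t -> h1_val (wH t) = w t. Proof. exact: (w_h1E ws). Qed.

Lemma ip_w_sub phi s t : L2 phi -> 0 <= s -> s <= t ->
  ip (wH t - wH s) phi = itg s t (fun tau => ip (wt tau) phi).
Proof.
move=> p2 s0 st; rewrite -(ip_w_increment hmu ws wr p2 s0 st).
rewrite -ipBl//; try by apply: (w_L2 ws); rewrite ?(le_trans s0).
by rewrite h1_subE !wHE// (le_trans s0 st).
Qed.

(** Differentiation in x commutes with the time integral: by Fubini the time integral [U] of [ux] is
    a weak derivative of the increment. *)
Lemma ip_wD_w_sub T ux f s t : L2L2 T ux ->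
  {ae leb, forall tau, 0 < tau < T -> prim (wt tau) (ux tau)} ->
  L2 f -> 0 <= s -> s <= t -> t <= T ->
  ip (wD (wH t - wH s)) f = itg s t (fun tau => ip (ux tau) f).
Proof.
move=> uxL P f2 s0 st tT; set z := wH t - wH s.
have [iU FU] := L2L2_Fubini uxL s0 tT.
set U := (fun x => itg s t (ux^~ x)) in iU FU.
have W : weak_deriv `]0, 1[ z U.
  move=> psi tpsi; have [p2 dp2] := test_function_L2 tpsi.
  have [i1 _ E1] := FU _ p2; have i2 := ip_wt_integrable ws t dp2 s0.
  apply/eqP; rewrite -subr_eq0 opprK; apply/eqP.
  transitivity (ip z (psi^`()%classic) + ip U psi); first by [].
  rewrite ip_w_sub// -E1 -RintegralD//.
  apply/eqP; rewrite -normr_le0.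
  have i12 : leb.-integrable `]s, t[ (EFin \o (fun tau => ip (wt tau) (psi^`()%classic) + ip (ux tau) psi)).
    have H : leb.-integrable `]s, t[ (fun tau => (ip (wt tau) (psi^`()%classic))%:E + (ip (ux tau) psi)%:E)%E.
      exact: integrableD.
    by apply: eq_integrable H.
  have := ae_itg_le (m := 0) i12 st (lexx 0); rewrite !mul0r subr0; apply.
  apply: filterS P => tau H /andP[h1 h2]; rewrite subr0.
  have {}H : prim (wt tau) (ux tau) by apply: H; rewrite (le_lt_trans s0 h1) (lt_le_trans h2 tT).
  have -> : ip (wt tau) (psi^`()%classic) = - ip (ux tau) psi by exact: (prim_weak_deriv H tpsi).
  by rewrite addNr normr0.
have zp := h1_prim z.
(* [U] is known to be integrable but not to be in L^2, so [weak_deriv_prim] does not apply. Instead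
   its integrals over interior intervals are compared with those of [wD z], which identifies the two
   almost everywhere. *)
have key a b : 0 < a -> a < b -> b < 1 -> itg a b (wD z) = itg a b U.
  move=> a0 ab b1; rewrite -(prim_sub zp (ltW a0) (ltW ab) (ltW b1)).
  have ic0 : a / 2 \in `]0%R, 1%R[ by rewrite in_itv/=; lra.
  have id1 : (b + 1) / 2 \in `]0%R, 1%R[ by rewrite in_itv/=; lra.
  have mz : measurable_fun `](a / 2), ((b + 1) / 2)[ z.
    have := h1_measurable z; apply: measurable_funS => //.
    by move=> x /=; rewrite !in_itv/=; lra.
  have cz := prim_cont zp.
  apply: (du_bois_reymond_pt W ic0 id1); try lra.
  - by apply: L2_integrable_itv (h1_L2 z); lra.
  - by apply: integrableS iU => // x /=; rewrite !in_itv/=; lra.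
  - by apply: (continuous_at_lebesgue_pt _ _ mz); [lra|lra|apply: cont01_at => //; lra].
  - by apply: (continuous_at_lebesgue_pt _ _ mz); [lra|lra|apply: cont01_at => //; lra].
pose h x := wD z x - U x.
have iz := L2_integrable (h1_wD_L2 z).
have sub a b : 0 <= a -> b <= 1 -> `]a, b[ `<=` I01.
  move=> a0 b1 x /=; rewrite !in_itv/= => /andP[ax xb].
  by rewrite (le_lt_trans a0 ax) (lt_le_trans xb b1).
have ih : leb.-integrable I01 (EFin \o h) by exact: sub_integrable.
have h0 a b : 0 < a -> a < b -> b < 1 -> itg a b h = 0.
  move=> a0 ab b1; rewrite /itg /h RintegralB//.
  - by rewrite -!/(itg _ _ _) key// subrr.
  - by apply: integrableS iz => //; apply: sub; exact: ltW.
  - by apply: integrableS iU => //; apply: sub; exact: ltW.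
have ae : ae01 h (cst 0).
  apply: itg0_ae0 => // x x01.
  have := cont01_constant (@itg_cont01 _ 0 _ ih) _ x01.
  rewrite (itg_ge _ (lexx 0)) !add0r; apply => a b a0 ab b1; rewrite !add0r.
  rewrite [RHS](@itgU_on _ _ 0 a b) ?(ltW a0) ?(ltW ab)//; first by rewrite (h0 a b)// addr0.
  by apply: integrableS ih => //; apply: sub => //; exact: ltW.
have [_ iUf ->] := FU _ f2.
apply: ae01_Rintegral => //.
- by apply: measurable_funM; apply: L2_measurable => //; exact: h1_wD_L2.
- by move/integrableP : iUf => [/measurable_EFinP].
- apply: filterS ae => x H Ix; have := H Ix; rewrite /h /= => /eqP.
  by rewrite subr_eq0 => /eqP ->.
Qed.

(** The functional of the increment is the time integral of the functional of [wt], so an almost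
    everywhere bound on the latter passes to the former. *)
Lemma increment_functional s t phi f (m K : R) : L2 phi -> L2 f -> 0 <= s -> s <= t -> 0 <= K ->
  {ae leb, forall tau, s < tau < t -> `|ip (wt tau) phi + ip (wD (wt tau)) f - m| <= K} ->
  `|ip (wH t - wH s) phi + ip (wD (wH t - wH s)) f - m * (t - s)| <= K * (t - s).
Proof.
move=> p2 f2 s0 st K0 ae.
have T0 : 0 < t + 1 by have := le_trans s0 st; lra.
have tT : t <= t + 1 by rewrite lerDl.
have [ux [uxL P]] := wt_ae ws T0.
rewrite ip_w_sub// (ip_wD_w_sub uxL P f2 s0 st tT).
have [_ /(_ _ f2)[i1 _ _]] := L2L2_Fubini uxL s0 tT.
have i2 := ip_wt_integrable ws t p2 s0.
rewrite -RintegralD//; apply: ae_itg_le => //.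
  have H : leb.-integrable `]s, t[ (fun tau => (ip (wt tau) phi)%:E + (ip (ux tau) f)%:E)%E.
    exact: integrableD.
  by apply: eq_integrable H.
apply: filterS2 P ae => tau P H st'; have {}H := H st'.
have {}P : prim (wt tau) (ux tau).
  by apply: P; case/andP: st' => h1 h2; rewrite (le_lt_trans s0 h1) (lt_trans h2)// ltrDl.
by rewrite -(ae01_ip (proj1 (prim_wD P)) (proj1 P) f2 (prim_wD_ae P)).
Qed.

(** Wide enough to contain both [fA u _ v] and [trip _ v]; the free weights [k0] and [k1] carry the
    endpoint terms. *)
Definition h1_functional (v : h1) (a0 a1 k0 k1 : R) (z : h1) : R :=
  a0 * ip z v + a1 * ip (wD z) (wD v) + k0 * z 0 + k1 * z 1.

Lemma increment_h1_functional s t v a0 a1 k0 k1 (m K : R) : 0 <= s -> s <= t -> 0 <= K ->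
  {ae leb, forall tau, s < tau < t -> `|h1_functional v a0 a1 k0 k1 (to_h1 (wt tau)) - m| <= K} ->
  `|h1_functional v a0 a1 k0 k1 (wH t - wH s) - m * (t - s)| <= K * (t - s).
Proof.
move=> s0 st K0 ae.
have idL2 : L2 (fun x : R => x).
  apply: (@L2_bounded _ _ 1) => // x /andP[x0 x1]; rewrite gtr0_norm//; exact: ltW.
(* By [endpoint_values], k0 z(0) + k1 z(1) = (k0 + k1) ((z_x, x) + (z, 1)) - k0 (z_x, 1). *)
pose phi x := a0 * v x + (k0 + k1) * (cst 1 : R -> R) x.
pose f x := a1 * wD v x + ((k0 + k1) * x + (- k0) * (cst 1 : R -> R) x).
have l1 := L2_cst (1 : R).
have l2 : L2 (fun x => (k0 + k1) * (cst 1 : R -> R) x) by exact: L2_scale.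
have l3 : L2 (fun x => - k0 * (cst 1 : R -> R) x) by exact: L2_scale.
have l4 : L2 (fun x => (k0 + k1) * x) by exact: (L2_scale (k0 + k1) idL2).
have l5 : L2 (fun x => (k0 + k1) * x + (- k0) * (cst 1 : R -> R) x) by exact: L2_add l4 l3.
have p2 : L2 phi by apply: L2_add l2; apply: L2_scale; exact: h1_L2.
have f2 : L2 f by apply: L2_add l5; apply: L2_scale; exact: h1_wD_L2.
have E (z : h1) : h1_functional v a0 a1 k0 k1 z = ip z phi + ip (wD z) f.
  rewrite /h1_functional [ip z phi]ipC [ip (wD z) f]ipC.
  rewrite (ip_lin a0 (h1_L2 v) l2 (h1_L2 z)) (ipZl _ l1 (h1_L2 z)).
  rewrite (ip_lin a1 (h1_wD_L2 v) l5 (h1_wD_L2 z)).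
  rewrite (ip_lin _ idL2 l3 (h1_wD_L2 z)) (ipZl _ l1 (h1_wD_L2 z)).
  have [-> ->] := endpoint_values z.
  have [-> _] := endpoint_values z.
  rewrite (ipC v) (ipC (wD v)) !(ipC (cst 1)) (ipC (fun x => x)); ring.
rewrite E; apply: increment_functional => //.
apply: filterS2 (wt_h1 ws) ae => tau h H st'; have := H st'.
by rewrite E insubdK//; apply: h; case/andP: st' => h1 _; exact: le_lt_trans h1.
Qed.

Lemma wt_N_bound : exists2 K, 0 <= K & {ae leb, forall tau, 0 < tau -> N (to_h1 (wt tau)) <= K}.
Proof.
have [K K0 H] := wt_bound hmu wr.
(* 9 = 4 + 4 + 1: each trace inequality gives 2 (K + K), and the derivative adds K. *)
exists (Num.sqrt (9 * K)); first exact: sqrtr_ge0.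
apply: filterS2 H (wt_h1 ws) => tau H h t0; have [H0 H1] := H t0.
rewrite /snorm ler_wsqrtr//.
have := e0_trace M (to_h1 (wt tau)); have := e1_trace M (to_h1 (wt tau)).
rewrite /trip /= insubdK ?h// -!expr2; lra.
Qed.

(** Duality: along [wt] the functional [trip _ z], with [z] the increment itself, is at most K
    |||z|||, hence |||z|||^2 <= K |||z||| (t - s). *)
Lemma w_lipschitz : exists2 L, 0 <= L & forall s t, 0 <= s -> s <= t ->
  N (wH t - wH s) <= L * (t - s).
Proof.
have [K K0 H] := wt_N_bound; exists K => // s t s0 st; set z := wH t - wH s.
have E (y : h1) : trip M y z = h1_functional z 0 1 (z 0) (z 1) y.
  by rewrite /trip /h1_functional /=; ring.
have z0 := N_ge0 M z; have ts : 0 <= t - s by rewrite subr_ge0.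
have := increment_h1_functional (v := z) (a0 := 0) (a1 := 1) (k0 := z 0) (k1 := z 1)
  (m := 0) (K := K * N z) s0 st (mulr_ge0 K0 z0).
rewrite -E mul0r subr0 => Hz.
have {}Hz : `|trip M z z| <= K * N z * (t - s).
  apply: Hz; apply: filterS H => tau H /andP[h1 _].
  rewrite -E subr0 (le_trans (semi_cauchy (trip_semi M) _ _))// ler_wpM2r//.
  by apply: H; exact: le_lt_trans h1.
rewrite -(sqr_snorm (trip_semi M)) ger0_norm ?sqr_ge0// in Hz.
move: z0; rewrite le_eqVlt => /predU1P[<-|z0]; first exact: mulr_ge0.
rewrite -(ler_pM2r z0); move: Hz; rewrite expr2; lra.
Qed.

Lemma w_curve_continuous : curve_continuous M (fun t => to_h1 (w t)).
Proof.
have [L L0 HL] := w_lipschitz.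
move=> s s0 eps e0; have L1 : 0 < L + 1 by rewrite ltr_wpDl.
exists (eps / (L + 1)); first exact: divr_gt0.
move=> t t0; rewrite ltr_pdivlMr// => H.
have n0 := normr_ge0 (t - s).
suff : N (wH t - wH s) <= L * `|t - s| by rewrite /wH; lra.
have [st|ts] := leP s t; first by rewrite ger0_norm ?subr_ge0//; exact: HL.
rewrite (snormBC (trip_semi M)) distrC gtr0_norm ?subr_gt0//.
by apply: HL => //; exact: ltW.
Qed.

(** The equation holds at almost every tau with the state w(tau). Freezing the state at [s] costs
    O(t - s) by the Lipschitz bounds, hence O((t - s)^2) N v after integration, uniformly in [v]. *)
Lemma w_evolves : evolves M Q (fun=> True) (fun t => to_h1 (w t)).
Proof.
have [L L0 HL] := w_lipschitz; have [K K0 HK] := wt_N_bound.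
move=> s s0 eps e0.
(* [D] bounds |||w||| on [0, s + 1], which is why [t - s < 1] is imposed. *)
pose D := N (wH 0) + L * (s + 1).
have wD' tau : 0 <= tau -> tau <= s + 1 -> N (wH tau) <= D.
  move=> t0 t1; have a1 := HL 0 tau (lexx 0) t0; rewrite subr0 in a1.
  have a2 := snormD (trip_semi M) (wH tau - wH 0) (wH 0); rewrite subrK in a2.
  apply: (le_trans a2); rewrite addrC lerD2l; apply: (le_trans a1).
  exact: (ler_wpM2l L0 t1).
have [Ca Ca0 HA] := fA_lipschitz M Q D; have [Cb Cb0 HB] := fB_lipschitz M Q D.
pose C := Ca * L * K + Cb * L.
have C0 : 0 <= C by rewrite addr_ge0 ?mulr_ge0.
have C1 : 0 < C + 1 by rewrite ltr_wpDl.
exists (Num.min 1 (eps / (C + 1))); first by rewrite lt_min ltr01 divr_gt0.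
move=> t /andP[st]; rewrite -ltrBlDl lt_min => /andP[t1 te] v _.
have ts : 0 < t - s by rewrite subr_gt0.
have v0 := N_ge0 M v.
pose u := wH s.
pose k0 := pmu Q / pnu Q * (pk0 Q + 2 / (3 * pc0 Q) * u 0 ^+ 2) * v 0.
pose k1 := pmu Q / pnu Q * (pk1 Q + 2 / (3 * pc1 Q) * u 1 ^+ 2) * v 1.
have E (z : h1) : fA M Q u z v = h1_functional v 1 (pmu Q) k0 k1 z.
  by rewrite /fA /fb /h1_functional /k0 /k1 /=; ring.
have := increment_h1_functional (v := v) (a0 := 1) (a1 := pmu Q) (k0 := k0) (k1 := k1)
  (m := - fB M Q u v) (K := C * (t - s) * N v) (ltW s0) (ltW st).
rewrite -E mulNr !opprK [fB M Q u v * _]mulrC => H.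
have ts0 := ltW ts.
have {}H : `|fA M Q u (wH t - wH s) v + (t - s) * fB M Q u v| <= C * (t - s) * N v * (t - s).
  apply: H; first by rewrite !mulr_ge0.
  apply: filterS3 HK (weak_solution_eq ws) (wt_h1 ws) => tau HK We h /andP[h1 h2].
  have t0 : 0 < tau by exact: lt_trans h1.
  have {}HK := HK t0; have {}h := h t0.
  have yE : h1_val (to_h1 (wt tau)) = wt tau by exact: insubdK.
  have := We t0 v (elimT (h1_predP _) (h1_valP v)).1 (elimT (h1_predP _) (h1_valP v)).2.
  rewrite -{1}(wHE (ltW t0)) -{1}yE (weak_formE hmu hnu hwd hc).
  set y := to_h1 (wt tau) => W.
  rewrite -E.
  have -> : fA M Q u y v + fB M Q u v = (fA M Q u y v - fA M Q (wH tau) y v) + (fB M Q u v - fB M Q (wH tau) v).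
    by rewrite [RHS]addrACA -opprD W subr0.
  have us : N u <= D by apply: (wD' _ (ltW s0)); rewrite lerDl.
  have ts1 : tau <= s + 1 by apply: ltW; apply: (lt_trans h2); rewrite -ltrBlDl.
  have ut : N (wH tau) <= D := wD' _ (ltW t0) ts1.
  have n1 := HA u (wH tau) y v us ut; have n2 := HB u (wH tau) v us ut.
  have n3 : N (u - wH tau) <= L * (t - s).
    rewrite (snormBC (trip_semi M)) (le_trans (HL _ _ (ltW s0) (ltW h1)))//.
    by rewrite ler_wpM2l// lerD2r ltW.
  have y0 := N_ge0 M y; have d0 := N_ge0 M (u - wH tau).
  have n4 := ler_pM d0 y0 n3 HK.
  have n5 := ler_wpM2r v0 (ler_wpM2l Ca0 n4).
  have n6 := ler_wpM2r v0 (ler_wpM2l Cb0 n3).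
  apply: (le_trans (ler_normD _ _)); apply: (le_trans (lerD n1 n2)).
  rewrite /C; move: n5 n6; clear; move: (N (u - wH tau)) (N y) (N v) => p q r; lra.
apply: (le_trans H).
have Ce : C * (t - s) <= eps.
  move: te; rewrite ltr_pdivlMr// => te; apply: le_trans (ltW te).
  by rewrite mulrC ler_wpM2l// lerDl.
rewrite -[leLHS]mulrA -[leRHS]mulrA [(t - s) * N v]mulrC.
exact: (ler_wpM2r (mulr_ge0 v0 ts0) Ce).
Qed.

End TimeEvolution.

(** * The error estimate *)

Section Conclusion.
Context {R : realType}.
Local Notation leb := (@lebesgue_measure R).
Local Notation I01 := (`]0%R, 1%R[%classic : set R).
Local Notation h1 := (h1 (R := R)).
Local Notation M := (@h1_model_of R).
Local Notation N := (snorm (trip M)).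

(** [q] is the continuous representative of w_0x, which lies in H^1 because w_0 lies in H^2. *)
Lemma H2_initial (w0 : R -> R) (u : h1) : Hm 2 w0 -> ae_eq leb I01 u w0 ->
  ae01 (wD u) (wD w0) /\ exists q : h1, forall v, d M u v = g M v q.
Proof.
move=> H2 E; have [w02 [f W [f2 [f' W' f'2]]]] := H2.
have H1 : Hm 1 w0 by split => //; exists f.
have cu := prim_cont (h1_prim u).
have P (f1 : R -> R) : weak_deriv `]0, 1[ w0 f1 -> L2 f1 -> prim u f1.
  move=> W1 L1; apply: weak_deriv_prim => //; apply: weak_deriv_ae W1.
  - exact: L2_measurable.
  - exact: h1_measurable.
  - by apply: filterS E => x H Ix; rewrite -H.
have [l0 W0] := wDP H1; split; first exact: prim_wD_ae (P _ W0 l0).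
have [q Pq fq] := weak_deriv_prim_ae f2 f'2 W'.
exists (H1fun (prim_h1 Pq)) => v; rewrite /d /g /= [RHS]ipC.
have ae := prim_wD_ae (P _ W f2).
rewrite (ae01_ip (h1_wD_L2 u) f2 (h1_wD_L2 v) ae).
exact: (ae01_ip f2 (prim_L2 Pq) (h1_wD_L2 v) fq).
Qed.

Variables (mu nu wd lam alpha : R) (c : 'I_2 -> R).
Hypotheses (hmu : 0 < mu) (hnu : 0 < nu) (hwd : 0 <= wd) (hc : forall i, 0 < c i).
Local Notation Q := (params hmu hnu hwd hc).

(* Strict, because [p_le] has the constant 3/4 where [max_decay_rate] allows for 1. *)
Lemma admissible_rate_gt : 0 <= alpha <= max_decay_rate mu nu wd c ->
  exists2 r, admissible_rate Q r & alpha < r.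
Proof.
move=> /andP[a0]; rewrite /max_decay_rate -ler_pdivrMl ?invr_gt0// invrK !le_min.
move=> /and4P[].
have k00 : 0 < pk0 Q by apply: ltr_wpDr => //; apply: addr_gt0 => //; exact: hc.
have k10 : 0 < pk1 Q by apply: ltr_wpDr => //; apply: addr_gt0 => //; exact: hc.
have e0 : 1 + c 0 + wd = pk0 Q by rewrite -[pk0 Q]/(c 0 + 1 + wd) (addrC 1).
have e1 : 1 + c 1 + wd = pk1 Q by rewrite -[pk1 Q]/(c 1 + 1 + wd) (addrC 1).
have [k0 E0] : exists k, k = pk0 Q by exists (pk0 Q).
have [k1 E1] : exists k, k = pk1 Q by exists (pk1 Q).
rewrite e0 e1 -E0 -E1; rewrite -E0 in k00; rewrite -E1 in k10.
have pos (k : R) : 0 < k -> 0 < 3 / 4 + mu / nu * k.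
  by move=> kp; rewrite addr_gt0// mulr_gt0// divr_gt0.
rewrite !ler_pdivlMr ?addr_gt0 ?mulr_gt0// => H1 H2 H3 H4.
(* The bound alpha (nu + k mu) <= nu k / 2 becomes strict when nu is lowered to 3/4 nu, except for
   alpha = 0, where positivity of nu k suffices. *)
have key (k : R) : 0 < k -> 2 * alpha * (nu + k * mu) <= nu * k ->
    alpha < k / 2 / (3 / 4 + mu / nu * k).
  move=> kp H; rewrite ltr_pdivlMr ?pos// -(ltr_pM2l hnu).
  have -> : nu * (alpha * (3 / 4 + mu / nu * k)) = alpha * (3 / 4 * nu + mu * k).
    by field; rewrite gt_eqF.
  have := mulr_gt0 hnu kp.
  move: a0; rewrite le_eqVlt => /predU1P[<-|ap]; first by rewrite mul0r; lra.
  have := mulr_gt0 ap hnu; lra.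
(* The largest rate that [admissible_rate] allows. *)
pose r := Num.min (nu / (3 / 4 + mu)) (Num.min (k0 / 2 / (3 / 4 + mu / nu * k0))
  (Num.min (k1 / 2 / (3 / 4 + mu / nu * k1)) (nu / (2 * mu)))).
have ar : alpha < r.
  rewrite !lt_min !key//= !ltr_pdivlMr ?mulr_gt0 ?addr_gt0//.
  have am := mulr_ge0 a0 (ltW hmu).
  move: a0; rewrite le_eqVlt => /predU1P[<-|ap]; first by rewrite !mul0r hnu.
  have an := mulr_gt0 ap hnu; apply/andP; split; lra.
exists r => //; rewrite /admissible_rate -E0 -E1.
have r1 : r <= nu / (3 / 4 + mu) by rewrite /r ge_min lexx.
have r2 : r <= k0 / 2 / (3 / 4 + mu / nu * k0) by rewrite /r !ge_min lexx !orbT.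
have r3 : r <= k1 / 2 / (3 / 4 + mu / nu * k1) by rewrite /r !ge_min lexx !orbT.
have r4 : r <= nu / (2 * mu) by rewrite /r !ge_min lexx !orbT.
split.
- exact: le_trans a0 (ltW ar).
- by rewrite -ler_pdivlMr// addr_gt0.
- by rewrite -ler_pdivlMr// pos.
- by rewrite -ler_pdivlMr// pos.
- have -> : 2 * r * (pmu Q / pnu Q) = r * (2 * mu) / nu by rewrite /=; ring.
  by rewrite ler_pdivrMr// mul1r -ler_pdivlMr// mulr_gt0.
Qed.

Lemma triple_normE (z : h1) : triple_norm z = N z.
Proof. by rewrite /triple_norm /snorm /trip /= /L2norm sqr_sqrtr ?ip_ge0// -!expr2. Qed.

Lemma Hnorm0E (z : h1) : Hnorm 0 z = snorm (p M) z.
Proof. by rewrite /Hnorm big_ord_recl big_ord0 addr0 /= sqrtr_sqr ger0_norm ?sqrtr_ge0. Qed.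

(** The L^2 norms of z and of z_x are each at most |||z|||, so the case r = 1 of the estimate
    reduces to the triple norm. *)
Lemma Hnorm1_le (z : h1) : Hnorm 1 z <= 2 * N z.
Proof.
rewrite /Hnorm !big_ord_recl big_ord0 addr0 /=.
have := np_le M z; have := nd_le M z; have n0 := N_ge0 M z.
rewrite -[L2norm z]/(snorm (p M) z) -[L2norm (wD z)]/(snorm (d M) z).
have := snorm_ge0 (p M) z; have := snorm_ge0 (d M) z.
move: (snorm (p M) z) (snorm (d M) z) (N z) n0 => a b n n0 b0 a0 bn an.
rewrite -[2 * n]ger0_norm ?mulr_ge0// -sqrtr_sqr ler_wsqrtr//; nra.
Qed.

End Conclusion.

Theorem theorem3p1 (R : realType) (mu nu wd lam alpha : R) (c : 'I_2 -> R)
    (w0 : R -> R) (w wt : R -> R -> R)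
    (hmu : 0 < mu) (hnu : 0 < nu) (hwd : 0 <= wd)
    (hc : forall i, 0 < c i) (hlam : 0 < lam)
    (halpha : 0 <= alpha <= max_decay_rate mu nu wd c)
    (hw0 : Hm 2 w0)
    (hw : weak_solution mu nu wd c w0 w wt)
    (hreg : regular_solution mu w wt) :
  exists K : R, forall (s : seq R) (wh : R -> R -> R),
    itv_partition 0 1 s ->
    semidiscrete_solution mu nu wd c lam s w0 wh ->
    forall t : R, 0 <= t ->
      (forall r : nat, (r <= 1)%N ->
        Hnorm r (w t \- wh t)
          <= K * ((Num.sqrt mu)^-1 * mesh_size s ^+ (2 - r)
                  * expR (- (alpha * t)))) /\
      triple_norm (w t \- wh t) <= K * (mesh_size s * expR (- (alpha * t))).
Proof.
have [r adm ar] := admissible_rate_gt hmu hnu hwd hc halpha.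
have a0 : 0 <= alpha by case/andP: halpha.
pose u := to_h1 (w 0); have uE : h1_val u = w 0 by apply: (w_h1E hw).
have [wDu [q Hq]] : ae01 (wD u) (wD w0) /\ exists q : h1, forall v, d h1_model_of u v = g h1_model_of v q.
  by apply: H2_initial => //; rewrite uE; exact: (weak_solution_init hw).
have [K K0 HK] := galerkin_error (w_curve_continuous hmu hw hreg)
  (w_evolves hmu hnu hwd hc hw hreg) Hq adm hlam a0 ar.
have sm : 0 < Num.sqrt mu by rewrite sqrtr_gt0.
(* The factor [Num.sqrt mu] compensates 1/sqrt(mu) in the claim, the 2 comes from [Hnorm1_le], and
   the last [K] serves the triple norm. *)
exists (2 * K * Num.sqrt mu + K) => s wh sP Hwh t t0.
have Xwh tau : 0 <= tau -> fe_space s (to_h1 (wh tau)).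
  by move=> tau0; rewrite (to_h1E sP); exact: (semidiscrete_fe Hwh).
(* The projection equation speaks of [w0]; it is transferred to the continuous representative [u]
   through almost everywhere equality of values and of derivatives. *)
have init (chi : h1) : fe_space s chi ->
    d h1_model_of (u - to_h1 (wh 0)) chi + lam * p h1_model_of (u - to_h1 (wh 0)) chi = 0.
  move=> Hchi; have [fe0 /(_ _ Hchi)] := semidiscrete_init Hwh.
  have v0E : h1_val (to_h1 (wh 0)) = wh 0 by exact: (to_h1E sP).
  set v0 := to_h1 (wh 0) in v0E *; rewrite -v0E.
  have [w02 _] := hw0.
  have H1 : Hm 1 w0 by have [? [f ? [? _]]] := hw0; split => //; exists f.
  have [l0 _] := wDP H1.
  have uw : ae01 u w0 by rewrite uE; exact: (weak_solution_init hw).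
  rewrite (ipBl l0 (h1_wD_L2 v0) (h1_wD_L2 chi)) (ipBl w02 (h1_L2 v0) (h1_L2 chi)).
  rewrite (semiBl (d_semi h1_model_of)) (semiBl (p_semi h1_model_of)) /=.
  have E1 := ae01_ip (h1_wD_L2 u) l0 (h1_wD_L2 chi) wDu.
  have E2 := ae01_ip (h1_L2 u) w02 (h1_L2 chi) uw.
  exact: etrans (f_equal2 (fun x y => x - ip (wD v0) (wD chi) + lam * (y - ip v0 chi)) E1 E2).
have := HK _ _ _ (fe_galerkin sP) _ Xwh (wh_curve_continuous sP Hwh)
  (wh_evolves hmu hnu hwd hc sP Hwh) init t t0.
set z := to_h1 (w t) - to_h1 (wh t) => -[HN Hp].
have zE : h1_val z = w t \- wh t.
  by rewrite h1_subE (w_h1E hw t0) (to_h1E sP (semidiscrete_fe Hwh t0)).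
have /andP[h0 h1'] := mesh_size01 sP.
have E0 : 0 <= expR (- (alpha * t)) by exact: expR_ge0.
rewrite -zE triple_normE.
have split_K (x : R) : 0 <= x ->
    2 * (K * x) <= (2 * K * Num.sqrt mu + K) * ((Num.sqrt mu)^-1 * x).
  move=> x0.
  have -> : (2 * K * Num.sqrt mu + K) * ((Num.sqrt mu)^-1 * x) =
      2 * (K * x) + K * x / Num.sqrt mu by field; rewrite gt_eqF.
  by rewrite lerDl !mulr_ge0// invr_ge0 ltW.
split; last first.
  apply: (le_trans HN); rewrite -mulrA; apply: ler_wpM2r; first exact: mulr_ge0.
  by rewrite lerDr; apply: mulr_ge0; [exact: mulr_ge0|exact: ltW].
case=> [|[|//]] _.
  rewrite Hnorm0E (le_trans Hp)// -[K * _ * _]mulrA -[X in _ * X]mulrA.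
  have x0 : 0 <= mesh_size s ^+ 2 * expR (- (alpha * t)) by rewrite mulr_ge0 ?sqr_ge0.
  by have := split_K _ x0; have := mulr_ge0 K0 x0; rewrite subn0; lra.
apply: (le_trans (Hnorm1_le z)); rewrite -[X in _ <= _ * X]mulrA.
have x0 : 0 <= mesh_size s ^+ 1 * expR (- (alpha * t)) by rewrite mulr_ge0 ?exprn_ge0.
apply: le_trans (split_K _ x0); rewrite ler_pM2l// mulrA expr1.
exact: HN.
Qed.
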